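(* (i) There exist $\mathfrak g$, $\sigma\in\mathrm{Aut}(\mathfrak g)$ and an automorphism of finite order of $L(\mathfrak g,\sigma)$ which is not conjugate in $\mathrm{Aut}(L(\mathfrak g,\sigma))$ to any automorphism of the form $u\mapsto \big(t\mapsto\varphi_0(u(\lambda(t)))\big)$ with $\varphi_0\in\mathrm{Aut}(\mathfrak g)$ constant. (ii) For every $\sigma\in\mathrm{Aut}(\mathfrak g)$ and every automorphism $\varphi$ of $L(\mathfrak g,\sigma)$ of finite order there exist $\tilde\sigma\in\mathrm{Aut}(\mathfrak g)$ and a Lie algebra isomorphism $\psi:L(\mathfrak g,\sigma)\to L(\mathfrak g,\tilde\sigma)$ such that $\tilde\varphi:=\psi\varphi\psi^{-1}$ is of the form $(\tilde\varphi u)(t)=\tilde\varphi_0\big(u(\epsilon t+t_0)\big)$ for some constant $\tilde\varphi_0\in\mathrm{Aut}(\mathfrak g)$, $\epsilon\in\{\pm1\}$ and $t_0\in\mathbb R$.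
   Context: $\mathfrak g$ is a simple Lie algebra over $\mathbb F\in\{\mathbb R,\mathbb C\}$, compact if $\mathbb F=\mathbb R$. For $\sigma\in\mathrm{Aut}(\mathfrak g)$, $L(\mathfrak g,\sigma)=\{u:\mathbb R\to\mathfrak g\text{ smooth}:u(t+2\pi)=\sigma(u(t))\ \forall t\}$ with pointwise bracket. Every automorphism of $L(\mathfrak g,\sigma)$ has the form $(\varphi u)(t)=\varphi_t(u(\lambda(t)))$ with $\lambda$ a diffeomorphism of $\mathbb R$ and $t\mapsto\varphi_t\in\mathrm{Aut}(\mathfrak g)$ smooth. *)

(* Defs.v *)
From Stdlib Require Vectors.Fin.
From Stdlib Require Import Reals.
Open Scope R_scope.

Definition vec (n : nat) := Fin.t n -> R.
Definition vzero (n : nat) : vec n := fun _ => 0.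
Definition vadd {n} (x y : vec n) : vec n := fun i => x i + y i.
Definition vscal {n} (a : R) (x : vec n) : vec n := fun i => a * x i.
Definition vopp {n} (x : vec n) : vec n := fun i => - x i.

Fixpoint fsum (n : nat) : (Fin.t n -> R) -> R :=
  match n with
  | O => fun _ => 0
  | S m => fun f => f Fin.F1 + fsum m (fun i => f (Fin.FS i))
  end.

Definition ebasis {n} (i : Fin.t n) : vec n :=
  fun j => if Fin.eq_dec i j then 1 else 0.

Definition rlinear {n m} (f : vec n -> vec m) : Prop :=
  (forall x y, f (vadd x y) = vadd (f x) (f y)) /\
  (forall a x, f (vscal a x) = vscal a (f x)).

Definition is_lie_bracket {n} (br : vec n -> vec n -> vec n) : Prop :=
  (forall y, rlinear (fun x => br x y)) /\
  (forall x, rlinear (br x)) /\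
  (forall x, br x x = vzero n) /\
  (forall x y z, vadd (br x (br y z)) (vadd (br y (br z x)) (br z (br x y)))
                 = vzero n).

(* A finite-dimensional Lie algebra over F in {R, C}, with underlying real
   vector space R^ldim.  lJ = None : F = R.
   lJ = Some J : F = C, J being multiplication by i. *)
Record liealg := mkLie {
  ldim : nat;
  lbr : vec ldim -> vec ldim -> vec ldim;
  lJ : option (vec ldim -> vec ldim)
}.

Definition cstruct_ok (g : liealg) : Prop :=
  match lJ g with
  | None => True
  | Some J => rlinear J /\ (forall x, J (J x) = vopp x) /\
              (forall x y, lbr g (J x) y = J (lbr g x y))
  end.

Definition flinear (g : liealg) (f : vec (ldim g) -> vec (ldim g)) : Prop :=
  rlinear f /\
  match lJ g with
  | None => True
  | Some J => forall x, f (J x) = J (f x)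
  end.

Definition is_ideal (g : liealg) (I : vec (ldim g) -> Prop) : Prop :=
  I (vzero _) /\ (forall x y, I x -> I y -> I (vadd x y)) /\
  (forall a x, I x -> I (vscal a x)) /\
  (match lJ g with None => True | Some J => forall x, I x -> I (J x) end) /\
  (forall x y, I y -> I (lbr g x y)).

Definition is_simple (g : liealg) : Prop :=
  is_lie_bracket (lbr g) /\
  (exists x y, lbr g x y <> vzero _) /\
  (forall I, is_ideal g I ->
     (forall x, I x -> x = vzero _) \/ (forall x, I x)).

Definition killing (g : liealg) (x y : vec (ldim g)) : R :=
  fsum (ldim g) (fun i => lbr g x (lbr g y (ebasis i)) i).

Definition compact (g : liealg) : Prop :=
  forall x, x <> vzero _ -> killing g x x < 0.

Definition admissible (g : liealg) : Prop :=
  is_simple g /\ cstruct_ok g /\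
  match lJ g with None => compact g | Some _ => True end.

Definition is_gaut (g : liealg) (f : vec (ldim g) -> vec (ldim g)) : Prop :=
  flinear g f /\ (forall x y, f (lbr g x y) = lbr g (f x) (f y)) /\
  exists h, (forall x, h (f x) = x) /\ (forall x, f (h x) = x).

Definition smoothR (f : R -> R) : Prop :=
  exists D : nat -> R -> R, D O = f /\
    forall k t, derivable_pt_lim (D k) t (D (S k) t).

Definition is_diffeo (lam : R -> R) : Prop :=
  smoothR lam /\ exists mu, smoothR mu /\
    (forall t, mu (lam t) = t) /\ (forall t, lam (mu t) = t).

Definition loop (g : liealg) := R -> vec (ldim g).

Definition inL (g : liealg) (sigma : vec (ldim g) -> vec (ldim g)) (u : loop g)
  : Prop :=
  (forall i, smoothR (fun t => u t i)) /\
  (forall t, u (t + 2 * PI) = sigma (u t)).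

Definition is_liso (g : liealg) (sigma sigma' : vec (ldim g) -> vec (ldim g))
  (Phi : loop g -> loop g) : Prop :=
  (forall u, inL g sigma u -> inL g sigma' (Phi u)) /\
  (forall u v, inL g sigma u -> inL g sigma v ->
     Phi (fun t => vadd (u t) (v t)) = (fun t => vadd (Phi u t) (Phi v t))) /\
  (forall a u, inL g sigma u ->
     Phi (fun t => vscal a (u t)) = (fun t => vscal a (Phi u t))) /\
  (match lJ g with
   | None => True
   | Some J => forall u, inL g sigma u ->
       Phi (fun t => J (u t)) = (fun t => J (Phi u t))
   end) /\
  (forall u v, inL g sigma u -> inL g sigma v ->
     Phi (fun t => lbr g (u t) (v t)) = (fun t => lbr g (Phi u t) (Phi v t))) /\
  exists Psi : loop g -> loop g,
    (forall v, inL g sigma' v -> inL g sigma (Psi v)) /\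
    (forall u, inL g sigma u -> Psi (Phi u) = u) /\
    (forall v, inL g sigma' v -> Phi (Psi v) = v).

Definition is_laut (g : liealg) (sigma : vec (ldim g) -> vec (ldim g))
  (Phi : loop g -> loop g) : Prop := is_liso g sigma sigma Phi.

Definition finite_order (g : liealg) (sigma : vec (ldim g) -> vec (ldim g))
  (Phi : loop g -> loop g) : Prop :=
  exists k : nat, (0 < k)%nat /\
    forall u, inL g sigma u -> Nat.iter k Phi u = u.

(* Main.v *)
Require Import Defs.
From Stdlib Require Vectors.Fin.
From Stdlib Require Import Reals Lra Lia Psatz ZArith FunctionalExtensionality.
From Stdlib Require Import PSeries_reg Ranalysis5 ClassicalEpsilon Classical.
From Coquelicot Require Import Coquelicot.
Open Scope R_scope.

(** An isomorphism of twisted loop algebras followed by an evaluation is a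
    surjection [delta] onto [g].  Since [g] is simple and nonabelian, [ker delta]
    is stable under multiplication by periodic functions, so these functions act
    on [g]; the functions acting by 0 have a common zero [s] by compactness, and,
    because the centroid is finite-dimensional and a division ring, every function
    [f] acts by [f s].  Hence [delta u] depends on [u s] only, and every
    isomorphism has the form [u |-> (t |-> phi_t (u (lam t)))].

    If such an automorphism [Phi] has finite order, averaging the iterates of
    [lam] gives a coordinate in which [lam] is [t |-> eps t + t0], and averaging
    the conjugates of [d/dt] under the powers of [Phi] gives a connection
    [d/dt + X], with values in derivations, that is invariant under [Phi] and the
    twist.  Parallel transport makes the connection trivial; then the twist and
    the [phi_t], which commute with it, become constant.

    For the first part, half-turns of R^3 about an axis that rotates by a
    half-turn over a period form a smooth loop in SO(3).  If they were conjugate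
    to a constant, the axis could be oriented periodically. *)

(** [is_liso] is purely algebraic: no continuity is assumed, and a map [loop g -> loop g] is
    constrained only on [inL]. The pointwise form of an isomorphism therefore has to be proved, and
    the smoothness of [lam] and [phi] is recovered from the sole fact that smooth loops go to smooth
    loops. In the finite-order part the obstacle is orientation. If [lam] reverses it, the plain
    mean of its iterates need not be monotone; so the iterate number [j] is weighted by [m ^ j],
    where [m] is the degree of [lam], and the order is doubled to make [m ^ k = 1]. Automorphisms of
    [g] have no mean, but connections form an affine space, so the mean of connections is again a
    connection. Since it takes values in derivations, its parallel transport consists of
    automorphisms; this needs linear differential equations only, and no Lie group structure on the
    automorphisms of [g]. *)

Lemma choice {A B : Type} (P : A -> B -> Prop) :
  (forall x, exists y, P x y) -> exists f, forall x, P x (f x).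
Proof.
  intros H; exists (fun x => proj1_sig (constructive_indefinite_description _ (H x))).
  intros x; apply proj2_sig.
Qed.

(** * Smooth functions of one real variable *)

(** The single global sequence of derivatives in [smoothR] does not suit inductive proofs. This
    version is graded by the order, so that product, chain and quotient rules go by induction on
    [k], and local, so that functions given by cases can be treated near each point. *)
Fixpoint Ck_at (k : nat) (f : R -> R) (t : R) : Prop :=
  match k with
  | O => True
  | S k => exists f' : R -> R,
      locally t (fun x : R => is_derive f x (f' x)) /\ Ck_at k f' t
  end.

Definition smooth_at (f : R -> R) (t : R) : Prop := forall k, Ck_at k f t.

Lemma Ck_at_ext_loc k f g t :
  locally t (fun x => f x = g x) -> Ck_at k f t -> Ck_at k g t.
Proof.
  destruct k as [|k]; [easy|].
  intros E (f' & D & C); exists f'; split; [|exact C].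
  generalize (filter_and _ _ (locally_locally _ _ E) D).
  apply filter_imp; intros x [E' D'].
  now apply (is_derive_ext_loc f).
Qed.

Lemma Ck_at_pred k f t : Ck_at (S k) f t -> Ck_at k f t.
Proof.
  revert f; induction k as [|k IH]; [easy|].
  intros f (f' & D & C); exists f'; auto.
Qed.

Lemma Ck_at_loc_derive k f t :
  Ck_at (S k) f t -> locally t (fun x => ex_derive f x).
Proof.
  intros (f' & D & _); revert D; apply filter_imp; intros x H; now exists (f' x).
Qed.

Lemma Ck_at_continuous k f t : Ck_at (S k) f t -> continuous f t.
Proof.
  intros H; apply (ex_derive_continuous f); apply locally_singleton.
  exact (Ck_at_loc_derive k f t H).
Qed.

Lemma Ck_at_const k a t : Ck_at k (fun _ => a) t.
Proof.
  revert a; induction k as [|k IH]; intros a; [easy|].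
  exists (fun _ => 0); split; [|apply IH].
  apply filter_forall; intros x; apply (is_derive_const a x).
Qed.

Lemma Ck_at_id k t : Ck_at k (fun x => x) t.
Proof.
  destruct k as [|k]; [easy|].
  exists (fun _ => 1); split; [|apply Ck_at_const].
  apply filter_forall; intros x; apply (is_derive_id x).
Qed.

Lemma Ck_at_plus k f g t :
  Ck_at k f t -> Ck_at k g t -> Ck_at k (fun x => f x + g x) t.
Proof.
  revert f g; induction k as [|k IH]; intros f g; [easy|].
  intros (f' & Df & Cf) (g' & Dg & Cg); exists (fun x => f' x + g' x).
  split; [|now apply IH].
  generalize (filter_and _ _ Df Dg); apply filter_imp; intros x [H1 H2].
  now apply (is_derive_plus f g).
Qed.

Lemma Ck_at_mult k f g t :
  Ck_at k f t -> Ck_at k g t -> Ck_at k (fun x => f x * g x) t.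
Proof.
  revert f g; induction k as [|k IH]; intros f g; [easy|].
  intros Hf Hg.
  pose proof (Ck_at_pred _ _ _ Hf) as Pf; pose proof (Ck_at_pred _ _ _ Hg) as Pg.
  destruct Hf as (f' & Df & Cf), Hg as (g' & Dg & Cg).
  exists (fun x => f' x * g x + f x * g' x).
  split; [|apply Ck_at_plus; now apply IH].
  generalize (filter_and _ _ Df Dg); apply filter_imp; intros x [H1 H2].
  apply (is_derive_mult f g); auto; intros; apply Rmult_comm.
Qed.

Lemma Ck_at_comp k f g t :
  Ck_at k g (f t) -> Ck_at k f t -> Ck_at k (fun x => g (f x)) t.
Proof.
  revert f g; induction k as [|k IH]; intros f g; [easy|].
  intros (g' & Dg & Cg) Hf.
  pose proof (Ck_at_pred _ _ _ Hf) as Pf.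
  pose proof (Ck_at_continuous _ _ _ Hf) as Kf.
  destruct Hf as (f' & Df & Cf).
  exists (fun x => f' x * g' (f x)).
  split; [|apply Ck_at_mult; auto].
  pose proof (Kf _ Dg : locally t (fun x : R => is_derive g (f x) (g' (f x)))) as L.
  generalize (filter_and _ _ L Df); apply filter_imp; intros x [H1 H2].
  now apply (is_derive_comp g f).
Qed.

Lemma Ck_at_inv k f t : f t <> 0 -> Ck_at k f t -> Ck_at k (fun x => / f x) t.
Proof.
  intros Nz; revert f Nz; induction k as [|k IH]; intros f Nz; [easy|].
  intros Hf.
  pose proof (Ck_at_pred _ _ _ Hf) as Pf.
  pose proof (Ck_at_continuous _ _ _ Hf) as Kf.
  destruct Hf as (f' & Df & Cf).
  exists (fun x => (-1 * f' x) * (/ f x * / f x)).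
  split.
  - assert (L : locally t (fun x => f x <> 0)).
    { apply (Kf (fun y => y <> 0)).
      exists (mkposreal _ (Rabs_pos_lt _ Nz)); intros y Hy.
      unfold ball in Hy; simpl in Hy; unfold AbsRing_ball, abs, minus, plus, opp in Hy;
        simpl in Hy.
      intros ->; rewrite Rplus_0_l, Rabs_Ropp in Hy; lra. }
    generalize (filter_and _ _ L Df); apply filter_imp; intros x [H1 H2].
    replace (-1 * f' x * (/ f x * / f x)) with (- f' x / f x ^ 2) by (field; auto).
    now apply is_derive_inv.
  - repeat apply Ck_at_mult; auto using Ck_at_const.
Qed.

Lemma smooth_at_ext_loc f g t :
  locally t (fun x => f x = g x) -> smooth_at f t -> smooth_at g t.
Proof. intros E H k; exact (Ck_at_ext_loc k f g t E (H k)). Qed.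

Lemma smooth_at_inv f t : f t <> 0 -> smooth_at f t -> smooth_at (fun x => / f x) t.
Proof. intros N H k; apply Ck_at_inv; auto. Qed.

Lemma Ck_at_S_Derive k f t : Ck_at (S k) f t -> Ck_at k (Derive f) t.
Proof.
  intros (f' & D & C); revert C; apply Ck_at_ext_loc; revert D; apply filter_imp.
  intros x H; symmetry; now apply is_derive_unique.
Qed.

Lemma smoothR_smooth_at f : smoothR f <-> forall t, smooth_at f t.
Proof.
  split.
  - intros (D & <- & HD) t k; change (D O) with (D (0 + 0)%nat).
    (* The induction needs the claim for every [D m], whose derivative is [D (S m)]. *)
    generalize 0%nat at 1.
    revert t; induction k as [|k IH]; intros t m; [easy|].
    exists (D (S m + 0)%nat); split; [|apply IH].
    apply filter_forall; intros x; apply is_derive_Reals, HD.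
  - intros H; exists (fun k => Nat.iter k Derive f); split; [reflexivity|].
    assert (A : forall k t, smooth_at (Nat.iter k Derive f) t).
    { induction k as [|k IH]; intros t; [apply H|].
      intros m; simpl; apply Ck_at_S_Derive, IH. }
    intros k t; apply is_derive_Reals; simpl; apply Derive_correct.
    exact (locally_singleton _ _ (Ck_at_loc_derive 0 _ _ (A k t 1%nat))).
Qed.

Lemma smoothR_ext f g : (forall t, f t = g t) -> smoothR f -> smoothR g.
Proof. intros E; now replace g with f by (now apply functional_extensionality). Qed.

(** A different smooth model may be used near each point; periodisations and functions obtained by
    pointwise choice are handled in this way. *)
Lemma smoothR_local f :
  (forall t, exists g, smoothR g /\ locally t (fun x => g x = f x)) -> smoothR f.
Proof.
  intros H; apply smoothR_smooth_at; intros t; destruct (H t) as (g & S & L).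
  apply (smooth_at_ext_loc g f t L); now apply smoothR_smooth_at.
Qed.

Lemma smoothR_const a : smoothR (fun _ => a).
Proof. apply smoothR_smooth_at; intros t k; apply Ck_at_const. Qed.

Lemma smoothR_id : smoothR (fun x => x).
Proof. apply smoothR_smooth_at; intros t k; apply Ck_at_id. Qed.

Lemma smoothR_plus f g : smoothR f -> smoothR g -> smoothR (fun x => f x + g x).
Proof.
  rewrite !smoothR_smooth_at; intros H1 H2 t k; apply Ck_at_plus; [apply H1|apply H2].
Qed.

Lemma smoothR_mult f g : smoothR f -> smoothR g -> smoothR (fun x => f x * g x).
Proof.
  rewrite !smoothR_smooth_at; intros H1 H2 t k; apply Ck_at_mult; [apply H1|apply H2].
Qed.

Lemma smoothR_opp f : smoothR f -> smoothR (fun x => - f x).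
Proof.
  intros H; apply (smoothR_ext (fun x => -1 * f x)); [intros; ring|].
  apply smoothR_mult; auto using smoothR_const.
Qed.

Lemma smoothR_minus f g : smoothR f -> smoothR g -> smoothR (fun x => f x - g x).
Proof. intros; apply smoothR_plus; auto using smoothR_opp. Qed.

Lemma smoothR_comp f g : smoothR g -> smoothR f -> smoothR (fun x => g (f x)).
Proof.
  rewrite !smoothR_smooth_at; intros H1 H2 t k; apply Ck_at_comp; [apply H1|apply H2].
Qed.

Lemma smoothR_inv f : (forall t, f t <> 0) -> smoothR f -> smoothR (fun x => / f x).
Proof.
  rewrite !smoothR_smooth_at; intros H1 H2 t; apply smooth_at_inv; auto.
Qed.

Lemma smoothR_ex_derive f t : smoothR f -> ex_derive f t.
Proof.
  rewrite smoothR_smooth_at; intros H.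
  exact (locally_singleton _ _ (Ck_at_loc_derive 0 _ _ (H t 1%nat))).
Qed.

Lemma smoothR_is_derive f t : smoothR f -> is_derive f t (Derive f t).
Proof. intros H; apply Derive_correct, smoothR_ex_derive, H. Qed.

Lemma smoothR_Derive f : smoothR f -> smoothR (Derive f).
Proof.
  rewrite !smoothR_smooth_at; intros H t k; apply Ck_at_S_Derive, H.
Qed.

Lemma smoothR_continuous f t : smoothR f -> continuous f t.
Proof. intros H; apply (ex_derive_continuous f), smoothR_ex_derive, H. Qed.

Lemma smoothR_antiderivative f f' :
  (forall t, is_derive f t (f' t)) -> smoothR f' -> smoothR f.
Proof.
  rewrite !smoothR_smooth_at; intros D H t [|k]; [easy|].
  exists f'; split; [now apply filter_forall | apply H].
Qed.

Lemma smoothR_sin_cos : smoothR sin /\ smoothR cos.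
Proof.
  assert (A : forall k t, Ck_at k sin t /\ Ck_at k cos t).
  { induction k as [|k IH]; intros t; [easy|]; split.
    - exists cos; split; [|apply IH].
      apply filter_forall; intros x; apply is_derive_Reals, derivable_pt_lim_sin.
    - exists (fun x => -1 * sin x); split.
      + apply filter_forall; intros x; apply is_derive_Reals.
        replace (-1 * sin x) with (- sin x) by ring; apply derivable_pt_lim_cos.
      + apply Ck_at_mult; [apply Ck_at_const | apply IH]. }
  split; apply smoothR_smooth_at; intros t k; apply A.
Qed.

Lemma smoothR_sin f : smoothR f -> smoothR (fun t => sin (f t)).
Proof. apply smoothR_comp, smoothR_sin_cos. Qed.

Lemma smoothR_cos f : smoothR f -> smoothR (fun t => cos (f t)).
Proof. apply smoothR_comp, smoothR_sin_cos. Qed.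

Lemma smoothR_fsum n (F : Fin.t n -> R -> R) :
  (forall i, smoothR (F i)) -> smoothR (fun t => fsum n (fun i => F i t)).
Proof.
  induction n as [|n IH]; intros H; simpl; [apply smoothR_const|].
  apply smoothR_plus; [apply H|]; apply (IH (fun i => F (Fin.FS i))); auto.
Qed.

Lemma smoothR_is_derive_RInt f t : smoothR f -> is_derive (RInt f 0) t (f t).
Proof.
  intros H; apply (is_derive_RInt f _ 0 t); [|now apply smoothR_continuous].
  apply filter_forall; intros b; apply (RInt_correct f), (ex_RInt_continuous f).
  intros z _; now apply smoothR_continuous.
Qed.

Lemma smoothR_RInt f : smoothR f -> smoothR (RInt f 0).
Proof.
  intros H; apply (smoothR_antiderivative _ f); auto using smoothR_is_derive_RInt.
Qed.

Lemma is_derive_0_const f : (forall t, is_derive f t 0) -> forall s t, f s = f t.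
Proof.
  intros D s t.
  destruct (MVT_gen f t s (fun _ => 0)) as (c & _ & E).
  - intros x _; apply D.
  - intros x _; apply continuity_pt_filterlim, (ex_derive_continuous f).
    now exists 0.
  - rewrite Rmult_0_l in E; lra.
Qed.

(** * A smooth bump function *)

(* [flat m x = x^-m exp(-1/x)] for [x > 0], extended by 0; the family is stable under differentiation up to linear combinations. *)
Definition flat (m : nat) (x : R) : R :=
  if Rlt_dec 0 x then (/ x) ^ m * exp (- / x) else 0.

Lemma flat_pos m x : 0 < x -> flat m x = (/ x) ^ m * exp (- / x).
Proof. intros H; unfold flat; destruct (Rlt_dec 0 x); [easy|lra]. Qed.

Lemma flat_neg m x : x <= 0 -> flat m x = 0.
Proof. intros H; unfold flat; destruct (Rlt_dec 0 x); [lra|easy]. Qed.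

(** With [y = / x], the Taylor bound [y ^ (m + 2) / (m + 2)! <= exp y] turns into this estimate. The
    factor [x * x] is what makes the derivative at 0 vanish. *)
Lemma flat_bound m x : 0 < x -> 0 < flat m x <= INR (fact (S (S m))) * (x * x).
Proof.
  intros Hx; rewrite flat_pos by easy.
  assert (Hy : 0 < / x) by now apply Rinv_0_lt_compat.
  pose proof (exp_pos (- / x)) as He.
  pose proof (pow_lt (/ x) m Hy) as Hp.
  split; [now apply Rmult_lt_0_compat|].
  assert (E : (/ x) ^ S (S m) / INR (fact (S (S m))) <= exp (/ x)).
  { eapply Rle_trans; [|apply (exp_ge_taylor (/ x) (S (S m))); lra].
    rewrite tech5.
    assert (0 <= sum_f_R0 (fun k => (/ x) ^ k / INR (fact k)) (S m)); [|lra].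
    apply cond_pos_sum; intros k; apply Rlt_le, Rdiv_lt_0_compat;
      [now apply pow_lt | apply INR_fact_lt_0]. }
  pose proof (INR_fact_lt_0 (S (S m))) as Hf.
  set (F := INR (fact (S (S m)))) in *; clearbody F.
  apply Rle_div_l in E; [|lra].
  assert (X : exp (/ x) * exp (- / x) = 1).
  { rewrite <- exp_plus, Rplus_opp_r; apply exp_0. }
  replace ((/ x) ^ m * exp (- / x)) with ((/ x) ^ S (S m) * (x * x) * exp (- / x))
    by (simpl; field; lra).
  replace (F * (x * x)) with (exp (/ x) * F * (x * x) * exp (- / x))
    by (rewrite <- (Rmult_1_r (F * (x * x))), <- X; ring).
  apply Rmult_le_compat_r; [lra|]; apply Rmult_le_compat_r; nra.
Qed.

Lemma is_derive_flat m x :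
  is_derive (flat m) x (flat (S (S m)) x + - INR m * flat (S m) x).
Proof.
  destruct (total_order_T x 0) as [[Hx|Hx]|Hx].
  - rewrite !flat_neg by lra; rewrite Rmult_0_r, Rplus_0_r.
    apply (is_derive_ext_loc (fun _ => 0)); [|apply (is_derive_const 0 x)].
    generalize (open_lt 0 x Hx); apply filter_imp; intros y Hy.
    now rewrite flat_neg by lra.
  (* At 0 the difference quotient is at most [F * h] by the quadratic bound. *)
  - subst x; rewrite !flat_neg by lra; rewrite Rmult_0_r, Rplus_0_r.
    apply is_derive_Reals; intros eps Heps.
    set (F := INR (fact (S (S m)))).
    assert (HF : 0 < F) by apply INR_fact_lt_0.
    assert (Hd : 0 < eps / F) by now apply Rdiv_lt_0_compat.
    exists (mkposreal _ Hd); intros h Hh Hlt; simpl in Hlt.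
    rewrite Rplus_0_l, (flat_neg m 0), !Rminus_0_r by lra.
    destruct (Rle_dec h 0) as [H0|H0].
    + rewrite flat_neg by easy; unfold Rdiv; rewrite Rmult_0_l, Rabs_R0; lra.
    + destruct (flat_bound m h) as [B1 B2]; [lra|]; fold F in B2.
      rewrite Rabs_pos_eq in Hlt by lra.
      rewrite Rabs_pos_eq by (apply Rlt_le, Rdiv_lt_0_compat; lra).
      apply Rlt_div_l; [lra|].
      apply Rlt_div_r in Hlt; [|lra].
      nra.
  - rewrite !flat_pos by lra.
    apply (is_derive_ext_loc (fun x => (/ x) ^ m * exp (- / x))).
    + generalize (open_gt 0 x Hx); apply filter_imp; intros y Hy.
      now rewrite flat_pos by lra.
    + auto_derive; [lra|].
      destruct m as [|m]; [simpl; field; lra|].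
      rewrite S_INR; simpl pred; simpl pow.
      field; lra.
Qed.

Lemma smoothR_flat m : smoothR (flat m).
Proof.
  apply smoothR_smooth_at; intros t k; revert m.
  induction k as [|k IH]; intros m; [easy|].
  exists (fun x => flat (S (S m)) x + - INR m * flat (S m) x); split.
  - apply filter_forall; intros x; apply is_derive_flat.
  - apply Ck_at_plus; [apply IH|]; apply Ck_at_mult; [apply Ck_at_const | apply IH].
Qed.

(** Equal to 1 on [-1, 1] and to 0 outside (-2, 2). Since 2 < PI, its translates by multiples of
    [2 * PI] have disjoint supports. *)
Definition bump (t : R) : R :=
  flat 0 (4 - t * t) * / (flat 0 (4 - t * t) + flat 0 (t * t - 1)).

Lemma smoothR_bump : smoothR bump.
Proof.
  unfold bump.
  assert (S1 : smoothR (fun t => flat 0 (4 - t * t))).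
  { apply (smoothR_comp (fun t => 4 - t * t)); [apply smoothR_flat|].
    auto using smoothR_minus, smoothR_mult, smoothR_const, smoothR_id. }
  apply smoothR_mult; [exact S1|]; apply smoothR_inv.
  - intros t; destruct (Rlt_dec (t * t) 4).
    + pose proof (flat_bound 0 (4 - t * t)) as B.
      destruct (Rlt_dec 1 (t * t)).
      * pose proof (flat_bound 0 (t * t - 1)); lra.
      * rewrite (flat_neg 0 (t * t - 1)) by lra; lra.
    + rewrite (flat_neg 0 (4 - t * t)) by lra.
      pose proof (flat_bound 0 (t * t - 1)); lra.
  - apply smoothR_plus; [exact S1|].
    apply (smoothR_comp (fun t => t * t - 1)); [apply smoothR_flat|].
    auto using smoothR_minus, smoothR_mult, smoothR_const, smoothR_id.
Qed.

Lemma bump_1 t : Rabs t <= 1 -> bump t = 1.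
Proof.
  intros H; unfold bump.
  assert (t * t <= 1) by (apply Rabs_le_between in H; nra).
  rewrite (flat_neg 0 (t * t - 1)), Rplus_0_r by lra.
  apply Rinv_r; pose proof (flat_bound 0 (4 - t * t)); lra.
Qed.

Lemma bump_0 t : 2 <= Rabs t -> bump t = 0.
Proof.
  intros H; unfold bump; rewrite flat_neg; [ring|].
  unfold Rabs in H; destruct (Rcase_abs t); nra.
Qed.

(** * Linear algebra in [vec n] *)

Ltac vring :=
  apply functional_extensionality; intro; unfold vadd, vscal, vopp, vzero; ring.

Lemma fsum_ext n (F G : Fin.t n -> R) : (forall i, F i = G i) -> fsum n F = fsum n G.
Proof. intros H; f_equal; now apply functional_extensionality. Qed.

Lemma fsum_plus n (F G : Fin.t n -> R) :
  fsum n (fun i => F i + G i) = fsum n F + fsum n G.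
Proof.
  induction n as [|n IH]; simpl; [ring|].
  rewrite (IH (fun i => F (Fin.FS i)) (fun i => G (Fin.FS i))); ring.
Qed.

Lemma fsum_scal n a (F : Fin.t n -> R) : fsum n (fun i => a * F i) = a * fsum n F.
Proof.
  induction n as [|n IH]; simpl; [ring|].
  rewrite (IH (fun i => F (Fin.FS i))); ring.
Qed.

Lemma fsum_0 n (F : Fin.t n -> R) : (forall i, F i = 0) -> fsum n F = 0.
Proof.
  intros H; rewrite (fsum_ext n F (fun i => 0 * F i)); [rewrite fsum_scal; ring|].
  intros i; rewrite H; ring.
Qed.

Lemma fsum_ebasis n (x : vec n) j : fsum n (fun i => x i * ebasis i j) = x j.
Proof.
  unfold ebasis; induction j as [n|n j IH]; simpl fsum.
  - destruct (Fin.eq_dec Fin.F1 Fin.F1) as [_|N]; [|easy].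
    rewrite fsum_0; [ring|]; intros i.
    destruct (Fin.eq_dec (Fin.FS i) Fin.F1) as [E|_]; [inversion E | ring].
  - destruct (Fin.eq_dec Fin.F1 (Fin.FS j)) as [E|_]; [inversion E|].
    rewrite Rmult_0_r, Rplus_0_l, <- (IH (fun i => x (Fin.FS i))).
    apply fsum_ext; intros i; f_equal.
    destruct (Fin.eq_dec i j) as [E0|N], (Fin.eq_dec (Fin.FS i) (Fin.FS j)) as [E|N'];
      try easy; exfalso; [now subst | now apply Fin.FS_inj in E].
Qed.

Section Linear.
Context {n m : nat} (f : vec n -> vec m) (Hf : rlinear f).

Lemma rlinear_add x y : f (vadd x y) = vadd (f x) (f y).
Proof. apply Hf. Qed.

Lemma rlinear_scal a x : f (vscal a x) = vscal a (f x).
Proof. apply Hf. Qed.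

Lemma rlinear_zero : f (vzero n) = vzero m.
Proof.
  replace (vzero n) with (vscal 0 (vzero n)) by vring.
  rewrite rlinear_scal; vring.
Qed.

Lemma rlinear_opp x : f (vopp x) = vopp (f x).
Proof.
  replace (vopp x) with (vscal (-1) x) by vring.
  rewrite rlinear_scal; vring.
Qed.

Lemma rlinear_fsum k (F : Fin.t k -> vec n) j :
  f (fun l => fsum k (fun i => F i l)) j = fsum k (fun i => f (F i) j).
Proof.
  revert j; induction k as [|k IH]; intros j; simpl.
  - change (fun _ : Fin.t n => 0) with (vzero n); now rewrite rlinear_zero.
  - rewrite <- (IH (fun i => F (Fin.FS i))).
    change (f (F Fin.F1) j + f (fun l => fsum k (fun i => F (Fin.FS i) l)) j)
      with (vadd (f (F Fin.F1)) (f (fun l => fsum k (fun i => F (Fin.FS i) l))) j).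
    now rewrite <- rlinear_add.
Qed.

Lemma rlinear_coord x j : f x j = fsum n (fun i => x i * f (ebasis i) j).
Proof.
  transitivity (f (fun l => fsum n (fun i => vscal (x i) (ebasis i) l)) j).
  - f_equal; f_equal; apply functional_extensionality; intros l.
    symmetry; apply (fsum_ebasis n x l).
  - rewrite (rlinear_fsum n (fun i => vscal (x i) (ebasis i))).
    apply fsum_ext; intros i; now rewrite rlinear_scal.
Qed.

Lemma rlinear_eq_inj :
  (forall x, f x = vzero m -> x = vzero n) -> forall x y, f x = f y -> x = y.
Proof.
  intros K x y E.
  assert (Z : vadd x (vopp y) = vzero n).
  { apply K; rewrite rlinear_add, rlinear_opp, E; vring. }
  replace x with (vadd (vadd x (vopp y)) y) by vring.
  rewrite Z; vring.
Qed.
End Linear.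

Lemma rlinear_comp n m k (f : vec n -> vec m) (h : vec m -> vec k) :
  rlinear f -> rlinear h -> rlinear (fun x => h (f x)).
Proof. intros [A B] [C D]; split; intros; [rewrite A, C | rewrite B, D]; easy. Qed.

Lemma vec_neq n (x y : vec n) : x <> y -> exists i, x i <> y i.
Proof.
  intros N; apply not_all_ex_not; intros E; apply N; now apply functional_extensionality.
Qed.

Definition vcons {n} (a : R) (x : vec n) : vec (S n) :=
  fun i => Fin.caseS' i (fun _ => R) a x.

Definition vtail {n} (x : vec (S n)) : vec n := fun i => x (Fin.FS i).

Lemma vec_S_ext n (x y : vec (S n)) :
  x Fin.F1 = y Fin.F1 -> vtail x = vtail y -> x = y.
Proof.
  intros E T; apply functional_extensionality; intros i.
  apply (Fin.caseS' i); [exact E|]; intros j; exact (f_equal (fun z => z j) T).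
Qed.

Lemma rlinear_vtail n : rlinear (@vtail n).
Proof. now split. Qed.

(** An injective parametrisation of a subspace of the kernel of a functional replaces dimension
    theory: it lets [rlinear_kernel] remove one equation and one unknown at a time. *)
Lemma functional_kernel m (c : Fin.t (S m) -> R) :
  exists iota : vec m -> vec (S m), rlinear iota /\
    (forall x, iota x = vzero _ -> x = vzero _) /\
    forall x, fsum (S m) (fun i => c i * iota x i) = 0.
Proof.
  induction m as [|m IH].
  - exists (fun _ => vzero 1); repeat split; intros.
    + vring.
    + vring.
    + apply functional_extensionality; intros i; apply (Fin.case0 (fun i => x i = vzero 0 i)).
    + apply fsum_0; intros i; unfold vzero; ring.
  - destruct (Req_dec (c Fin.F1) 0) as [Z|N].
    + destruct (IH (fun i => c (Fin.FS i))) as (iota & L & I & K).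
      exists (fun x => vcons (x Fin.F1) (iota (vtail x))).
      assert (LT := rlinear_comp _ _ _ _ _ (rlinear_vtail m) L).
      repeat split.
      * intros x y; apply vec_S_ext; [reflexivity|]; exact (proj1 LT x y).
      * intros a x; apply vec_S_ext; [reflexivity|]; exact (proj2 LT a x).
      * intros x H; apply vec_S_ext; [exact (f_equal (fun z => z Fin.F1) H)|].
        apply I; exact (f_equal vtail H).
      * intros x; change (c Fin.F1 * x Fin.F1 +
          fsum (S m) (fun i => c (Fin.FS i) * iota (vtail x) i) = 0).
        rewrite K, Z; ring.
    (* The equation is solved for its first unknown, whose coefficient is nonzero. *)
    + exists (fun x => vcons (- / c Fin.F1 * fsum (S m) (fun i => c (Fin.FS i) * x i)) x).
      repeat split.
      * intros x y; apply vec_S_ext; [|reflexivity].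
        change (- / c Fin.F1 * fsum (S m) (fun i => c (Fin.FS i) * (x i + y i)) =
          - / c Fin.F1 * fsum (S m) (fun i => c (Fin.FS i) * x i) +
          - / c Fin.F1 * fsum (S m) (fun i => c (Fin.FS i) * y i)).
        rewrite <- Rmult_plus_distr_l, <- fsum_plus; f_equal; apply fsum_ext; intros; ring.
      * intros a x; apply vec_S_ext; [|reflexivity].
        change (- / c Fin.F1 * fsum (S m) (fun i => c (Fin.FS i) * (a * x i)) =
          a * (- / c Fin.F1 * fsum (S m) (fun i => c (Fin.FS i) * x i))).
        rewrite (fsum_ext _ _ (fun i => a * (c (Fin.FS i) * x i))), fsum_scal
          by (intros; ring); ring.
      * intros x H; exact (f_equal vtail H).
      * intros x; change (c Fin.F1 * (- / c Fin.F1 *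
          fsum (S m) (fun i => c (Fin.FS i) * x i)) +
          fsum (S m) (fun i => c (Fin.FS i) * x i) = 0).
        set (s := fsum _ _); field; exact N.
Qed.

Lemma rlinear_kernel n (f : vec (S n) -> vec n) :
  rlinear f -> exists x, x <> vzero _ /\ f x = vzero _.
Proof.
  induction n as [|n IH]; intros L.
  - exists (fun _ => 1); split.
    + intros E; apply (f_equal (fun z => z Fin.F1)) in E; unfold vzero in E; lra.
    + apply functional_extensionality; intros i.
      apply (Fin.case0 (fun i => f (fun _ => 1) i = vzero 0 i)).
  - destruct (functional_kernel (S n) (fun i => f (ebasis i) Fin.F1)) as (iota & Li & I & K).
    destruct (IH (fun x => vtail (f (iota x)))) as (x & Nx & Ex).
    + apply (rlinear_comp _ _ _ (fun x => f (iota x)) vtail);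
        [now apply rlinear_comp | apply rlinear_vtail].
    + exists (iota x); split; [intros H; now apply Nx, I|].
      apply vec_S_ext; [|exact Ex].
      change (f (iota x) Fin.F1 = 0); rewrite (rlinear_coord f L), <- (K x).
      apply fsum_ext; intros; ring.
Qed.

(** A nonzero kernel vector [(a, x)] of [(a, x) |-> a y + f x] has [a <> 0] by injectivity, and then
    [y] is the image of [- x / a]. *)
Lemma rlinear_inj_surj n (f : vec n -> vec n) :
  rlinear f -> (forall x, f x = vzero n -> x = vzero n) -> forall y, exists x, f x = y.
Proof.
  intros L I y.
  destruct (rlinear_kernel n (fun z => vadd (vscal (z Fin.F1) y) (f (vtail z))))
    as (z & Nz & Ez).
  - split; intros.
    + change (vtail (vadd x y0)) with (vadd (vtail x) (vtail y0)).
      rewrite (rlinear_add f L); vring.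
    + change (vtail (vscal a x)) with (vscal a (vtail x)).
      rewrite (rlinear_scal f L); vring.
  - destruct (Req_dec (z Fin.F1) 0) as [Z|N].
    + exfalso; apply Nz, vec_S_ext; [exact Z|].
      apply I; rewrite <- Ez, Z; vring.
    + exists (vscal (- / z Fin.F1) (vtail z)); rewrite (rlinear_scal f L).
      apply functional_extensionality; intros i.
      apply (f_equal (fun w => w i)) in Ez; unfold vadd, vscal, vzero in *.
      replace (f (vtail z) i) with (- (z Fin.F1 * y i)) by lra; field; exact N.
Qed.

(** * Differentiation of curves of vectors and operators *)

Definition vsmooth {n} (u : R -> vec n) : Prop := forall i, smoothR (fun t => u t i).

Definition is_vderive {n} (u : R -> vec n) (t : R) (v : vec n) : Prop :=
  forall i, is_derive (fun s => u s i) t (v i).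

Definition vD {n} (u : R -> vec n) (t : R) : vec n := fun i => Derive (fun s => u s i) t.

Lemma vsmooth_is_vderive n (u : R -> vec n) t : vsmooth u -> is_vderive u t (vD u t).
Proof. intros H i; apply smoothR_is_derive, H. Qed.

Lemma vsmooth_vD n (u : R -> vec n) : vsmooth u -> vsmooth (vD u).
Proof. intros H i; apply (smoothR_Derive (fun s => u s i)), H. Qed.

Lemma is_vderive_unique n (u : R -> vec n) t v w :
  is_vderive u t v -> is_vderive u t w -> v = w.
Proof.
  intros H1 H2; apply functional_extensionality; intros i.
  rewrite <- (is_derive_unique _ _ _ (H1 i)); apply is_derive_unique, H2.
Qed.

Lemma is_vderive_vD n (u : R -> vec n) t v : is_vderive u t v -> vD u t = v.
Proof. intros H; apply functional_extensionality; intros i; apply is_derive_unique, H. Qed.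

Lemma is_vderive_const n (x : vec n) t : is_vderive (fun _ => x) t (vzero n).
Proof. intros i; apply (is_derive_const (x i) t). Qed.

Lemma is_vderive_add n (u v : R -> vec n) t x y :
  is_vderive u t x -> is_vderive v t y ->
  is_vderive (fun s => vadd (u s) (v s)) t (vadd x y).
Proof.
  intros H1 H2 i.
  apply (is_derive_plus (fun s => u s i) (fun s => v s i)); [apply H1 | apply H2].
Qed.

Lemma is_vderive_comp n (u : R -> vec n) f t x l :
  is_vderive u (f t) x -> is_derive f t l ->
  is_vderive (fun s => u (f s)) t (vscal l x).
Proof. intros H1 H2 i; apply (is_derive_comp (fun s => u s i) f); [apply H1 | exact H2]. Qed.

Lemma is_vderive_0_const n (u : R -> vec n) :
  (forall t, is_vderive u t (vzero n)) -> forall s t, u s = u t.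
Proof.
  intros H s t; apply functional_extensionality; intros i.
  apply (is_derive_0_const (fun s => u s i)); intros r; apply H.
Qed.

Lemma is_derive_fsum n (F : Fin.t n -> R -> R) t (l : Fin.t n -> R) :
  (forall i, is_derive (F i) t (l i)) -> is_derive (fun s => fsum n (fun i => F i s)) t (fsum n l).
Proof.
  induction n as [|n IH]; intros H; simpl; [apply (is_derive_const 0 t)|].
  apply (is_derive_plus (F Fin.F1) (fun s => fsum n (fun i => F (Fin.FS i) s))); [apply H|].
  apply (IH (fun i => F (Fin.FS i))); intros i; apply H.
Qed.

Lemma is_vderive_app n m (A : R -> vec n -> vec m) A' u t v :
  (forall s, rlinear (A s)) -> (forall x, is_vderive (fun s => A s x) t (A' x)) ->
  is_vderive u t v ->
  is_vderive (fun s => A s (u s)) t (vadd (A' (u t)) (A t v)).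
Proof.
  intros L HA Hu j.
  apply (is_derive_ext (fun s => fsum n (fun i => u s i * A s (ebasis i) j))).
  { intros s; symmetry; apply (rlinear_coord (A s) (L s)). }
  evar_last.
  - apply (is_derive_fsum n (fun i s => u s i * A s (ebasis i) j)); intros i.
    apply (is_derive_mult (fun s => u s i) (fun s => A s (ebasis i) j)).
    + apply Hu.
    + apply HA.
    + intros; apply Rmult_comm.
  - unfold vadd, plus, mult; simpl; rewrite fsum_plus, Rplus_comm; f_equal.
    + symmetry; rewrite <- (is_derive_unique _ _ _ (HA (u t) j)).
      apply is_derive_unique.
      apply (is_derive_ext (fun s => fsum n (fun i => u t i * A s (ebasis i) j))).
      { intros s; symmetry; apply (rlinear_coord (A s) (L s)). }
      apply (is_derive_fsum n (fun i s => u t i * A s (ebasis i) j)); intros i.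
      apply (is_derive_scal (fun s => A s (ebasis i) j)), HA.
    + symmetry; apply (rlinear_coord (A t) (L t)).
Qed.

Lemma is_vderive_lin n m (f : vec n -> vec m) u t v :
  rlinear f -> is_vderive u t v -> is_vderive (fun s => f (u s)) t (f v).
Proof.
  intros L H.
  replace (f v) with (vadd (vzero m) (f v)) by vring.
  apply (is_vderive_app n m (fun _ => f) (fun _ => vzero m) u t v); auto.
  intros x; apply is_vderive_const.
Qed.

Lemma vsmooth_app n m (A : R -> vec n -> vec m) u :
  (forall s, rlinear (A s)) -> (forall x, vsmooth (fun s => A s x)) ->
  vsmooth u -> vsmooth (fun s => A s (u s)).
Proof.
  intros L HA Hu j.
  apply (smoothR_ext (fun s => fsum n (fun i => u s i * A s (ebasis i) j))).
  { intros s; symmetry; apply (rlinear_coord (A s) (L s)). }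
  apply (smoothR_fsum n (fun i s => u s i * A s (ebasis i) j)); intros i.
  apply smoothR_mult; [apply Hu | apply HA].
Qed.

Lemma vsmooth_const n (x : vec n) : vsmooth (fun _ => x).
Proof. intros i; apply smoothR_const. Qed.

Lemma vsmooth_lin n m (f : vec n -> vec m) u :
  rlinear f -> vsmooth u -> vsmooth (fun s => f (u s)).
Proof.
  intros L H; apply (vsmooth_app n m (fun _ => f)); auto using vsmooth_const.
Qed.

Lemma vsmooth_add n (u v : R -> vec n) :
  vsmooth u -> vsmooth v -> vsmooth (fun s => vadd (u s) (v s)).
Proof. intros H1 H2 i; apply smoothR_plus; [apply H1 | apply H2]. Qed.

Lemma vsmooth_scal n f (u : R -> vec n) :
  smoothR f -> vsmooth u -> vsmooth (fun s => vscal (f s) (u s)).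
Proof. intros H1 H2 i; apply smoothR_mult; [apply H1 | apply H2]. Qed.

Lemma vsmooth_comp n (u : R -> vec n) f :
  smoothR f -> vsmooth u -> vsmooth (fun s => u (f s)).
Proof. intros H1 H2 i; apply (smoothR_comp f (fun s => u s i)); auto. Qed.

(** * Automorphisms and integer powers *)

(** The power [f ^ k] for [k] in Z, with [h] as the inverse of [f]: [Z.to_nat] sends negative
    numbers to 0, so at most one of the two iterations is nontrivial. *)
Definition zpow {T} (f h : T -> T) (k : Z) (x : T) : T :=
  Nat.iter (Z.to_nat k) f (Nat.iter (Z.to_nat (- k)) h x).

Lemma zpow_succ T (f h : T -> T) k x :
  (forall x, f (h x) = x) -> zpow f h (Z.succ k) x = f (zpow f h k x).
Proof.
  intros E; unfold zpow; destruct (Z_le_gt_dec 0 k) as [H|H].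
  - replace (Z.to_nat (Z.succ k)) with (S (Z.to_nat k)) by lia.
    replace (Z.to_nat (- Z.succ k)) with O by lia.
    now replace (Z.to_nat (- k)) with O by lia.
  - replace (Z.to_nat (Z.succ k)) with O by lia.
    replace (Z.to_nat k) with O by lia.
    replace (Z.to_nat (- k)) with (S (Z.to_nat (- Z.succ k))) by lia.
    simpl; now rewrite E.
Qed.

Lemma zpow_ind T (f h : T -> T) (P : (T -> T) -> Prop) k :
  P (fun x => x) -> (forall F, P F -> P (fun x => f (F x))) ->
  (forall F, P F -> P (fun x => h (F x))) -> P (zpow f h k).
Proof.
  intros P0 Pf Ph; unfold zpow.
  assert (A : forall m, P (fun x => Nat.iter m h x)) by (induction m; simpl; auto).
  generalize (Z.to_nat k) as m; induction m; simpl; auto.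
Qed.

Lemma zpow_equivariant T (f h : T -> T) (u : R -> T) :
  (forall x, f (h x) = x) -> (forall x, h (f x) = x) ->
  (forall t, u (t + 2 * PI) = f (u t)) ->
  forall k t, u (t + 2 * PI * IZR k) = zpow f h k (u t).
Proof.
  intros E1 E2 H k; apply (Z.bi_induction (fun k =>
    forall t, u (t + 2 * PI * IZR k) = zpow f h k (u t))).
  - now intros ? ? ->.
  - intros t; now rewrite Rmult_0_r, Rplus_0_r.
  - clear k; intros k.
    assert (S : forall t, u (t + 2 * PI * IZR (Z.succ k)) = f (u (t + 2 * PI * IZR k))).
    { intros t; rewrite succ_IZR, <- H; f_equal; ring. }
    split; intros K t.
    + now rewrite S, K, zpow_succ.
    + rewrite <- (E2 (u _)), <- (E2 (zpow f h k (u t))); f_equal.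
      now rewrite <- S, K, zpow_succ.
Qed.

Lemma periodic_Z T (u : R -> T) :
  (forall t, u (t + 2 * PI) = u t) -> forall k t, u (t + 2 * PI * IZR k) = u t.
Proof.
  intros H k t.
  rewrite (zpow_equivariant T (fun x => x) (fun x => x)) by easy.
  apply (zpow_ind T (fun x => x) (fun x => x) (fun F => F (u t) = u t)); auto.
Qed.

Lemma rlinear_zpow n (f h : vec n -> vec n) k :
  rlinear f -> rlinear h -> rlinear (zpow f h k).
Proof.
  intros Lf Lh; apply zpow_ind; [now split| |]; intros F HF; now apply rlinear_comp.
Qed.

Lemma gaut_rlinear g f : is_gaut g f -> rlinear f.
Proof. intros H; apply H. Qed.

Lemma gaut_id g : is_gaut g (fun x => x).
Proof.
  split; [split; [now split|]|].
  - now destruct (lJ g).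
  - split; [easy|]; now exists (fun x => x).
Qed.

Lemma gaut_comp g f h : is_gaut g f -> is_gaut g h -> is_gaut g (fun x => f (h x)).
Proof.
  intros ((Lf & Jf) & Bf & f' & If & If') ((Lh & Jh) & Bh & h' & Ih & Ih').
  split; [split; [now apply rlinear_comp|]|split].
  - destruct (lJ g); [intros x; now rewrite Jh, Jf | easy].
  - intros; now rewrite Bh, Bf.
  - exists (fun x => h' (f' x)); split; intros; [now rewrite If, Ih | now rewrite Ih', If'].
Qed.

Lemma gaut_inv g f h :
  is_gaut g f -> (forall x, h (f x) = x) -> (forall x, f (h x) = x) -> is_gaut g h.
Proof.
  intros ((Lf & Jf) & Bf & _) E1 E2.
  assert (C : forall x y, f x = f y -> x = y)
    by (intros x y E; now rewrite <- (E1 x), E, E1).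
  split; [split; [split|]|split].
  - intros x y; apply C; now rewrite (rlinear_add f Lf), !E2.
  - intros a x; apply C; now rewrite (rlinear_scal f Lf), !E2.
  - destruct (lJ g); [|easy]; intros x; apply C; now rewrite Jf, !E2.
  - intros x y; apply C; now rewrite Bf, !E2.
  - now exists f.
Qed.

Lemma gaut_inverse g f : is_gaut g f ->
  exists h, is_gaut g h /\ (forall x, h (f x) = x) /\ (forall x, f (h x) = x).
Proof.
  intros H; pose proof H as (_ & _ & h & E1 & E2); exists h; split; [|easy].
  now apply (gaut_inv g f).
Qed.

Lemma gaut_zpow g f h k : is_gaut g f -> is_gaut g h -> is_gaut g (zpow f h k).
Proof. intros Hf Hh; apply zpow_ind; auto using gaut_id, gaut_comp. Qed.

(** * Twisted periodisation *)

Lemma PI_gt_3 : 3 < PI.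
Proof. pose proof PI2_3_2; unfold PI2 in *; lra. Qed.

Definition cell (s t : R) : Z := Int_part ((t - s + PI) / (2 * PI)).

Lemma cell_spec s t :
  s - PI <= t - 2 * PI * IZR (cell s t) < s + PI.
Proof.
  unfold cell; destruct (base_Int_part ((t - s + PI) / (2 * PI))) as [A B].
  set (k := IZR _) in *; clearbody k.
  pose proof PI_gt_3.
  set (r := (t - s + PI) / (2 * PI)) in *.
  assert (E : t = r * (2 * PI) + s - PI) by (unfold r; field; lra).
  clearbody r; nra.
Qed.

(** The twisted sum of all translates of [v]. As [v] will vanish at distance 2 or more from [s], at
    most one term is nonzero at each [t], so only that of the cell of [t] is written. *)
Definition periodise {n} (f h : vec n -> vec n) (s : R) (v : R -> vec n) (t : R) : vec n :=
  zpow f h (cell s t) (v (t - 2 * PI * IZR (cell s t))).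

Section Periodise.
Context {n : nat} (f h : vec n -> vec n) (s : R) (v : R -> vec n).
Context (Lf : rlinear f) (Lh : rlinear h) (E : forall x, f (h x) = x).
Context (Hv : forall t, 2 <= Rabs (t - s) -> v t = vzero n).

(** The formula of cell [k] stays valid up to distance 1 beyond the cell. If the cell of [t] is
    another one, both representatives of [t] are at distance more than PI - 1 > 2 from [s], where
    [v] vanishes. This overlap gives smoothness across the cell boundaries. *)
Lemma periodise_near k t :
  Rabs (t - 2 * PI * IZR k - s) < PI + 1 ->
  periodise f h s v t = zpow f h k (v (t - 2 * PI * IZR k)).
Proof.
  intros H; unfold periodise; pose proof (cell_spec s t) as C.
  set (m := cell s t) in *; clearbody m.
  pose proof PI_gt_3.
  assert (Z0 : forall k, zpow f h k (vzero n) = vzero n)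
    by (intros; apply rlinear_zero; now apply rlinear_zpow).
  apply Rabs_def2 in H.
  destruct (Z.lt_trichotomy m k) as [L|[->|L]]; [|easy|];
    apply Z.le_succ_l, IZR_le in L; rewrite succ_IZR in L.
  - rewrite !Hv, !Z0; [easy| |]; [rewrite Rabs_left | rewrite Rabs_right]; nra.
  - rewrite !Hv, !Z0; [easy| |]; [rewrite Rabs_right | rewrite Rabs_left]; nra.
Qed.

Lemma periodise_center t : Rabs (t - s) < PI -> periodise f h s v t = v t.
Proof.
  intros H; rewrite (periodise_near 0); rewrite Rmult_0_r, Rminus_0_r; [easy | lra].
Qed.

Lemma periodise_shift t : periodise f h s v (t + 2 * PI) = f (periodise f h s v t).
Proof.
  pose proof (cell_spec s t) as C; pose proof PI_gt_3.
  rewrite (periodise_near (Z.succ (cell s t))); rewrite succ_IZR.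
  - rewrite zpow_succ by easy; unfold periodise; do 3 f_equal; ring.
  - apply Rabs_def1; nra.
Qed.

Lemma periodise_smooth : vsmooth v -> vsmooth (periodise f h s v).
Proof.
  intros Sv i; apply smoothR_local; intros t.
  set (k := cell s t).
  exists (fun r => zpow f h k (v (r - 2 * PI * IZR k)) i); split.
  - apply (vsmooth_lin n n (zpow f h k) (fun r => v (r - 2 * PI * IZR k)));
      [now apply rlinear_zpow|].
    apply vsmooth_comp; [|exact Sv].
    apply smoothR_minus; auto using smoothR_id, smoothR_const.
  - exists (mkposreal 1 Rlt_0_1); intros r Hr.
    rewrite (periodise_near k); [reflexivity|].
    pose proof (cell_spec s t) as C; fold k in C.
    change (Rabs (r - t) < 1) in Hr; apply Rabs_def2 in Hr.
    apply Rabs_def1; nra.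
Qed.
End Periodise.

(** * Periodic scalar functions *)

Definition periodic (f : R -> R) : Prop :=
  smoothR f /\ forall t, f (t + 2 * PI) = f t.

Lemma periodic_mult f h : periodic f -> periodic h -> periodic (fun t => f t * h t).
Proof.
  intros [A B] [C D]; split; [now apply smoothR_mult | intros; now rewrite B, D].
Qed.

Lemma periodic_plus f h : periodic f -> periodic h -> periodic (fun t => f t + h t).
Proof.
  intros [A B] [C D]; split; [now apply smoothR_plus | intros; now rewrite B, D].
Qed.

Lemma periodic_const a : periodic (fun _ => a).
Proof. split; [apply smoothR_const | easy]. Qed.

Definition sper (s : R) (f : R -> R) (t : R) : R :=
  periodise (fun x : vec 1 => x) (fun x => x) s (fun t _ => f t) t Fin.F1.

Lemma sper_periodic s f :
  smoothR f -> (forall t, 2 <= Rabs (t - s) -> f t = 0) -> periodic (sper s f).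
Proof.
  intros Sf Z; unfold sper.
  assert (Hv : forall t, 2 <= Rabs (t - s) -> (fun _ : Fin.t 1 => f t) = vzero 1)
    by (intros; apply functional_extensionality; intros; unfold vzero; auto).
  split.
  - apply periodise_smooth; try easy; now intros i.
  - intros t; now rewrite periodise_shift by easy.
Qed.

Lemma sper_eq s f t : sper s f t = f (t - 2 * PI * IZR (cell s t)).
Proof.
  unfold sper, periodise.
  apply (zpow_ind (vec 1) (fun x => x) (fun x => x)
    (fun F => forall y, F (fun _ => y) Fin.F1 = y)); auto.
Qed.

(** * Modules of twisted loops *)

Lemma inL_vsmooth g sigma u : inL g sigma u -> vsmooth u.
Proof. intros [A _]; exact A. Qed.

Definition lmul {n} (f : R -> R) (u : R -> vec n) (t : R) : vec n := vscal (f t) (u t).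

Section Loops.
Context (g : liealg) (sigma : vec (ldim g) -> vec (ldim g)).
Context (Hg : is_simple g) (Hc : cstruct_ok g) (Hs : is_gaut g sigma).

Lemma bracket_l y : rlinear (fun x => lbr g x y).
Proof. apply Hg. Qed.

Lemma bracket_r x : rlinear (lbr g x).
Proof. apply Hg. Qed.

Lemma vsmooth_bracket u v :
  vsmooth u -> vsmooth v -> vsmooth (fun t => lbr g (u t) (v t)).
Proof.
  intros Su Sv; apply (vsmooth_app _ _ (fun t => lbr g (u t))); auto.
  - intros t; apply bracket_r.
  - intros x; apply (vsmooth_lin _ _ (fun y => lbr g y x)); auto using bracket_l.
Qed.

Lemma inL_add u v :
  inL g sigma u -> inL g sigma v -> inL g sigma (fun t => vadd (u t) (v t)).
Proof.
  intros [A B] [C D]; split; [now apply (vsmooth_add _ u v)|].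
  intros t; rewrite B, D; symmetry; now apply rlinear_add, (gaut_rlinear g).
Qed.

Lemma inL_lmul f u : periodic f -> inL g sigma u -> inL g sigma (lmul f u).
Proof.
  intros [A B] [C D]; split; [now apply (vsmooth_scal _ f u)|].
  intros t; unfold lmul; rewrite B, D; symmetry;
    now apply rlinear_scal, (gaut_rlinear g).
Qed.

Lemma inL_scal a u : inL g sigma u -> inL g sigma (fun t => vscal a (u t)).
Proof. apply (inL_lmul (fun _ => a)), periodic_const. Qed.

Lemma inL_J J u : lJ g = Some J -> inL g sigma u -> inL g sigma (fun t => J (u t)).
Proof.
  intros E [A B]; unfold cstruct_ok in Hc; destruct Hs as ((_ & K) & _).
  rewrite E in *; split.
  - apply (vsmooth_lin _ _ J u); [apply Hc | exact A].
  - intros t; now rewrite B, K.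
Qed.

Lemma inL_bracket u v :
  inL g sigma u -> inL g sigma v -> inL g sigma (fun t => lbr g (u t) (v t)).
Proof.
  intros [A B] [C D]; split; [now apply (vsmooth_bracket u v)|].
  intros t; rewrite B, D; symmetry; apply Hs.
Qed.

Lemma inL_zero : inL g sigma (fun _ => vzero _).
Proof.
  split; [intros i; apply smoothR_const|].
  intros _; symmetry; now apply rlinear_zero, (gaut_rlinear g).
Qed.

Lemma inL_fsum k (F : Fin.t k -> loop g) :
  (forall i, inL g sigma (F i)) -> inL g sigma (fun t l => fsum k (fun i => F i t l)).
Proof.
  induction k as [|k IH]; intros H; simpl; [apply inL_zero|].
  apply (inL_add (F Fin.F1) (fun t l => fsum k (fun i => F (Fin.FS i) t l))); auto.
Qed.

Definition sigma_inv : vec (ldim g) -> vec (ldim g) :=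
  epsilon (inhabits (fun x => x))
    (fun h => is_gaut g h /\ (forall x, h (sigma x) = x) /\ (forall x, sigma (h x) = x)).

Lemma sigma_inv_spec :
  is_gaut g sigma_inv /\ (forall x, sigma_inv (sigma x) = x) /\
  (forall x, sigma (sigma_inv x) = x).
Proof.
  apply (epsilon_spec (inhabits (fun x : vec (ldim g) => x)) (fun h =>
    is_gaut g h /\ (forall x, h (sigma x) = x) /\ (forall x, sigma (h x) = x))).
  exact (gaut_inverse g sigma Hs).
Qed.

(** A twisted loop that is constantly [x] near [s]; through such loops every value is attained at
    every time. *)
Definition local_section (s : R) (x : vec (ldim g)) : loop g :=
  periodise sigma sigma_inv s (fun t => vscal (bump (t - s)) x).

Lemma bump_far s t : 2 <= Rabs (t - s) -> bump (t - s) = 0.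
Proof. apply bump_0. Qed.

Lemma smoothR_bump_shift s : smoothR (fun t => bump (t - s)).
Proof.
  apply (smoothR_comp (fun t => t - s)); [apply smoothR_bump|].
  apply smoothR_minus; auto using smoothR_id, smoothR_const.
Qed.

Lemma local_section_inL s x : inL g sigma (local_section s x).
Proof.
  destruct sigma_inv_spec as (Gi & _ & E).
  assert (Z : forall t, 2 <= Rabs (t - s) -> vscal (bump (t - s)) x = vzero _)
    by (intros t Ht; rewrite bump_far by easy; vring).
  pose proof (gaut_rlinear _ _ Hs); pose proof (gaut_rlinear _ _ Gi).
  split.
  - apply (periodise_smooth sigma sigma_inv s); auto.
    apply (vsmooth_scal _ (fun t => bump (t - s)) (fun _ => x));
      auto using smoothR_bump_shift, vsmooth_const.
  - intros t; now apply periodise_shift.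
Qed.

Lemma local_section_near s x t : Rabs (t - s) <= 1 -> local_section s x t = x.
Proof.
  intros H; destruct sigma_inv_spec as (Gi & _ & E); pose proof PI_gt_3.
  unfold local_section; rewrite periodise_center; try lra.
  - rewrite bump_1 by easy; vring.
  - now apply (gaut_rlinear g).
  - now apply (gaut_rlinear g).
  - intros r Hr; rewrite bump_far by easy; vring.
Qed.

Lemma local_section_at s x : local_section s x s = x.
Proof. apply local_section_near; rewrite Rminus_diag, Rabs_R0; lra. Qed.

Lemma local_section_linear s t : rlinear (fun x => local_section s x t).
Proof.
  assert (L : rlinear (zpow sigma sigma_inv (cell s t))).
  { apply rlinear_zpow; apply (gaut_rlinear g); auto; apply sigma_inv_spec. }
  unfold local_section, periodise; split; intros.
  - rewrite <- (rlinear_add _ L); f_equal; vring.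
  - rewrite <- (rlinear_scal _ L); f_equal; vring.
Qed.

(** The sections through the basis vectors form a local frame around [s]. Two bump factors are
    needed: one sits inside the frame, the other turns the coordinates of [u] into periodic
    coefficients. *)
Lemma bump_section_decomposition s u :
  inL g sigma u ->
  lmul (fun t => sper s (fun r => bump (r - s)) t * sper s (fun r => bump (r - s)) t) u =
  fun t l => fsum (ldim g) (fun i =>
    lmul (sper s (fun r => bump (r - s) * u r i)) (local_section s (ebasis i)) t l).
Proof.
  intros Hu; apply functional_extensionality; intros t.
  apply functional_extensionality; intros l; unfold lmul.
  destruct sigma_inv_spec as (Gi & E1 & E2).
  assert (L : rlinear (zpow sigma sigma_inv (cell s t))).
  { apply rlinear_zpow; apply (gaut_rlinear g); auto. }
  rewrite !sper_eq.
  set (k := cell s t) in *; set (r := t - 2 * PI * IZR k).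
  replace (u t) with (zpow sigma sigma_inv k (u r)).
  2: { rewrite <- (zpow_equivariant _ sigma sigma_inv u) by (auto; apply Hu).
       f_equal; unfold r; ring. }
  unfold vscal at 1; rewrite (rlinear_coord _ L), <- fsum_scal.
  apply fsum_ext; intros i.
  rewrite sper_eq; unfold local_section, periodise; fold k r.
  rewrite (rlinear_scal _ L); unfold vscal; ring.
Qed.

Lemma separating_loop s t x :
  (forall k : Z, t <> s + 2 * PI * IZR k) ->
  exists u, inL g sigma u /\ u s = x /\ u t = vzero _.
Proof.
  intros N.
  (* This periodic function vanishes exactly on [t + 2 * PI * Z]. *)
  set (f := fun r => 1 - cos (r - t)).
  assert (Pf : periodic f).
  { split.
    - apply smoothR_minus; [apply smoothR_const|]; apply smoothR_cos.
      apply smoothR_minus; auto using smoothR_id, smoothR_const.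
    - intros r; unfold f; replace (r + 2 * PI - t) with (r - t + 2 * PI) by ring.
      rewrite cos_plus, cos_2PI, sin_2PI; ring. }
  assert (Nf : f s <> 0).
  { intros E; unfold f in E.
    replace (s - t) with (2 * ((s - t) / 2)) in E by field; rewrite cos_2a_sin in E.
    assert (E' : sin ((s - t) / 2) = 0) by nra.
    destruct (sin_eq_0_0 _ E') as [k Ek]; apply (N (- k)%Z); rewrite opp_IZR; lra. }
  exists (lmul f (local_section s (vscal (/ f s) x))); repeat split.
  - apply inL_lmul; [exact Pf | apply local_section_inL].
  - apply inL_lmul; [exact Pf | apply local_section_inL].
  - unfold lmul; rewrite local_section_at; apply functional_extensionality; intros i;
      unfold vscal; field; exact Nf.
  - unfold lmul, f; rewrite Rminus_diag, cos_0; vring.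
Qed.
End Loops.

(** * Homomorphisms from a twisted loop algebra onto [g] are point evaluations *)

(** Compactness of [[a, b]] as a continuation principle: it serves in place of extracting a finite
    subcover. *)
Lemma real_induction (P : R -> Prop) a b :
  a <= b -> P a ->
  (forall m, a <= m <= b -> exists d, 0 < d /\
     forall x y, m - d < x -> x <= m -> y < m + d -> x <= y -> P x -> P y) ->
  P b.
Proof.
  intros Hab Pa H.
  destruct (completeness (fun x => a <= x <= b /\ P x)) as [m [Up Least]].
  - exists b; now intros x [[_ Hx] _].
  - exists a; split; [lra | exact Pa].
  - assert (Hm : a <= m <= b).
    { split; [apply Up; split; [lra | exact Pa]|].
      apply Least; now intros x [[_ Hx] _]. }
    destruct (H m Hm) as (d & Hd & K).
    destruct (classic (exists x, m - d < x <= m /\ P x)) as [(x & Hx & Px)|N].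
    + set (y := Rmin b (m + d / 2)).
      assert (Py : P y).
      { pose proof (Rmin_r b (m + d / 2)).
        apply (K x); [lra | lra | unfold y; lra | apply Rmin_glb; lra | exact Px]. }
      assert (Hy : y <= m).
      { apply Up; split; [|exact Py]; unfold y; split;
          [apply Rmin_glb; lra | apply Rmin_l]. }
      replace b with y; [exact Py|]; unfold y in *.
      revert Hy; unfold Rmin; destruct (Rle_dec b (m + d / 2)); lra.
    (* Without points of the set just left of the supremum [m], already [m - d] would be an upper
       bound. *)
    + exfalso.
      assert (m <= m - d); [|lra].
      apply Least; intros x Hx.
      destruct (Rle_dec x (m - d)) as [L|L]; [exact L|].
      exfalso; apply N; exists x; split; [|apply Hx].
      split; [lra | now apply Up].
Qed.

Definition is_eval (g : liealg) (sigma : vec (ldim g) -> vec (ldim g))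
  (delta : loop g -> vec (ldim g)) : Prop :=
  (forall u v, inL g sigma u -> inL g sigma v ->
     delta (fun t => vadd (u t) (v t)) = vadd (delta u) (delta v)) /\
  (forall a u, inL g sigma u -> delta (fun t => vscal a (u t)) = vscal a (delta u)) /\
  (match lJ g with
   | None => True
   | Some J => forall u, inL g sigma u -> delta (fun t => J (u t)) = J (delta u)
   end) /\
  (forall u v, inL g sigma u -> inL g sigma v ->
     delta (fun t => lbr g (u t) (v t)) = lbr g (delta u) (delta v)) /\
  (forall x, exists u, inL g sigma u /\ delta u = x).

Lemma simple_nonabelian g : is_simple g -> ~ (forall x y, lbr g x y = vzero _).
Proof. intros (_ & (x & y & N) & _) H; now apply N. Qed.

Section Eval.
Context (g : liealg) (sigma : vec (ldim g) -> vec (ldim g)) (delta : loop g -> vec (ldim g)).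
Context (Hg : is_simple g) (Hc : cstruct_ok g) (Hs : is_gaut g sigma).
Context (Hd : is_eval g sigma delta).

Lemma eval_add u v : inL g sigma u -> inL g sigma v ->
  delta (fun t => vadd (u t) (v t)) = vadd (delta u) (delta v).
Proof. apply Hd. Qed.

Lemma eval_scal a u : inL g sigma u -> delta (fun t => vscal a (u t)) = vscal a (delta u).
Proof. apply Hd. Qed.

Lemma eval_J J u : lJ g = Some J -> inL g sigma u -> delta (fun t => J (u t)) = J (delta u).
Proof. intros E; destruct Hd as (_ & _ & H & _); rewrite E in H; apply H. Qed.

Lemma eval_bracket u v : inL g sigma u -> inL g sigma v ->
  delta (fun t => lbr g (u t) (v t)) = lbr g (delta u) (delta v).
Proof. apply Hd. Qed.

Lemma eval_surj x : exists u, inL g sigma u /\ delta u = x.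
Proof. apply Hd. Qed.

Lemma J_linear J : lJ g = Some J -> rlinear J.
Proof. intros E; unfold cstruct_ok in Hc; rewrite E in Hc; apply Hc. Qed.

Lemma eval_zero : delta (fun _ => vzero _) = vzero _.
Proof.
  replace (fun _ : R => vzero (ldim g)) with
    (fun _ : R => vscal 0 (vzero (ldim g))) by (apply functional_extensionality; intros; vring).
  rewrite (eval_scal 0 (fun _ => vzero _)); [vring | now apply inL_zero].
Qed.

Lemma eval_fsum k (F : Fin.t k -> loop g) : (forall i, inL g sigma (F i)) ->
  delta (fun t l => fsum k (fun i => F i t l)) = fun l => fsum k (fun i => delta (F i) l).
Proof.
  induction k as [|k IH]; intros H; simpl.
  - exact eval_zero.
  - transitivity (vadd (delta (F Fin.F1))
      (fun l => fsum k (fun i => delta (F (Fin.FS i)) l))); [|reflexivity].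
    rewrite <- (IH (fun i => F (Fin.FS i))) by auto.
    apply (eval_add (F Fin.F1) (fun t l => fsum k (fun i => F (Fin.FS i) t l))); auto.
    now apply (inL_fsum g sigma Hs k (fun i => F (Fin.FS i))).
Qed.

Lemma lmul_add f (u v : loop g) :
  lmul f (fun t => vadd (u t) (v t)) = fun t => vadd (lmul f u t) (lmul f v t).
Proof. apply functional_extensionality; intros t; unfold lmul; vring. Qed.

Lemma lmul_scal f a (u : loop g) :
  lmul f (fun t => vscal a (u t)) = fun t => vscal a (lmul f u t).
Proof. apply functional_extensionality; intros t; unfold lmul; vring. Qed.

Lemma lmul_lmul f h (u : loop g) : lmul f (lmul h u) = lmul (fun t => f t * h t) u.
Proof. apply functional_extensionality; intros t; unfold lmul; vring. Qed.

Lemma lmul_J J f (u : loop g) :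
  lJ g = Some J -> lmul f (fun t => J (u t)) = fun t => J (lmul f u t).
Proof.
  intros E; apply functional_extensionality; intros t; symmetry.
  apply rlinear_scal, J_linear, E.
Qed.

Lemma lmul_bracket_r f (u v : loop g) :
  lmul f (fun t => lbr g (u t) (v t)) = fun t => lbr g (u t) (lmul f v t).
Proof.
  apply functional_extensionality; intros t; symmetry.
  apply (rlinear_scal (lbr g (u t))), bracket_r, Hg.
Qed.

Lemma lmul_bracket_l f (u v : loop g) :
  lmul f (fun t => lbr g (u t) (v t)) = fun t => lbr g (lmul f u t) (v t).
Proof.
  apply functional_extensionality; intros t; symmetry.
  apply (rlinear_scal (fun x => lbr g x (v t))), bracket_l, Hg.
Qed.

Ltac inL_tac := repeat first
  [ assumption | apply inL_scal | apply inL_lmul | apply inL_add | apply inL_bracket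
  | (eapply inL_J; [eassumption .. |]) | apply inL_zero | apply local_section_inL].

(* The ideal [delta (f ker delta)] of [g] is abelian, hence zero. *)
Lemma eval_kernel_module f u :
  periodic f -> inL g sigma u -> delta u = vzero _ -> delta (lmul f u) = vzero _.
Proof.
  intros Pf Hu Zu.
  destruct (proj2 (proj2 Hg) (fun x => exists v, inL g sigma v /\ delta v = vzero _ /\
    delta (lmul f v) = x)) as [H|H].
  - split; [|split; [|split; [|split]]].
    + exists (fun _ => vzero _); split; [inL_tac|].
      split; [exact eval_zero|]; (etransitivity; [|exact eval_zero]); f_equal.
      apply functional_extensionality; intros t; unfold lmul; vring.
    + intros x y (v & Hv & Zv & Ev) (w & Hw & Zw & Ew).
      exists (fun t => vadd (v t) (w t)); split; [inL_tac|].
      split; [rewrite eval_add, Zv, Zw by easy; vring|].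
      rewrite lmul_add, eval_add, Ev, Ew by inL_tac; easy.
    + intros a x (v & Hv & Zv & Ev).
      exists (fun t => vscal a (v t)); split; [inL_tac|].
      split; [rewrite eval_scal, Zv by easy; vring|].
      rewrite lmul_scal, eval_scal, Ev by inL_tac; easy.
    + destruct (lJ g) as [J|] eqn:EJ; [|easy].
      intros x (v & Hv & Zv & Ev); exists (fun t => J (v t)); split; [inL_tac|].
      split; [rewrite (eval_J J), Zv by easy; now apply rlinear_zero, J_linear|].
      rewrite (lmul_J J), (eval_J J), Ev by (easy || inL_tac); easy.
    + intros x y (v & Hv & Zv & Ev).
      destruct (eval_surj x) as (w & Hw & Ew).
      exists (fun t => lbr g (w t) (v t)); split; [inL_tac|].
      split; [rewrite eval_bracket, Zv by easy; now apply rlinear_zero, bracket_r|].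
      rewrite lmul_bracket_r, eval_bracket, Ev, Ew by inL_tac; easy.
  - apply H; now exists u.
  (* If [delta v = 0], moving [f] across the bracket gives [[delta (f v), delta w] = delta [v, f w]
     = [delta v, delta (f w)] = 0]. *)
  - exfalso; apply (simple_nonabelian g Hg); intros x y.
    destruct (H x) as (v & Hv & Zv & <-), (eval_surj y) as (w & Hw & <-).
    rewrite <- eval_bracket, <- lmul_bracket_l, lmul_bracket_r, eval_bracket, Zv by inL_tac.
    apply (rlinear_zero (fun z => lbr g z _)), bracket_l, Hg.
Qed.

(** * Functions acting by zero, and their common zero *)

Definition eval_null (f : R -> R) : Prop :=
  periodic f /\ forall u, inL g sigma u -> delta (lmul f u) = vzero _.

(** The Schur argument: [f] acts on [g] by [delta v |-> delta (f v)], and the kernel of this action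
    is an ideal. A nonzero kernel is therefore all of [g]. *)
Lemma eval_null_of_zero f u :
  periodic f -> inL g sigma u -> delta u <> vzero _ -> delta (lmul f u) = vzero _ ->
  eval_null f.
Proof.
  intros Pf Hu Nu Zu; split; [exact Pf|]; intros w Hw.
  destruct (proj2 (proj2 Hg) (fun x => exists v, inL g sigma v /\
    delta (lmul f v) = vzero _ /\ delta v = x)) as [H|H].
  - split; [|split; [|split; [|split]]].
    + exists (fun _ => vzero _); split; [inL_tac|].
      split; [|exact eval_zero]; (etransitivity; [|exact eval_zero]); f_equal.
      apply functional_extensionality; intros t; unfold lmul; vring.
    + intros x y (v & Hv & Zv & Ev) (v' & Hv' & Zv' & Ev').
      exists (fun t => vadd (v t) (v' t)); split; [inL_tac|].
      split; [rewrite lmul_add, eval_add, Zv, Zv' by inL_tac; vring|].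
      rewrite eval_add, Ev, Ev' by inL_tac; easy.
    + intros a x (v & Hv & Zv & Ev).
      exists (fun t => vscal a (v t)); split; [inL_tac|].
      split; [rewrite lmul_scal, eval_scal, Zv by inL_tac; vring|].
      rewrite eval_scal, Ev by inL_tac; easy.
    + destruct (lJ g) as [J|] eqn:EJ; [|easy].
      intros x (v & Hv & Zv & Ev); exists (fun t => J (v t)); split; [inL_tac|].
      split; [rewrite (lmul_J J), (eval_J J), Zv by (easy || inL_tac);
        now apply rlinear_zero, J_linear|].
      rewrite (eval_J J), Ev by (easy || inL_tac); easy.
    + intros x y (v & Hv & Zv & Ev).
      destruct (eval_surj x) as (v' & Hv' & Ev').
      exists (fun t => lbr g (v' t) (v t)); split; [inL_tac|].
      split; [rewrite lmul_bracket_r, eval_bracket, Zv by inL_tac;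
        now apply rlinear_zero, bracket_r|].
      rewrite eval_bracket, Ev, Ev' by inL_tac; easy.
  - exfalso; apply Nu, H; now exists u.
  (* [w] and [v] differ by an element of the kernel of [delta], which [f] preserves. *)
  - destruct (H (delta w)) as (v & Hv & Zv & Ev).
    assert (Hv1 : inL g sigma (fun t => vscal (-1) (v t))) by inL_tac.
    assert (K : delta (lmul f (fun t => vadd (w t) (vscal (-1) (v t)))) = vzero _).
    { apply eval_kernel_module; [exact Pf | inL_tac|].
      rewrite eval_add, eval_scal, Ev by inL_tac; vring. }
    rewrite lmul_add, lmul_scal, eval_add, eval_scal, Zv in K by inL_tac.
    rewrite <- K; vring.
Qed.

Lemma eval_null_mult f h : eval_null f -> periodic h -> eval_null (fun t => h t * f t).
Proof.
  intros [Pf Hf] Ph; split; [now apply periodic_mult|]; intros u Hu.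
  replace (lmul (fun t => h t * f t) u) with (lmul f (lmul h u)); [apply Hf; inL_tac|].
  rewrite lmul_lmul; f_equal; apply functional_extensionality; intros; ring.
Qed.

Lemma eval_null_plus f h : eval_null f -> eval_null h -> eval_null (fun t => f t + h t).
Proof.
  intros [Pf Hf] [Ph Hh]; split; [now apply periodic_plus|]; intros u Hu.
  replace (lmul (fun t => f t + h t) u) with (fun t => vadd (lmul f u t) (lmul h u t)).
  - rewrite eval_add, Hf, Hh by inL_tac; vring.
  - apply functional_extensionality; intros; unfold lmul; vring.
Qed.

Lemma exists_nonzero_vec : exists x : vec (ldim g), x <> vzero _.
Proof. destruct Hg as (_ & (x & y & N) & _); eauto. Qed.

(** A function without zeros is invertible among periodic functions, and its inverse would undo the
    zero action. *)
Lemma eval_null_has_zero f : eval_null f -> exists t, f t = 0.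
Proof.
  intros [[Sf Qf] Hf]; apply NNPP; intros N.
  assert (N' : forall t, f t <> 0) by (intros t E; apply N; eauto).
  destruct exists_nonzero_vec as (x & Nx); apply Nx.
  destruct (eval_surj x) as (u & Hu & <-).
  assert (P : periodic (fun t => / f t)).
  { split; [now apply smoothR_inv | intros t; now rewrite Qf]. }
  rewrite <- (Hf (lmul (fun t => / f t) u)) by inL_tac; f_equal.
  rewrite lmul_lmul; apply functional_extensionality; intros t; unfold lmul.
  rewrite Rinv_r by apply N'; vring.
Qed.

(** Otherwise finitely many null functions have no common zero on a period, and the sum of their
    squares is a null function without zeros. *)
Lemma eval_null_common_zero : exists s, forall f, eval_null f -> f s = 0.
Proof.
  apply NNPP; intros N.
  assert (A : forall s, exists f, eval_null f /\ f s <> 0).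
  { intros s; apply NNPP; intros M; apply N; exists s; intros f Hf.
    apply NNPP; intros Z; apply M; eauto. }
  assert (B : exists f, eval_null f /\ (forall t, 0 <= f t) /\
    forall t, 0 <= t <= 2 * PI -> 0 < f t).
  { apply (real_induction (fun y => exists f, eval_null f /\ (forall t, 0 <= f t) /\
      forall t, 0 <= t <= y -> 0 < f t) 0 (2 * PI)).
    - pose proof PI_gt_3; lra.
    - destruct (A 0) as (f & Hf & Nf); exists (fun t => f t * f t); split; [|split].
      + apply (eval_null_mult f f); [exact Hf | apply Hf].
      + intros t; nra.
      + intros t Ht; replace t with 0 by lra; nra.
    - intros m _; destruct (A m) as (f & Hf & Nf).
      assert (L : locally m (fun t => f t <> 0)).
      { apply (smoothR_continuous f m (proj1 (proj1 Hf)) (fun y => y <> 0)).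
        exact (open_neq 0 _ Nf). }
      destruct L as [d Hd']; exists d; split; [apply cond_pos|].
      intros x y H1 H2 H3 H4 (h & Hh & Ph & Qh).
      exists (fun t => f t * f t + h t); split; [|split].
      + apply eval_null_plus; [|exact Hh].
        apply (eval_null_mult f f); [exact Hf | apply Hf].
      + intros t; pose proof (Ph t); nra.
      + intros t Ht; destruct (Rle_dec t x) as [Ht'|Ht'].
        * pose proof (Qh t); nra.
        * assert (f t <> 0).
          { apply Hd'; apply Rabs_def1; unfold minus, plus, opp; simpl; lra. }
          pose proof (Ph t); nra. }
  destruct B as (f & Hf & _ & Pf); destruct (eval_null_has_zero f Hf) as (t & Et).
  (* The cell centred at PI is [[0, 2 * PI)], where [f] is known to be positive. *)
  pose proof (cell_spec PI t) as C.
  assert (E : f (t - 2 * PI * IZR (cell PI t)) = f t).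
  { rewrite <- (periodic_Z R f (proj2 (proj1 Hf)) (cell PI t)); f_equal; ring. }
  pose proof (Pf (t - 2 * PI * IZR (cell PI t))); lra.
Qed.

(** The polynomial in [f] with coefficients [c], in Horner form so that [f] splits off as soon as
    the constant term is 0. *)
Fixpoint horner (m : nat) (f : R -> R) : vec m -> R -> R :=
  match m with
  | O => fun _ _ => 0
  | S m => fun c t => c Fin.F1 + f t * horner m f (vtail c) t
  end.

Lemma horner_periodic m f c : periodic f -> periodic (horner m f c).
Proof.
  intros Pf; revert c; induction m as [|m IH]; intros c; simpl; [apply periodic_const|].
  apply periodic_plus; [apply periodic_const|]; apply periodic_mult; auto.
Qed.

Lemma horner_linear m f t :
  (forall c d, horner m f (vadd c d) t = horner m f c t + horner m f d t) /\
  (forall a c, horner m f (vscal a c) t = a * horner m f c t).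
Proof.
  induction m as [|m [IH1 IH2]]; simpl; [split; intros; ring|].
  split; intros.
  - change (vtail (vadd c d)) with (vadd (vtail c) (vtail d)); rewrite IH1.
    unfold vadd; ring.
  - change (vtail (vscal a c)) with (vscal a (vtail c)); rewrite IH2.
    unfold vscal; ring.
Qed.

(** If [f] were not null, no nonzero polynomial in [f] would annihilate [delta u]. Such a polynomial
    would be null, so its value at [s], the constant term, would be 0; the factor [f] acts
    injectively and can be cancelled. But [ldim g + 1] powers of [f] applied to [delta u] are
    linearly dependent. As [f s = 0] has been arranged, real coefficients suffice even if the
    centroid is C. *)
Lemma eval_null_of_vanishing s f :
  (forall h, eval_null h -> h s = 0) -> periodic f -> f s = 0 -> eval_null f.
Proof.
  intros Hz Pf Zf; apply NNPP; intros NN.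
  destruct exists_nonzero_vec as (x & Nx).
  destruct (eval_surj x) as (u & Hu & Ex); rewrite <- Ex in Nx; clear x Ex.
  assert (K : forall m c, c <> vzero m -> delta (lmul (horner m f c) u) <> vzero _).
  { induction m as [|m IH]; intros c Nc Z.
    - apply Nc, functional_extensionality; intros i; apply (Fin.case0 (fun i => c i = _)).
    - assert (P : periodic (horner (S m) f c)) by now apply horner_periodic.
      assert (c0 : c Fin.F1 = 0).
      { pose proof (Hz _ (eval_null_of_zero _ u P Hu Nx Z)) as E; simpl in E.
        rewrite Zf in E; lra. }
      assert (Q : periodic (horner m f (vtail c))) by now apply horner_periodic.
      apply NN, (eval_null_of_zero f (lmul (horner m f (vtail c)) u)); auto.
      + inL_tac.
      + apply IH; intros E; apply Nc, vec_S_ext; [exact c0 | exact E].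
      + rewrite <- Z, lmul_lmul; do 2 f_equal; apply functional_extensionality.
        intros t; simpl; rewrite c0; ring. }
  destruct (rlinear_kernel (ldim g) (fun c => delta (lmul (horner _ f c) u)))
    as (c & Nc & Zc).
  - assert (I : forall c, inL g sigma (lmul (horner (S (ldim g)) f c) u))
      by (intros; apply inL_lmul; auto using horner_periodic).
    split; intros.
    + rewrite <- eval_add by auto; f_equal; apply functional_extensionality; intros t.
      unfold lmul; rewrite (proj1 (horner_linear _ f t)); vring.
    + rewrite <- eval_scal by auto; f_equal; apply functional_extensionality; intros t.
      unfold lmul; rewrite (proj2 (horner_linear _ f t)); vring.
  - exact (K _ c Nc Zc).
Qed.

Lemma eval_lmul : exists s, forall f u, periodic f -> inL g sigma u ->
  delta (lmul f u) = vscal (f s) (delta u).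
Proof.
  destruct eval_null_common_zero as (s & Hz); exists s; intros f u Pf Hu.
  assert (P : periodic (fun t => f t + - f s)) by auto using periodic_plus, periodic_const.
  assert (E : eval_null (fun t => f t + - f s)).
  { apply (eval_null_of_vanishing s); auto; ring. }
  rewrite <- eval_scal by exact Hu.
  replace (lmul f u) with
    (fun t => vadd (lmul (fun t => f t + - f s) u t) (vscal (f s) (u t))).
  - rewrite eval_add, (proj2 E) by inL_tac; vring.
  - apply functional_extensionality; intros t; unfold lmul; vring.
Qed.

(** The kernel is an ideal, and it is not all of [g] because [f] is onto and [g] is nonzero. *)
Lemma gaut_of_surjective f :
  flinear g f -> (forall x y, f (lbr g x y) = lbr g (f x) (f y)) ->
  (forall y, exists x, f x = y) -> is_gaut g f.
Proof.
  intros Lf Bf Sf; split; [exact Lf | split; [exact Bf|]].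
  assert (K : forall x, f x = vzero _ -> x = vzero _).
  { destruct (proj2 (proj2 Hg) (fun x => f x = vzero _)) as [H|H].
    - destruct Lf as [Lf Jf]; split; [|split; [|split; [|split]]].
      + now apply rlinear_zero.
      + intros x y Ex Ey; rewrite (rlinear_add f Lf), Ex, Ey; vring.
      + intros a x Ex; rewrite (rlinear_scal f Lf), Ex; vring.
      + destruct (lJ g) as [J|] eqn:EJ; [|easy]; intros x Ex; rewrite Jf, Ex.
        now apply rlinear_zero, J_linear.
      + intros x y Ey; rewrite Bf, Ey; now apply rlinear_zero, bracket_r.
    - exact H.
    - destruct exists_nonzero_vec as (y & Ny); exfalso; apply Ny.
      destruct (Sf y) as (x & <-); apply H. }
  destruct (choice _ Sf) as [h Hh]; exists h; split; [|exact Hh].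
  intros x; apply (rlinear_eq_inj f (proj1 Lf) K), Hh.
Qed.

(** Apply [delta] to the local frame decomposition at [s]: periodic coefficients come out as their
    values at [s], where the bump is 1, so only the coordinates of [u s] remain. *)
Theorem eval_form : exists s A, is_gaut g A /\
  forall u, inL g sigma u -> delta u = A (u s).
Proof.
  destruct eval_lmul as (s & Hm); exists s.
  set (A := fun x => delta (local_section g sigma s x)); exists A.
  assert (LA : rlinear A).
  { split; intros; unfold A.
    - rewrite <- eval_add by inL_tac; f_equal; apply functional_extensionality; intros t.
      now apply local_section_linear.
    - rewrite <- eval_scal by inL_tac; f_equal; apply functional_extensionality; intros t.
      now apply local_section_linear. }
  assert (E : forall u, inL g sigma u -> delta u = A (u s)).
  { intros u Hu; pose proof PI_gt_3.
    assert (cs : cell s s = 0%Z).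
    { pose proof (cell_spec s s) as C; destruct (Z.lt_trichotomy (cell s s) 0) as [L|[?|L]];
        [|easy|]; apply Z.le_succ_l, IZR_le in L; rewrite ?succ_IZR in L; simpl in L; nra. }
    assert (P1 : periodic (sper s (fun r => bump (r - s)))).
    { apply sper_periodic; [apply smoothR_bump_shift | apply bump_far]. }
    assert (P2 : forall i, periodic (sper s (fun r => bump (r - s) * u r i))).
    { intros i; apply sper_periodic.
      - apply smoothR_mult; [apply smoothR_bump_shift | apply Hu].
      - intros t Ht; rewrite bump_far by easy; ring. }
    assert (b0 : bump (s - s) = 1).
    { apply bump_1; rewrite Rminus_diag, Rabs_R0; lra. }
    pose proof (bump_section_decomposition g sigma Hs s u Hu) as D.
    apply (f_equal delta) in D.
    rewrite Hm, (eval_fsum (ldim g) (fun i => lmul (sper s (fun r => bump (r - s) * u r i))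
      (local_section g sigma s (ebasis i)))) in D; auto using periodic_mult.
    2: { intros i; apply inL_lmul; auto; now apply local_section_inL. }
    rewrite sper_eq, cs, Rmult_0_r, Rminus_0_r, b0 in D.
    replace (delta u) with (vscal (1 * 1) (delta u)) by vring; rewrite D.
    apply functional_extensionality; intros l; rewrite (rlinear_coord A LA).
    apply fsum_ext; intros i; unfold A.
    rewrite Hm by (auto; now apply local_section_inL).
    rewrite sper_eq, cs, Rmult_0_r, Rminus_0_r, b0; unfold vscal; ring. }
  split; [|exact E].
  assert (S : forall x, exists u, inL g sigma u /\ u s = x).
  { intros x; exists (local_section g sigma s x); split; [inL_tac|].
    now apply local_section_at. }
  apply gaut_of_surjective; [split; [exact LA|]| |].
  - destruct (lJ g) as [J|] eqn:EJ; [|easy]; intros x.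
    destruct (S x) as (u & Hu & <-).
    rewrite <- (E u), <- (eval_J J), (E (fun t => J (u t))) by (easy || inL_tac); easy.
  - intros x y; destruct (S x) as (u & Hu & <-), (S y) as (v & Hv & <-).
    rewrite <- (E u), <- (E v), <- eval_bracket by easy.
    rewrite (E (fun t => lbr g (u t) (v t))) by inL_tac; easy.
  - intros y; destruct (eval_surj y) as (u & Hu & <-); exists (u s); symmetry; auto.
Qed.
End Eval.

(** * Structure of isomorphisms of twisted loop algebras *)

Lemma cos_sin_lattice x y :
  cos x = cos y -> sin x = sin y -> exists k : Z, x = y + 2 * PI * IZR k.
Proof.
  intros C S.
  assert (E : cos (2 * ((x - y) / 2)) = 1).
  { replace (2 * ((x - y) / 2)) with (x - y) by field.
    rewrite cos_minus, C, S; pose proof (sin2_cos2 y); unfold Rsqr in *; lra. }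
  rewrite cos_2a_sin in E.
  assert (E' : sin ((x - y) / 2) = 0) by nra.
  destruct (sin_eq_0_0 _ E') as [k Ek]; exists k; lra.
Qed.

(** [s] is arbitrary, possibly discontinuous. The lift integrates the angular velocity
    [C S' - S C'], starting from [s 0]. *)
Lemma circle_lift s :
  smoothR (fun t => cos (s t)) -> smoothR (fun t => sin (s t)) ->
  exists lam, smoothR lam /\ forall t, exists k : Z, s t = lam t + 2 * PI * IZR k.
Proof.
  intros SC SS.
  set (C := fun t => cos (s t)) in *; set (S := fun t => sin (s t)) in *.
  assert (N : forall t, C t * C t + S t * S t = 1).
  { intros t; unfold C, S; pose proof (sin2_cos2 (s t)); unfold Rsqr in *; lra. }
  pose proof (fun t => smoothR_is_derive C t SC) as DC.
  pose proof (fun t => smoothR_is_derive S t SS) as DS.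
  pose proof (smoothR_Derive C SC) as SC'; pose proof (smoothR_Derive S SS) as SS'.
  set (C' := Derive C) in *; set (S' := Derive S) in *.
  assert (N' : forall t, C t * C' t + S t * S' t = 0).
  { intros t.
    assert (D1 : is_derive (fun r => C r * C r + S r * S r) t
                   ((C' t * C t + C t * C' t) + (S' t * S t + S t * S' t))).
    { apply (is_derive_plus (fun r => C r * C r) (fun r => S r * S r)).
      - apply (is_derive_mult C C); auto; intros; apply Rmult_comm.
      - apply (is_derive_mult S S); auto; intros; apply Rmult_comm. }
    assert (D2 : is_derive (fun r => C r * C r + S r * S r) t 0).
    { apply (is_derive_ext (fun _ => 1)); [intros; now rewrite N|].
      apply (is_derive_const 1 t). }
    apply is_derive_unique in D1; apply is_derive_unique in D2; lra. }
  assert (Sw : smoothR (fun t => C t * S' t - S t * C' t))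
    by (apply smoothR_minus; now apply smoothR_mult).
  set (lam := fun t => s 0 + RInt (fun t => C t * S' t - S t * C' t) 0 t).
  assert (l0 : lam 0 = s 0) by (unfold lam; rewrite RInt_point; apply Rplus_0_r).
  assert (Sl : smoothR lam)
    by (apply smoothR_plus; [apply smoothR_const | now apply smoothR_RInt]).
  assert (Dl : forall t, is_derive lam t (C t * S' t - S t * C' t)).
  { intros t; evar_last; [apply (is_derive_plus (fun _ => s 0) (RInt _ 0))|].
    - apply (is_derive_const (s 0) t).
    - now apply (smoothR_is_derive_RInt (fun t => C t * S' t - S t * C' t)).
    - apply plus_zero_l. }
  exists lam; split; [exact Sl|]; intros t.
  (* The inner product of the unit vectors at angles [s] and [lam] is constant, hence 1 as at time
     0, so the two vectors agree. *)
  assert (Dp : forall r, is_derive (fun r => C r * cos (lam r) + S r * sin (lam r)) r 0).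
  { intros r; evar_last.
    - apply (is_derive_plus (fun r => C r * cos (lam r)) (fun r => S r * sin (lam r))).
      + apply (is_derive_mult C (fun r => cos (lam r))); [apply DC | |intros; apply Rmult_comm].
        apply (is_derive_comp cos lam); [apply is_derive_Reals, derivable_pt_lim_cos | apply Dl].
      + apply (is_derive_mult S (fun r => sin (lam r))); [apply DS | |intros; apply Rmult_comm].
        apply (is_derive_comp sin lam); [apply is_derive_Reals, derivable_pt_lim_sin | apply Dl].
    - unfold plus, mult, scal; simpl; unfold mult; simpl.
      pose proof (N r) as N1; pose proof (N' r) as N2.
      transitivity ((C' r + S r * (C r * S' r - S r * C' r)) * cos (lam r) +
        (S' r - C r * (C r * S' r - S r * C' r)) * sin (lam r)); [ring|].
      replace (C' r + S r * (C r * S' r - S r * C' r)) with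
        (C' r * (1 - (C r * C r + S r * S r)) + C r * (C r * C' r + S r * S' r)) by ring.
      replace (S' r - C r * (C r * S' r - S r * C' r)) with
        (S' r * (1 - (C r * C r + S r * S r)) + S r * (C r * C' r + S r * S' r)) by ring.
      rewrite N1, N2; ring. }
  pose proof (is_derive_0_const _ Dp t 0) as E; simpl in E.
  rewrite l0 in E; change (cos (s 0)) with (C 0) in E; change (sin (s 0)) with (S 0) in E.
  rewrite N in E.
  pose proof (N t) as N1.
  pose proof (sin2_cos2 (lam t)) as N2; unfold Rsqr in N2.
  assert (Z0 : (C t - cos (lam t)) * (C t - cos (lam t)) +
              (S t - sin (lam t)) * (S t - sin (lam t)) = 0) by nra.
  assert (Z1 : forall a b, a * a + b * b = 0 -> a = 0 /\ b = 0) by (intros; split; nra).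
  apply Z1 in Z0; apply cos_sin_lattice;
    [change (C t = cos (lam t)) | change (S t = sin (lam t))]; lra.
Qed.

(** [sin (f / 2)] is identically 0, and in its derivative [f' / 2 * cos (f / 2)] the cosine is 1 or
    -1; so [f' = 0]. *)
Lemma smooth_lattice_const f :
  smoothR f -> (forall t, exists k : Z, f t = 2 * PI * IZR k) ->
  exists k : Z, forall t, f t = 2 * PI * IZR k.
Proof.
  intros Sf H.
  assert (D : forall t, is_derive f t 0).
  { intros t; pose proof (smoothR_is_derive f t Sf) as Df.
    assert (S0 : forall r, sin (/ 2 * f r) = 0).
    { intros r; destruct (H r) as [k ->]; apply sin_eq_0_1; exists k; field. }
    assert (D1 : is_derive (fun r => sin (/ 2 * f r)) t
                   ((/ 2 * Derive f t) * cos (/ 2 * f t))).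
    { apply (is_derive_comp sin (fun r => / 2 * f r)).
      - apply is_derive_Reals, derivable_pt_lim_sin.
      - now apply (is_derive_scal f). }
    assert (D2 : is_derive (fun r => sin (/ 2 * f r)) t 0).
    { apply (is_derive_ext (fun _ => 0)); [intros; now rewrite S0|].
      apply (is_derive_const 0 t). }
    apply is_derive_unique in D1; apply is_derive_unique in D2; rewrite D2 in D1.
    pose proof (sin2_cos2 (/ 2 * f t)) as N; rewrite S0 in N; unfold Rsqr in N.
    assert (Nc : cos (/ 2 * f t) <> 0) by (intros E; rewrite E in N; lra).
    replace 0 with (Derive f t); [exact Df|].
    symmetry in D1; apply Rmult_integral in D1; lra. }
  destruct (H 0) as [k Hk]; exists k; intros t; now rewrite (is_derive_0_const f D t 0).
Qed.

Definition vcurve {n} (A : R -> vec n -> vec n) : Prop := forall x, vsmooth (fun t => A t x).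

Definition has_form (g : liealg) (sigma : vec (ldim g) -> vec (ldim g))
  (Phi : loop g -> loop g) (lam : R -> R) (phi : R -> vec (ldim g) -> vec (ldim g)) : Prop :=
  smoothR lam /\ (forall t, is_gaut g (phi t)) /\ vcurve phi /\
  forall u t, inL g sigma u -> Phi u t = phi t (u (lam t)).

Section Iso.
Context (g : liealg) (Hg : is_simple g) (Hc : cstruct_ok g).

Lemma liso_inverse sigma sigma' Phi :
  is_gaut g sigma -> is_gaut g sigma' -> is_liso g sigma sigma' Phi ->
  exists Psi, is_liso g sigma' sigma Psi /\
    (forall u, inL g sigma u -> Psi (Phi u) = u) /\
    (forall v, inL g sigma' v -> Phi (Psi v) = v).
Proof.
  intros Hs Hs' (HL & HA & HS & HJ & HB & Psi & KL & K1 & K2).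
  exists Psi; split; [|easy].
  split; [exact KL | split; [|split; [|split; [|split]]]].
  - intros u v Hu Hv.
    replace (fun t => vadd (u t) (v t)) with (Phi (fun t => vadd (Psi u t) (Psi v t)))
      by (rewrite HA, !K2; auto).
    apply K1, inL_add; auto.
  - intros a u Hu.
    replace (fun t => vscal a (u t)) with (Phi (fun t => vscal a (Psi u t)))
      by (rewrite HS, !K2; auto).
    apply K1, inL_scal; auto.
  - destruct (lJ g) as [J|] eqn:EJ; [|easy].
    intros u Hu.
    replace (fun t => J (u t)) with (Phi (fun t => J (Psi u t)))
      by (rewrite HJ, !K2; auto).
    apply K1; eapply inL_J; eauto.
  - intros u v Hu Hv.
    replace (fun t => lbr g (u t) (v t)) with (Phi (fun t => lbr g (Psi u t) (Psi v t)))
      by (rewrite HB, !K2; auto).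
    apply K1, inL_bracket; auto.
  - now exists Phi.
Qed.

Lemma liso_is_eval sigma sigma' Phi t :
  is_gaut g sigma' -> is_liso g sigma sigma' Phi -> is_eval g sigma (fun u => Phi u t).
Proof.
  intros Hs' (HL & HA & HS & HJ & HB & Psi & KL & K1 & K2).
  split; [|split; [|split; [|split]]].
  - intros u v Hu Hv; now rewrite HA.
  - intros a u Hu; now rewrite HS.
  - destruct (lJ g) as [J|]; [|easy]; intros u Hu; now rewrite HJ.
  - intros u v Hu Hv; now rewrite HB.
  - intros x; exists (Psi (local_section g sigma' t x)); split.
    + apply KL, local_section_inL, Hs'.
    + rewrite K2 by (apply local_section_inL, Hs'); now apply local_section_at.
Qed.

(** Evaluating [Phi u] at each [t] gives a point [s t] determined only modulo [2 * PI], chosen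
    without regularity. Smoothness of [f (s t)] for periodic [f] is obtained first; with the cosine
    and sine as [f], a smooth lift [lam] of [s] follows. *)
Theorem liso_has_form sigma sigma' Phi :
  is_gaut g sigma -> is_gaut g sigma' -> is_liso g sigma sigma' Phi ->
  exists lam phi, has_form g sigma Phi lam phi.
Proof.
  intros Hs Hs' HPhi.
  destruct (liso_inverse _ _ _ Hs Hs' HPhi) as (Psi & HPsi & K1 & K2).
  assert (E : forall t, exists sA : R * (vec (ldim g) -> vec (ldim g)),
    is_gaut g (snd sA) /\ forall u, inL g sigma u -> Phi u t = snd sA (u (fst sA))).
  { intros t.
    destruct (eval_form g sigma _ Hg Hc Hs (liso_is_eval _ _ _ t Hs' HPhi)) as (s & A & H).
    now exists (s, A). }
  apply choice in E; destruct E as [sA E].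
  set (s := fun t => fst (sA t)) in *; set (A := fun t => snd (sA t)) in *.
  assert (GA : forall t, is_gaut g (A t)) by apply E.
  assert (FA : forall t u, inL g sigma u -> Phi u t = A t (u (s t))) by apply E.
  clearbody s A; clear E sA.
  assert (SF : forall f, periodic f -> smoothR (fun t => f (s t))).
  { intros f Pf; apply smoothR_local; intros t0.
    destruct (exists_nonzero_vec g Hg) as (x & Nx).
    destruct (vec_neq _ _ _ Nx) as (i & Ni).
    (* [Phi u] is constantly [x] near [t0], so [f (s t)] is there the ratio of coordinate [i] of
       [Phi (f u)] to [x i]. *)
    set (u := Psi (local_section g sigma' t0 x)).
    assert (Hu : inL g sigma u) by now apply HPsi, local_section_inL.
    exists (fun t => / x i * Phi (lmul f u) t i); split.
    - apply smoothR_mult; [apply smoothR_const|].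
      apply (inL_vsmooth g sigma'), HPhi, inL_lmul; auto.
    - exists (mkposreal 1 Rlt_0_1); intros t Ht; change (Rabs (t - t0) < 1) in Ht.
      rewrite FA by now apply inL_lmul.
      unfold lmul; rewrite (rlinear_scal (A t)) by apply (gaut_rlinear g), GA.
      rewrite <- FA by easy; unfold u; rewrite K2 by now apply local_section_inL.
      rewrite local_section_near by (easy || lra).
      unfold vscal; field; exact Ni. }
  assert (Pid : forall f : R -> R, smoothR f -> (forall t, f (t + 2 * PI) = f t) -> periodic f)
    by now split.
  destruct (circle_lift s) as (lam & Sl & Hl).
  { apply SF, Pid; [apply smoothR_sin_cos|].
    intros t; rewrite cos_plus, cos_2PI, sin_2PI; ring. }
  { apply SF, Pid; [apply smoothR_sin_cos|].
    intros t; rewrite sin_plus, cos_2PI, sin_2PI; ring. }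
  apply choice in Hl; destruct Hl as [k Hk].
  destruct (sigma_inv_spec g sigma Hs) as (Gi & E1 & E2).
  (* Replacing [s t] by [lam t] costs [k t] periods, which the twist moves into the automorphism.
     The result is smooth although [A] and [k] need not be. *)
  exists lam, (fun t x => A t (zpow sigma (sigma_inv g sigma) (k t) x)).
  assert (F : forall u t, inL g sigma u ->
    Phi u t = A t (zpow sigma (sigma_inv g sigma) (k t) (u (lam t)))).
  { intros u t Hu; rewrite FA, Hk by easy; f_equal.
    apply zpow_equivariant; auto; apply Hu. }
  split; [exact Sl | split; [|split; [|exact F]]].
  - intros t; apply gaut_comp; auto using gaut_zpow.
  - intros x i; apply smoothR_local; intros t0.
    (* Near [t0], [lam t] stays where this section is constantly [x]. *)
    exists (fun t => Phi (local_section g sigma (lam t0) x) t i); split.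
    + apply (inL_vsmooth g sigma'), HPhi, local_section_inL, Hs.
    + assert (L : locally t0 (fun t => Rabs (lam t - lam t0) < 1)).
      { apply (smoothR_continuous lam t0 Sl (fun y => Rabs (y - lam t0) < 1)).
        exists (mkposreal 1 Rlt_0_1); intros y Hy; exact Hy. }
      revert L; apply filter_imp; intros t Ht.
      rewrite F by now apply local_section_inL.
      rewrite local_section_near by (easy || lra); reflexivity.
Qed.

(** Twisted loops separate points that are distinct modulo the period: otherwise a loop with value
    [x <> 0] at [s] and 0 at [t] would give [A x = 0]. *)
Lemma eval_separated sigma A B s t :
  is_gaut g sigma -> is_gaut g A -> is_gaut g B ->
  (forall u, inL g sigma u -> A (u s) = B (u t)) ->
  exists k : Z, t = s + 2 * PI * IZR k.
Proof.
  intros Hs HA HB H; apply NNPP; intros N.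
  destruct (exists_nonzero_vec g Hg) as (x & Nx); apply Nx.
  destruct (separating_loop g sigma Hs s t x) as (u & Hu & Es & Et).
  { intros k Ek; apply N; eauto. }
  pose proof (H u Hu) as E; rewrite Es, Et, (rlinear_zero B) in E by apply HB.
  destruct HA as (LA & _ & h & Eh & _).
  pose proof (Eh (vzero _)) as Z0; rewrite (rlinear_zero A) in Z0 by apply LA.
  now rewrite <- (Eh x), E.
Qed.

Lemma form_shift sigma sigma' Phi lam phi :
  is_gaut g sigma -> is_gaut g sigma' -> is_liso g sigma sigma' Phi ->
  has_form g sigma Phi lam phi ->
  exists m : Z, (forall t, lam (t + 2 * PI) = lam t + 2 * PI * IZR m) /\
    forall t x, phi (t + 2 * PI) (zpow sigma (sigma_inv g sigma) m x) = sigma' (phi t x).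
Proof.
  intros Hs Hs' HPhi (Sl & Gp & Sp & F).
  destruct (sigma_inv_spec g sigma Hs) as (Gi & E1 & E2).
  assert (H : forall t u, inL g sigma u ->
    sigma' (phi t (u (lam t))) = phi (t + 2 * PI) (u (lam (t + 2 * PI)))).
  { intros t u Hu; rewrite <- !F by easy; symmetry; now apply HPhi. }
  destruct (smooth_lattice_const (fun t => lam (t + 2 * PI) - lam t)) as [m Hm].
  - apply smoothR_minus; [|exact Sl]; apply (smoothR_comp (fun t => t + 2 * PI)); auto.
    apply smoothR_plus; [apply smoothR_id | apply smoothR_const].
  - intros t.
    destruct (eval_separated sigma (fun x => sigma' (phi t x)) (phi (t + 2 * PI))
      (lam t) (lam (t + 2 * PI)) Hs) as [k Hk]; auto using gaut_comp.
    exists k; lra.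
  - exists m.
    assert (Hm' : forall t, lam (t + 2 * PI) = lam t + 2 * PI * IZR m)
      by (intros t; rewrite <- (Hm t); ring).
    split; [exact Hm'|]; intros t x.
    pose proof (H t (local_section g sigma (lam t) x)) as E.
    rewrite Hm', (zpow_equivariant _ sigma (sigma_inv g sigma)) in E;
      auto; [|apply local_section_inL, Hs].
    rewrite local_section_at in E by easy; symmetry; apply E.
    now apply local_section_inL.
Qed.

(** [m] is the degree of [lam] as a map of the circle. [st_mono] says at once that [lam] has no
    critical point and that its direction is the sign of [m]. *)
Record structured (sigma sigma' : vec (ldim g) -> vec (ldim g)) (Phi : loop g -> loop g)
  (lam : R -> R) (phi chi : R -> vec (ldim g) -> vec (ldim g)) (m : Z) : Prop := {
  st_form : has_form g sigma Phi lam phi;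
  st_deg : m = 1%Z \/ m = (-1)%Z;
  st_lam_shift : forall t, lam (t + 2 * PI) = lam t + 2 * PI * IZR m;
  st_mono : forall t, 0 < IZR m * Derive lam t;
  st_shift : forall t x,
    phi (t + 2 * PI) (zpow sigma (sigma_inv g sigma) m x) = sigma' (phi t x);
  st_inv_gaut : forall t, is_gaut g (chi t);
  st_inv_smooth : vcurve chi;
  st_inv_l : forall t x, chi t (phi t x) = x;
  st_inv_r : forall t x, phi t (chi t x) = x
}.

(** The two parametrisations were lifted independently, so they are inverse only up to a multiple of
    [2 * PI], compensated by a power of the twist. *)
Lemma form_inverse sigma sigma' Phi Psi lam phi mu theta :
  is_gaut g sigma -> is_gaut g sigma' ->
  has_form g sigma Phi lam phi -> has_form g sigma' Psi mu theta ->
  (forall u, inL g sigma u -> inL g sigma' (Phi u)) ->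
  (forall u, inL g sigma u -> Psi (Phi u) = u) ->
  exists k : Z, (forall t, lam (mu t) = t + 2 * PI * IZR k) /\
    forall t x, theta t (phi (mu t) (zpow sigma (sigma_inv g sigma) k x)) = x.
Proof.
  intros Hs Hs' (Sl & Gp & Sp & F) (Sm & Gt & St & G) HL K.
  destruct (sigma_inv_spec g sigma Hs) as (Gi & E1 & E2).
  assert (H : forall t u, inL g sigma u -> u t = theta t (phi (mu t) (u (lam (mu t))))).
  { intros t u Hu; rewrite <- F, <- G, K; auto. }
  destruct (smooth_lattice_const (fun t => lam (mu t) - t)) as [k Hk].
  - apply smoothR_minus; [now apply smoothR_comp | apply smoothR_id].
  - intros t.
    destruct (eval_separated sigma (fun x => x) (fun x => theta t (phi (mu t) x))
      t (lam (mu t)) Hs) as [k Hk]; auto using gaut_comp, gaut_id.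
    exists k; lra.
  - assert (Hk' : forall t, lam (mu t) = t + 2 * PI * IZR k)
      by (intros t; rewrite <- (Hk t); ring).
    exists k; split; [exact Hk'|]; intros t x.
    pose proof (H t (local_section g sigma t x)) as E.
    rewrite Hk', (zpow_equivariant _ sigma (sigma_inv g sigma)) in E;
      auto; [|apply local_section_inL, Hs].
    rewrite local_section_at in E by easy; symmetry; apply E.
    now apply local_section_inL.
Qed.

Theorem liso_structured sigma sigma' Phi :
  is_gaut g sigma -> is_gaut g sigma' -> is_liso g sigma sigma' Phi ->
  exists lam phi chi m, structured sigma sigma' Phi lam phi chi m.
Proof.
  intros Hs Hs' HPhi.
  destruct (liso_inverse _ _ _ Hs Hs' HPhi) as (Psi & HPsi & K1 & K2).
  destruct (liso_has_form _ _ _ Hs Hs' HPhi) as (lam & phi & Fp).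
  destruct (liso_has_form _ _ _ Hs' Hs HPsi) as (mu & theta & Ft).
  destruct (form_inverse _ _ _ _ _ _ _ _ Hs Hs' Fp Ft) as (k1 & L1 & I1);
    [apply HPhi | exact K1|].
  destruct (form_inverse _ _ _ _ _ _ _ _ Hs' Hs Ft Fp) as (k2 & L2 & I2);
    [apply HPsi | exact K2|].
  destruct (form_shift _ _ _ _ _ Hs Hs' HPhi Fp) as (m & Lm & Im).
  destruct (form_shift _ _ _ _ _ Hs' Hs HPsi Ft) as (m' & Lm' & _).
  destruct (sigma_inv_spec g sigma' Hs') as (Gi & E1 & E2).
  pose proof Fp as (Sl & Gp & Sp & F); pose proof Ft as (Sm & Gt & St & G).
  (* [mu (lam t)] is [t] plus a constant, so the degrees [m] and [m'] multiply to 1. *)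
  assert (Hm : m = 1%Z \/ m = (-1)%Z).
  { apply (Z.eq_mul_1 m m'), eq_IZR; rewrite mult_IZR.
    pose proof PI_gt_3.
    assert (E : mu (lam (0 + 2 * PI)) = mu (lam 0) + 2 * PI * (IZR m * IZR m')).
    { rewrite Lm.
      assert (Q : forall j t, mu (t + 2 * PI * IZR j) = mu t + 2 * PI * IZR j * IZR m').
      { intros j; apply (Z.bi_induction (fun j => forall t,
          mu (t + 2 * PI * IZR j) = mu t + 2 * PI * IZR j * IZR m')).
        - now intros ? ? ->.
        - intros t; rewrite Rmult_0_r, Rmult_0_l, !Rplus_0_r; reflexivity.
        - clear j; intros j.
          assert (S : forall t, mu (t + 2 * PI * IZR (Z.succ j)) =
            mu (t + 2 * PI * IZR j) + 2 * PI * IZR m').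
          { intros t; rewrite <- Lm', succ_IZR; f_equal; ring. }
          split; intros Q t; pose proof (Q t) as Qt.
          + rewrite S, Qt, succ_IZR; ring.
          + rewrite S, succ_IZR in Qt; lra. }
      rewrite Q; ring. }
    rewrite !L2 in E; nra. }
  (* Every point is a value of [mu], and there the chain rule for the translation [lam (mu t)]
     excludes a zero derivative. *)
  assert (D0 : forall t, Derive lam t <> 0).
  { intros y; replace y with (mu (lam (y - 2 * PI * IZR k2))) by (rewrite L2; ring).
    generalize (lam (y - 2 * PI * IZR k2)) as t; intros t E.
    assert (D1 : is_derive (fun r => lam (mu r)) t (Derive mu t * Derive lam (mu t))).
    { apply (is_derive_comp lam mu); apply smoothR_is_derive; auto. }
    assert (D2 : is_derive (fun r => lam (mu r)) t 1).
    { apply (is_derive_ext (fun r => r + 2 * PI * IZR k1)); [intros; now rewrite L1|].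
      auto_derive; [easy | ring]. }
    apply is_derive_unique in D1; apply is_derive_unique in D2.
    rewrite D1, E in D2; lra. }
  assert (DC : forall t, continuity_pt (Derive lam) t).
  { intros t; apply continuity_pt_filterlim; apply (smoothR_continuous (Derive lam)).
    now apply smoothR_Derive. }
  exists lam, phi, (fun t x => theta (lam t) (zpow sigma' (sigma_inv g sigma') k2 x)), m.
  assert (IR : forall t x, phi t (theta (lam t)
    (zpow sigma' (sigma_inv g sigma') k2 x)) = x) by (intros; apply I2).
  split; auto.
  (* By the mean value theorem over one period [Derive lam] takes the value [m]; having no zero, it
     keeps that sign. *)
  - pose proof PI_gt_3.
    destruct (MVT_gen lam 0 (0 + 2 * PI) (Derive lam)) as (c & _ & Ec).
    { intros x _; now apply smoothR_is_derive. }
    { intros x _; apply continuity_pt_filterlim; now apply (smoothR_continuous lam). }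
    rewrite Lm in Ec; assert (Dc : Derive lam c = IZR m) by nra.
    intros t; apply NNPP; intros N.
    destruct (IVT_gen (Derive lam) c t 0) as (z & _ & Ez); [exact DC | |exact (D0 z Ez)].
    pose proof (D0 t); rewrite Dc; unfold Rmin, Rmax.
    destruct Hm as [-> | ->]; destruct (Rle_dec _ _); lra.
  - intros t; apply gaut_comp; auto using gaut_zpow.
  - intros x i; apply (smoothR_comp lam (fun r => theta r _ i)); auto; apply St.
  - intros t x; destruct (gaut_inverse g (phi t) (Gp t)) as (h & _ & Eh & _).
    rewrite <- (Eh (theta _ _)), IR; apply Eh.
Qed.
End Iso.

(** * Linear differential equations *)

Lemma geometric_series_tail a C :
  (forall k, Rabs (a k) <= C * (/ 2) ^ k) ->
  ex_series a /\ forall N, Rabs (Series a - sum_f_R0 a N) <= C * (/ 2) ^ N.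
Proof.
  intros H.
  assert (G : Rabs (/ 2) < 1) by (rewrite Rabs_pos_eq; lra).
  assert (Eg : forall D, ex_series (fun k => D * (/ 2) ^ k)).
  { intros D; apply (ex_series_scal_l (V := R_NormedModule) D (fun k => (/ 2) ^ k)), ex_series_geom, G. }
  assert (Ea : ex_series a) by (apply (ex_series_le a _ H), Eg).
  split; [exact Ea|]; intros N.
  rewrite (Series_incr_n a (S N)) by (lia || exact Ea); simpl pred.
  replace (sum_f_R0 a N + Series (fun k => a (S N + k)%nat) - sum_f_R0 a N)
    with (Series (fun k => a (S N + k)%nat)) by ring.
  assert (T : forall k, Rabs (a (S N + k)%nat) <= C * (/ 2) ^ S N * (/ 2) ^ k).
  { intros k; rewrite Rmult_assoc, <- pow_add; apply H. }
  eapply Rle_trans; [apply Series_Rabs|].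
  - apply (ex_series_le (fun k => Rabs (a (S N + k)%nat)) (fun k => C * (/ 2) ^ S N * (/ 2) ^ k)); [|apply Eg].
    intros k; unfold norm; simpl; unfold abs; simpl; rewrite Rabs_Rabsolu; apply T.
  - eapply Rle_trans; [apply (Series_le _ (fun k => C * (/ 2) ^ S N * (/ 2) ^ k))|].
    + intros k; split; [apply Rabs_pos | apply T].
    + apply Eg.
    + rewrite Series_scal_l, Series_geom by exact G.
      simpl; right; field.
Qed.

(** A mean value inequality with majorant [G]; negative times are reduced to positive ones by
    reflection. *)
Lemma is_derive_abs_bound (f f' G G' : R -> R) T :
  f 0 = 0 -> (forall t, is_derive f t (f' t)) -> (forall t, is_derive G t (G' t)) ->
  (forall t, Rabs t <= T -> Rabs (f' t) <= G' (Rabs t)) ->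
  forall t, Rabs t <= T -> Rabs (f t) <= G (Rabs t) - G 0.
Proof.
  intros f0 Df DG B.
  assert (K : forall h h' : R -> R, h 0 = 0 -> (forall t, is_derive h t (h' t)) ->
    (forall t, 0 <= t <= T -> Rabs (h' t) <= G' t) ->
    forall t, 0 <= t <= T -> h t <= G t - G 0).
  { intros h h' h0 Dh Bh t Ht.
    assert (D : forall r, is_derive (fun r => G r - h r) r (G' r - h' r))
      by (intros r; apply (is_derive_minus G h); auto).
    destruct (MVT_gen (fun r => G r - h r) 0 t (fun r => G' r - h' r)) as (c & Hc & E).
    - intros x _; apply D.
    - intros x _; apply continuity_pt_filterlim, (ex_derive_continuous (fun r => G r - h r)).
      eexists; apply D.
    - rewrite Rmin_left, Rmax_right in Hc by lra.
      rewrite h0 in E; pose proof (Bh c) as Bc.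
      pose proof (Rle_abs (h' c)); nra. }
  assert (K2 : forall h h' : R -> R, h 0 = 0 -> (forall t, is_derive h t (h' t)) ->
    (forall t, 0 <= t <= T -> Rabs (h' t) <= G' t) ->
    forall t, 0 <= t <= T -> Rabs (h t) <= G t - G 0).
  { intros h h' h0 Dh Bh t Ht; apply Rabs_le; split.
    - enough (- h t <= G t - G 0) by lra.
      apply (K (fun r => - h r) (fun r => - h' r)); auto.
      + rewrite h0; ring.
      + intros r; apply (is_derive_opp h); auto.
      + intros r Hr; rewrite Rabs_Ropp; auto.
    - now apply (K h h'). }
  intros t Ht; destruct (Rle_dec 0 t) as [P|P].
  - rewrite (Rabs_pos_eq t) in * by easy; apply (K2 f f'); auto.
    intros r Hr; replace (G' r) with (G' (Rabs r)) by (f_equal; apply Rabs_pos_eq; lra).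
    apply B.
    rewrite Rabs_pos_eq; lra.
  - rewrite (Rabs_left t) in * by lra.
    replace (f t) with (f (- - t)) by (f_equal; ring).
    apply (K2 (fun r => f (- r)) (fun r => -1 * f' (- r))); [| | |lra].
    + now rewrite Ropp_0.
    + intros r; apply (is_derive_comp f (fun r => - r)); [apply Df|].
      auto_derive; [easy | ring].
    + intros r Hr; replace (-1 * f' (- r)) with (- f' (- r)) by ring.
      rewrite Rabs_Ropp.
      replace (G' r) with (G' (Rabs (- r))) by (rewrite Rabs_Ropp, Rabs_pos_eq; [easy|lra]).
      apply B; rewrite Rabs_Ropp, Rabs_pos_eq; lra.
Qed.

Lemma exp_mono x y : x <= y -> exp x <= exp y.
Proof.
  intros [H | ->]; [now apply Rlt_le, exp_increasing | apply Rle_refl].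
Qed.

Lemma fsum_le n (F G : Fin.t n -> R) : (forall i, F i <= G i) -> fsum n F <= fsum n G.
Proof.
  induction n as [|n IH]; intros H; simpl; [lra|].
  apply Rplus_le_compat; [apply H|]; apply IH; auto.
Qed.

Lemma fsum_Rabs n (F : Fin.t n -> R) : Rabs (fsum n F) <= fsum n (fun i => Rabs (F i)).
Proof.
  induction n as [|n IH]; simpl; [rewrite Rabs_R0; lra|].
  eapply Rle_trans; [apply Rabs_triang|].
  apply Rplus_le_compat_l, IH.
Qed.

Lemma fsum_nonneg n (F : Fin.t n -> R) : (forall i, 0 <= F i) -> 0 <= fsum n F.
Proof. intros H; rewrite <- (fsum_0 n (fun _ => 0)) by easy; now apply fsum_le. Qed.

Lemma fsum_term_le n (F : Fin.t n -> R) j : (forall i, 0 <= F i) -> F j <= fsum n F.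
Proof.
  induction j as [n|n j IH]; intros H; simpl.
  - pose proof (fsum_nonneg n (fun i => F (Fin.FS i))) as P; specialize (P (fun i => H _)); lra.
  - pose proof (IH (fun i => F (Fin.FS i)) (fun i => H _)); pose proof (H Fin.F1); lra.
Qed.

Section ODE.
Context {n : nat} (X : R -> vec n -> vec n) (LX : forall t, rlinear (X t)) (SX : vcurve X).
Context (y0 : vec n).

(** These are not the Picard iterates but their successive increments, that is, iterated integrals.
    The solution is their sum. *)
Fixpoint picard (k : nat) : R -> vec n :=
  match k with
  | O => fun _ => y0
  | S k => fun t j => RInt (fun s => X s (picard k s) j) 0 t
  end.

Lemma picard_smooth k : vsmooth (picard k).
Proof.
  induction k as [|k IH]; [apply vsmooth_const|]; intros j; simpl.
  apply (smoothR_RInt (fun s => X s (picard k s) j)).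
  now apply (vsmooth_app n n X (picard k)).
Qed.

Lemma picard_derive k t : is_vderive (picard (S k)) t (X t (picard k t)).
Proof.
  intros j; simpl; apply (smoothR_is_derive_RInt (fun s => X s (picard k s) j)).
  apply (vsmooth_app n n X (picard k)); auto using picard_smooth.
Qed.

Lemma picard_zero k : picard (S k) 0 = vzero n.
Proof. apply functional_extensionality; intros j; exact (RInt_point 0 (fun s => X s (picard k s) j)). Qed.

Lemma operator_bound T : 0 <= T -> exists M, 0 < M /\
  forall t x B, Rabs t <= T -> (forall i, Rabs (x i) <= B) -> forall j, Rabs (X t x j) <= M * B.
Proof.
  intros HT.
  (* [1 + a * a] bounds the absolute value of [a] and is smooth, so the extreme value theorem
     applies to the sum over all matrix entries. *)
  set (F := fun t => fsum n (fun j => fsum n (fun i => 1 + X t (ebasis i) j * X t (ebasis i) j))).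
  assert (SF : smoothR F).
  { apply (smoothR_fsum n (fun j t => fsum n (fun i => 1 + X t (ebasis i) j * X t (ebasis i) j))).
    intros j; apply (smoothR_fsum n (fun i t => 1 + X t (ebasis i) j * X t (ebasis i) j)).
    intros i; apply smoothR_plus; [apply smoothR_const|].
    apply smoothR_mult; apply (SX (ebasis i) j). }
  destruct (continuity_ab_maj F (- T) T) as (m & Hm & _); [lra| |].
  { intros t _; apply continuity_pt_filterlim; now apply (smoothR_continuous F). }
  assert (P1 : forall t j i, 0 <= 1 + X t (ebasis i) j * X t (ebasis i) j) by (intros; nra).
  assert (PF : forall t, 0 <= F t) by (intros; do 2 (apply fsum_nonneg; intros); auto).
  exists (F m + 1); split; [pose proof (PF m); lra|].
  intros t x B Ht Hx j; rewrite (rlinear_coord (X t) (LX t)).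
  eapply Rle_trans; [apply fsum_Rabs|].
  apply Rle_trans with (F t * B).
  - apply Rle_trans with (B * fsum n (fun i => 1 + X t (ebasis i) j * X t (ebasis i) j)).
    + rewrite <- fsum_scal; apply fsum_le; intros i; rewrite Rabs_mult.
      pose proof (Rabs_pos (x i)).
      apply Rmult_le_compat; auto using Rabs_pos.
      unfold Rabs; destruct (Rcase_abs _); nra.
    + rewrite Rmult_comm; apply Rmult_le_compat_r.
      * eapply Rle_trans; [apply Rabs_pos | apply (Hx j)].
      * apply (fsum_term_le n (fun j => fsum n (fun i => 1 + X t (ebasis i) j * X t (ebasis i) j))).
        intros; now apply fsum_nonneg.
  - apply Rmult_le_compat_r; [eapply Rle_trans; [apply Rabs_pos | apply (Hx j)]|].
    apply Rabs_le_between in Ht; pose proof (Hm t); lra.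
Qed.

(* With the weight [exp (2 M |t|)] each Picard step halves the bound, so the series converges geometrically. *)
Lemma picard_bound T : 0 <= T -> exists C,
  forall k t j, Rabs t <= T -> Rabs (picard k t j) <= C * (/ 2) ^ k.
Proof.
  intros HT; destruct (operator_bound T HT) as (M & PM & HM).
  set (C := fsum n (fun i => Rabs (y0 i))).
  assert (PC : 0 <= C) by (apply fsum_nonneg; intros; apply Rabs_pos).
  assert (W : forall k t j, Rabs t <= T ->
    Rabs (picard k t j) <= C * (/ 2) ^ k * exp (2 * M * Rabs t)).
  { induction k as [|k IH]; intros t j Ht.
    - simpl pow; rewrite Rmult_1_r.
      assert (B : Rabs (y0 j) <= C).
      { apply (fsum_term_le n (fun i => Rabs (y0 i))); intros; apply Rabs_pos. }
      assert (1 <= exp (2 * M * Rabs t)).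
      { rewrite <- exp_0; apply exp_mono; pose proof (Rabs_pos t); nra. }
      simpl; nra.
    - set (G := fun r => C * (/ 2) ^ S k * exp (2 * M * r)).
      assert (Q : Rabs (picard (S k) t j) <= G (Rabs t) - G 0).
      { apply (is_derive_abs_bound (fun r => picard (S k) r j)
          (fun r => X r (picard k r) j) G (fun r => M * (C * (/ 2) ^ k * exp (2 * M * r))) T).
        - now rewrite picard_zero.
        - intros r; apply (picard_derive k r j).
        - intros r; unfold G; auto_derive; [easy|]; simpl; field.
        - intros r Hr; apply HM; auto.
        - exact Ht. }
      assert (0 <= G 0); [|unfold G in *; lra].
      unfold G; apply Rmult_le_pos; [apply Rmult_le_pos; [lra|]; apply pow_le; lra |].
      apply Rlt_le, exp_pos. }
  exists (C * exp (2 * M * T)); intros k t j Ht.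
  eapply Rle_trans; [apply W, Ht|].
  assert (E : exp (2 * M * Rabs t) <= exp (2 * M * T)) by (apply exp_mono; nra).
  assert (P : 0 <= C * (/ 2) ^ k) by (apply Rmult_le_pos; [lra | apply pow_le; lra]).
  replace (C * exp (2 * M * T) * (/ 2) ^ k) with (C * (/ 2) ^ k * exp (2 * M * T)) by ring.
  now apply Rmult_le_compat_l.
Qed.

Definition picard_sum (N : nat) (t : R) : vec n := fun j => sum_f_R0 (fun k => picard k t j) N.

Definition picard_limit (t : R) : vec n := fun j => Series (fun k => picard k t j).

Lemma picard_sum_smooth N : vsmooth (picard_sum N).
Proof.
  induction N as [|N IH]; intros j; unfold picard_sum; simpl.
  - apply smoothR_const.
  - apply smoothR_plus; [apply IH | apply (picard_smooth (S N))].
Qed.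

Lemma picard_sum_derive N t : is_vderive (picard_sum (S N)) t (X t (picard_sum N t)).
Proof.
  induction N as [|N IH].
  - change (picard_sum 0 t) with (picard 0 t).
    replace (X t (picard 0 t)) with (vadd (vzero n) (X t (picard 0 t))) by vring.
    apply (is_vderive_add n (picard_sum 0) (picard 1)).
    + apply is_vderive_const.
    + apply picard_derive.
  - replace (X t (picard_sum (S N) t)) with
      (vadd (X t (picard_sum N t)) (X t (picard (S N) t))).
    + apply (is_vderive_add n (picard_sum (S N)) (picard (S (S N)))); auto using picard_derive.
    + now rewrite <- (rlinear_add (X t) (LX t)).
Qed.

Lemma picard_sum_close T : 0 <= T -> exists C, 0 <= C /\ forall N t j, Rabs t <= T ->
  Rabs (picard_limit t j - picard_sum N t j) <= C * (/ 2) ^ N.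
Proof.
  intros HT; destruct (picard_bound T HT) as (C & HC); exists (Rabs C).
  split; [apply Rabs_pos|]; intros N t j Ht.
  eapply Rle_trans; [apply (geometric_series_tail (fun k => picard k t j) C)|].
  - intros k; now apply HC.
  - apply Rmult_le_compat_r; [apply pow_le; lra | apply Rle_abs].
Qed.

Lemma half_pow_small C eps : 0 <= C -> 0 < eps ->
  exists N, forall m, (N <= m)%nat -> C * (/ 2) ^ m < eps.
Proof.
  intros HC He.
  destruct (pow_lt_1_zero (/ 2) ltac:(rewrite Rabs_pos_eq; lra) (eps / (C + 1)))
    as (N & HN); [apply Rdiv_lt_0_compat; lra|].
  exists N; intros m Hm; specialize (HN m Hm).
  assert (P : 0 < (/ 2) ^ m) by (apply pow_lt; lra).
  rewrite Rabs_pos_eq in HN by lra.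
  apply Rlt_div_r in HN; [nra | lra].
Qed.

Lemma Boule_0 (r : posreal) t : Boule 0 r t -> Rabs t <= r.
Proof. unfold Boule; rewrite Rminus_0_r; lra. Qed.

Lemma picard_limit_continuous j t : continuity_pt (fun s => picard_limit s j) t.
Proof.
  pose proof (Rabs_pos t).
  assert (P : 0 < Rabs t + 1) by lra.
  destruct (picard_sum_close (Rabs t + 1)) as (C & HC & K); [lra|].
  apply (CVU_continuity (fun N s => picard_sum N s j) (fun s => picard_limit s j)
    0 (mkposreal _ P)).
  - intros eps He; destruct (half_pow_small C eps HC He) as (N & HN).
    exists N; intros m s Hm Hs; apply Boule_0 in Hs; simpl in Hs.
    eapply Rle_lt_trans; [now apply K | now apply HN].
  - intros N s _; apply continuity_pt_filterlim.
    apply (smoothR_continuous (fun s => picard_sum N s j)), picard_sum_smooth.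
  - unfold Boule; simpl; rewrite Rminus_0_r; lra.
Qed.

Lemma fsum_continuous m (F : Fin.t m -> R -> R) t :
  (forall i, continuity_pt (F i) t) -> continuity_pt (fun s => fsum m (fun i => F i s)) t.
Proof.
  induction m as [|m IH]; intros H; simpl.
  - now apply continuity_pt_const.
  - apply (continuity_pt_plus (F Fin.F1) (fun s => fsum m (fun i => F (Fin.FS i) s)));
      [apply H | apply (IH (fun i => F (Fin.FS i))); auto].
Qed.

Lemma picard_limit_derive t : is_vderive picard_limit t (X t (picard_limit t)).
Proof.
  intros j; apply is_derive_Reals.
  pose proof (Rabs_pos t).
  assert (P : 0 < Rabs t + 1) by lra.
  assert (HT : 0 <= Rabs t + 1) by lra.
  destruct (picard_sum_close (Rabs t + 1) HT) as (C & HC & K).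
  destruct (operator_bound (Rabs t + 1) HT) as (M & PM & HM).
  (* The derivative of partial sum [S N] is [X] applied to partial sum [N], hence the shifted
     index. *)
  apply (derivable_pt_lim_CVU (fun N s => picard_sum (S N) s j)
    (fun N s => X s (picard_sum N s) j) (fun s => picard_limit s j)
    (fun s => X s (picard_limit s) j) t 0 (mkposreal _ P)).
  - unfold Boule; simpl; rewrite Rminus_0_r; lra.
  - intros s N _; apply is_derive_Reals, (picard_sum_derive N s j).
  - intros s Hs eps He; apply Boule_0 in Hs; simpl in Hs.
    destruct (half_pow_small C eps HC He) as (N & HN).
    exists N; intros m Hm; unfold R_dist; rewrite Rabs_minus_sym.
    eapply Rle_lt_trans; [now apply K | apply HN; lia].
  - intros eps He.
    destruct (half_pow_small (M * C) eps) as (N & HN); [nra | exact He|].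
    exists N; intros m s Hm Hs; apply Boule_0 in Hs; simpl in Hs.
    replace (X s (picard_limit s) j - X s (picard_sum m s) j)
      with (X s (vadd (picard_limit s) (vopp (picard_sum m s))) j).
    2: { rewrite (rlinear_add _ (LX s)), (rlinear_opp _ (LX s)); unfold vadd, vopp; ring. }
    eapply Rle_lt_trans; [|apply (HN m Hm)].
    rewrite Rmult_assoc; apply HM; [exact Hs|]; intros i; now apply K.
  - intros s _.
    apply (continuity_pt_ext (fun s => fsum n (fun i => picard_limit s i * X s (ebasis i) j))).
    { intros r; symmetry; apply (rlinear_coord (X r) (LX r)). }
    apply (fsum_continuous n (fun i s => picard_limit s i * X s (ebasis i) j)); intros i.
    apply (continuity_pt_mult (fun s => picard_limit s i) (fun s => X s (ebasis i) j)).
    + apply picard_limit_continuous.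
    + apply continuity_pt_filterlim, (smoothR_continuous (fun s => X s (ebasis i) j)), SX.
Qed.

Lemma picard_limit_zero : picard_limit 0 = y0.
Proof.
  apply functional_extensionality; intros j; unfold picard_limit.
  destruct (picard_bound 0) as (C & HC); [lra|].
  rewrite Series_incr_1.
  - rewrite (Series_ext _ (fun k => 0 * 0)), Series_scal_l, Rmult_0_l; [apply Rplus_0_r|].
    intros k; rewrite picard_zero; unfold vzero; ring.
  - apply (geometric_series_tail (fun k => picard k 0 j) C); intros k; apply HC.
    rewrite Rabs_R0; lra.
Qed.

(** Bootstrapping: if [y] has order [k], so does [X y], which is the derivative of [y]. *)
Lemma ode_smooth y : (forall t, is_vderive y t (X t (y t))) -> vsmooth y.
Proof.
  intros D.
  assert (A : forall k j t, Ck_at k (fun s => y s j) t).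
  { induction k as [|k IH]; intros j t; [easy|].
    exists (fun s => X s (y s) j); split; [apply filter_forall; intros s; apply D|].
    apply (Ck_at_ext_loc k (fun s => fsum n (fun i => y s i * X s (ebasis i) j))).
    { apply filter_forall; intros s; symmetry; apply (rlinear_coord (X s) (LX s)). }
    assert (B : forall m (F : Fin.t m -> R -> R), (forall i, Ck_at k (F i) t) ->
      Ck_at k (fun s => fsum m (fun i => F i s)) t).
    { induction m as [|m IHm]; intros F HF; simpl; [apply Ck_at_const|].
      apply (Ck_at_plus k (F Fin.F1)); [apply HF|].
      apply (IHm (fun i => F (Fin.FS i))); auto. }
    apply (B n (fun i s => y s i * X s (ebasis i) j)); intros i.
    apply (Ck_at_mult k (fun s => y s i) (fun s => X s (ebasis i) j)); [apply IH|].
    apply (proj1 (smoothR_smooth_at (fun s => X s (ebasis i) j)) (SX (ebasis i) j) t). }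
  intros j; apply smoothR_smooth_at; intros t k; apply A.
Qed.

Theorem linear_ode : exists y, vsmooth y /\ y 0 = y0 /\ forall t, is_vderive y t (X t (y t)).
Proof.
  exists picard_limit; split; [|split].
  - apply ode_smooth, picard_limit_derive.
  - apply picard_limit_zero.
  - apply picard_limit_derive.
Qed.
End ODE.

(** * Parallel transport *)

Section Transport.
Context {n : nat} (X : R -> vec n -> vec n) (LX : forall t, rlinear (X t)) (SX : vcurve X).

Lemma fsum_rlinear (F : Fin.t n -> vec n) :
  rlinear (fun (x : vec n) j => fsum n (fun i => x i * F i j)).
Proof.
  split; intros; apply functional_extensionality; intros j; unfold vadd, vscal.
  - rewrite <- fsum_plus; apply fsum_ext; intros; ring.
  - rewrite <- fsum_scal; apply fsum_ext; intros; ring.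
Qed.

(** Solutions are taken for the basis vectors only and combined linearly, so that linearity in the
    initial value holds without a uniqueness theorem. *)
Lemma forward_transport : exists d : R -> vec n -> vec n,
  (forall t, rlinear (d t)) /\ vcurve d /\ (forall x, d 0 x = x) /\
  forall x t, is_vderive (fun s => d s x) t (X t (d t x)).
Proof.
  destruct (choice _ (linear_ode X LX SX)) as [y Hy].
  set (d := fun t (x : vec n) j => fsum n (fun i => x i * y (ebasis i) t j)).
  exists d; split; [intros t; apply (fsum_rlinear (fun i => y (ebasis i) t))|].
  split; [|split].
  - intros x j; apply (smoothR_fsum n (fun i t => x i * y (ebasis i) t j)); intros i.
    apply smoothR_mult; [apply smoothR_const | apply Hy].
  - intros x; apply functional_extensionality; intros j; unfold d.
    rewrite <- (fsum_ebasis n x j); apply fsum_ext; intros i.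
    destruct (Hy (ebasis i)) as (_ & -> & _); reflexivity.
  - intros x t j; unfold d.
    replace (X t _ j) with (fsum n (fun i => x i * X t (y (ebasis i) t) j)).
    + apply (is_derive_fsum n (fun i t => x i * y (ebasis i) t j)); intros i.
      apply (is_derive_scal (fun t => y (ebasis i) t j)); apply Hy.
    + transitivity (X t (fun l => fsum n (fun i => vscal (x i) (y (ebasis i) t) l)) j);
        [|reflexivity].
      rewrite (rlinear_fsum _ (LX t) n (fun i => vscal (x i) (y (ebasis i) t))).
      apply fsum_ext; intros i; now rewrite (rlinear_scal _ (LX t)).
Qed.
End Transport.

(* [d' = -X d] is solved columnwise and [c' = c X] rowwise; [c d] is then constant. *)
Theorem parallel_transport n (X : R -> vec n -> vec n) :
  (forall t, rlinear (X t)) -> vcurve X ->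
  exists c d : R -> vec n -> vec n,
    (forall t, rlinear (c t)) /\ (forall t, rlinear (d t)) /\ vcurve c /\ vcurve d /\
    (forall t x, c t (d t x) = x) /\ (forall t x, d t (c t x) = x) /\ (forall x, d 0 x = x) /\
    (forall x t, is_vderive (fun s => c s x) t (c t (X t x))) /\
    (forall x t, is_vderive (fun s => d s x) t (vopp (X t (d t x)))).
Proof.
  intros LX SX.
  destruct (forward_transport (fun t x => vopp (X t x))) as (d & Ld & Sd & d0 & Dd).
  { intros t; split; intros; [rewrite (rlinear_add _ (LX t)) | rewrite (rlinear_scal _ (LX t))];
      vring. }
  { intros x j; apply smoothR_opp, SX. }
  (* The transpose of [X]: the rows of [c] evolve by [r' = XT r]. *)
  set (XT := fun t (y : vec n) i => fsum n (fun k => y k * X t (ebasis i) k)).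
  destruct (forward_transport XT) as (r & Lr & Sr & r0 & Dr).
  { intros t; apply (fsum_rlinear (fun k i => X t (ebasis i) k)). }
  { intros y i; apply (smoothR_fsum n (fun k t => y k * X t (ebasis i) k)); intros k.
    apply smoothR_mult; [apply smoothR_const | apply SX]. }
  set (c := fun t (x : vec n) j => fsum n (fun i => x i * r t (ebasis j) i)).
  assert (Lc : forall t, rlinear (c t)).
  { intros t; apply (fsum_rlinear (fun i j => r t (ebasis j) i)). }
  assert (Dc : forall x t, is_vderive (fun s => c s x) t (c t (X t x))).
  { intros x t j.
    replace (c t (X t x) j) with (fsum n (fun i => x i * XT t (r t (ebasis j)) i)).
    - apply (is_derive_fsum n (fun i s => x i * r s (ebasis j) i)); intros i.
      apply (is_derive_scal (fun s => r s (ebasis j) i)), Dr.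
    - rewrite (rlinear_coord _ (rlinear_comp _ _ _ _ _ (LX t) (Lc t))).
      apply fsum_ext; intros i; f_equal; apply fsum_ext; intros k; ring. }
  assert (c0 : forall x, c 0 x = x).
  { intros x; apply functional_extensionality; intros j; unfold c.
    rewrite <- (fsum_ebasis n x j); apply fsum_ext; intros i; rewrite r0; f_equal.
    unfold ebasis; destruct (Fin.eq_dec i j), (Fin.eq_dec j i); congruence. }
  assert (CD : forall t x, c t (d t x) = x).
  { intros t x.
    assert (D : forall s, is_vderive (fun s => c s (d s x)) s (vzero n)).
    { intros s.
      replace (vzero n) with (vadd (c s (X s (d s x))) (c s (vopp (X s (d s x)))))
        by (rewrite (rlinear_opp _ (Lc s)); vring).
      apply (is_vderive_app n n c (fun y => c s (X s y)) (fun s => d s x)); auto. }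
    rewrite (is_vderive_0_const n _ D t 0), d0, c0; reflexivity. }
  assert (Id : forall t x, d t x = vzero n -> x = vzero n).
  { intros t x E; rewrite <- (CD t x), E; apply rlinear_zero, Lc. }
  exists c, d; repeat (split; [assumption|]); split; [|split; [exact Sd|]].
  - intros x j; apply (smoothR_fsum n (fun i s => x i * r s (ebasis j) i)); intros i.
    apply smoothR_mult; [apply smoothR_const | apply Sr].
  - split; [exact CD | split; [|split; [exact d0 | split; [exact Dc | exact Dd]]]].
    (* A left inverse makes [d t] injective, hence onto, so it is also a right inverse. *)
    intros t x; destruct (rlinear_inj_surj n (d t) (Ld t) (Id t) x) as (z & <-).
    now rewrite CD.
Qed.

(** * Finite-order automorphisms *)

(** Monotonicity gives injectivity, the shift relation unboundedness. The equation
    [eta' = 1 / h' (eta)] then raises the order of differentiability of [eta] step by step. *)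
Lemma smooth_inverse h :
  smoothR h -> (forall t, 0 < Derive h t) -> (forall t, h (t + 2 * PI) = h t + 2 * PI) ->
  exists eta, smoothR eta /\ (forall t, h (eta t) = t) /\ (forall t, eta (h t) = t).
Proof.
  intros Sh Ph Qh.
  assert (Ch : forall t, continuity_pt h t)
    by (intros; apply continuity_pt_filterlim; now apply (smoothR_continuous h)).
  assert (MV : forall a b, exists c, Rmin a b <= c <= Rmax a b /\ h b - h a = Derive h c * (b - a)).
  { intros a b; apply MVT_gen; auto; intros; now apply smoothR_is_derive. }
  assert (Inc : forall a b, a < b -> h a < h b).
  { intros a b L; destruct (MV a b) as (c & _ & E); pose proof (Ph c); nra. }
  assert (Sur : forall y, exists t, h t = y).
  { intros y.
    assert (P : forall k, h (0 + 2 * PI * IZR k) = h 0 + 2 * PI * IZR k).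
    { intros k; pose proof (periodic_Z R (fun t => h t - t)) as P; simpl in P.
      specialize (P (fun t => ltac:(rewrite Qh; ring)) k 0); lra. }
    destruct (archimed (Rabs (y - h 0))) as [B _].
    set (k := up _) in *; pose proof PI_gt_3; pose proof (Rabs_pos (y - h 0)).
    assert (IZR k <= 2 * PI * IZR k) by nra.
    pose proof (P k) as Pk; pose proof (P (- k)%Z) as Pk'; rewrite opp_IZR in Pk'.
    destruct (IVT_gen h (0 + 2 * PI * - IZR k) (0 + 2 * PI * IZR k) y Ch) as (t & _ & E);
      [|eauto].
    rewrite Pk, Pk', Rmin_left, Rmax_right by lra.
    assert (Hb : Rabs (y - h 0) <= 2 * PI * IZR k) by lra.
    apply Rabs_le_between in Hb; lra. }
  destruct (choice _ Sur) as [eta He].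
  assert (Inj : forall a b, h a = h b -> a = b).
  { intros a b E; destruct (Rtotal_order a b) as [L|[L|L]]; [|easy|]; apply Inc in L; lra. }
  assert (Mono : forall a b, h a < h b -> a < b).
  { intros a b L; apply Rnot_le_lt; intros [G|G]; [apply Inc in G; lra | subst; lra]. }
  exists eta; split; [|split; [exact He | intros t; apply Inj, He]].
  assert (Sd : smoothR (fun t => / Derive h t)).
  { apply smoothR_inv; [intros t; pose proof (Ph t); lra | now apply smoothR_Derive]. }
  assert (D : forall y, is_derive eta y (/ Derive h (eta y))).
  { intros y; apply is_derive_Reals; intros eps Heps.
    assert (L : locally (eta y) (fun x => Rabs (/ Derive h x - / Derive h (eta y)) < eps)).
    { apply (smoothR_continuous _ (eta y) Sd (fun z => Rabs (z - / Derive h (eta y)) < eps)).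
      exists (mkposreal eps Heps); intros z Hz; exact Hz. }
    destruct L as [e He'].
    assert (Hr : h (eta y) < h (eta y + e / 2)) by (apply Inc; pose proof (cond_pos e); lra).
    assert (Hl : h (eta y - e / 2) < h (eta y)) by (apply Inc; pose proof (cond_pos e); lra).
    rewrite He in Hr, Hl.
    assert (Hdel : 0 < Rmin (h (eta y + e / 2) - y) (y - h (eta y - e / 2)))
      by (apply Rmin_glb_lt; lra).
    exists (mkposreal _ Hdel); simpl; intros k Hk Bk.
    pose proof (Rmin_l (h (eta y + e / 2) - y) (y - h (eta y - e / 2))).
    pose proof (Rmin_r (h (eta y + e / 2) - y) (y - h (eta y - e / 2))).
    apply Rabs_def2 in Bk.
    assert (B1 : eta (y + k) < eta y + e / 2) by (apply Mono; rewrite He; lra).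
    assert (B2 : eta y - e / 2 < eta (y + k)) by (apply Mono; rewrite He; lra).
    destruct (MV (eta y) (eta (y + k))) as (c & Hc & E); rewrite !He in E.
    pose proof (Ph c) as Pc.
    replace ((eta (y + k) - eta y) / k) with (/ Derive h c).
    - apply He'; change (Rabs (c - eta y) < e); pose proof (cond_pos e).
      apply Rabs_def1; revert Hc; unfold Rmin, Rmax; destruct (Rle_dec _ _); lra.
    - replace (eta (y + k) - eta y) with (k / Derive h c); [field; lra|].
      replace k with (y + k - y) at 1 by ring; rewrite E; field; lra. }
  apply smoothR_smooth_at.
  intros t k; revert t; induction k as [|k IH]; intros t; [easy|].
  exists (fun y => / Derive h (eta y)); split; [now apply filter_forall|].
  apply (Ck_at_comp k eta (fun t => / Derive h t)); [|apply IH].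
  apply (proj1 (smoothR_smooth_at _) Sd).
Qed.

(** * Conjugates of the trivial connection *)

Definition is_derivation (g : liealg) (D : vec (ldim g) -> vec (ldim g)) : Prop :=
  flinear g D /\ forall x y, D (lbr g x y) = vadd (lbr g (D x) y) (lbr g x (D y)).

Section FiniteOrder.
Context (g : liealg) (Hg : is_simple g) (Hc : cstruct_ok g).
Context (sigma : vec (ldim g) -> vec (ldim g)) (Hs : is_gaut g sigma).
Context (Phi : loop g -> loop g) (lam : R -> R) (phi chi : R -> vec (ldim g) -> vec (ldim g)).
Context (m : Z) (St : structured g sigma sigma Phi lam phi chi m).

Lemma lam_smooth : smoothR lam.
Proof. apply St. Qed.

Lemma phi_gaut t : is_gaut g (phi t).
Proof. apply St. Qed.

Lemma phi_smooth : vcurve phi.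
Proof. apply St. Qed.

Lemma phi_linear t : rlinear (phi t).
Proof. apply phi_gaut. Qed.

Lemma chi_gaut t : is_gaut g (chi t).
Proof. apply St. Qed.

Lemma chi_linear t : rlinear (chi t).
Proof. apply chi_gaut. Qed.

Lemma m_sq : IZR m * IZR m = 1.
Proof. destruct (st_deg _ _ _ _ _ _ _ _ St) as [-> | ->]; ring. Qed.

Definition dphi (t : R) (x : vec (ldim g)) : vec (ldim g) := vD (fun s => phi s x) t.

Lemma dphi_is x t : is_vderive (fun s => phi s x) t (dphi t x).
Proof. apply vsmooth_is_vderive, phi_smooth. Qed.

Lemma dphi_smooth : vcurve dphi.
Proof. intros x; apply (vsmooth_vD _ (fun s => phi s x)), phi_smooth. Qed.

Lemma dphi_linear t : rlinear (dphi t).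
Proof.
  split; intros.
  - apply is_vderive_vD.
    replace (fun s => phi s (vadd x y)) with (fun s => vadd (phi s x) (phi s y)).
    + apply (is_vderive_add _ (fun s => phi s x) (fun s => phi s y)); apply dphi_is.
    + apply functional_extensionality; intros s; symmetry; apply rlinear_add, phi_linear.
  - apply is_vderive_vD.
    replace (fun s => phi s (vscal a x)) with (fun s => vscal a (phi s x)).
    + intros i; apply (is_derive_scal (fun s => phi s x i)), dphi_is.
    + apply functional_extensionality; intros s; symmetry; apply rlinear_scal, phi_linear.
Qed.

Lemma is_vderive_bracket u v t x y :
  is_vderive u t x -> is_vderive v t y ->
  is_vderive (fun s => lbr g (u s) (v s)) t (vadd (lbr g x (v t)) (lbr g (u t) y)).
Proof.
  intros Hu Hv.
  apply (is_vderive_app _ _ (fun s => lbr g (u s)) (lbr g x) v t y); auto.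
  - intros s; now apply bracket_r.
  - intros z; apply (is_vderive_lin _ _ (fun w => lbr g w z)); [now apply bracket_l | exact Hu].
Qed.

Lemma dphi_bracket t x y :
  dphi t (lbr g x y) = vadd (lbr g (dphi t x) (phi t y)) (lbr g (phi t x) (dphi t y)).
Proof.
  apply is_vderive_vD.
  replace (fun s => phi s (lbr g x y)) with (fun s => lbr g (phi s x) (phi s y)).
  - apply (is_vderive_bracket (fun s => phi s x) (fun s => phi s y)); apply dphi_is.
  - apply functional_extensionality; intros s; symmetry; apply phi_gaut.
Qed.

Lemma dphi_J J t x : lJ g = Some J -> dphi t (J x) = J (dphi t x).
Proof.
  intros E; apply is_vderive_vD.
  replace (fun s => phi s (J x)) with (fun s => J (phi s x)).
  - apply (is_vderive_lin _ _ J (fun s => phi s x)); [now apply (J_linear g) | apply dphi_is].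
  - apply functional_extensionality; intros s; symmetry.
    destruct (phi_gaut s) as ((_ & K) & _); rewrite E in K; apply K.
Qed.

Lemma chi_J J t x : lJ g = Some J -> chi t (J x) = J (chi t x).
Proof. intros E; destruct (chi_gaut t) as ((_ & K) & _); rewrite E in K; apply K. Qed.

Lemma phi_J J t x : lJ g = Some J -> phi t (J x) = J (phi t x).
Proof. intros E; destruct (phi_gaut t) as ((_ & K) & _); rewrite E in K; apply K. Qed.

(* [u' + conn j u] is the connection obtained from [d/dt] by conjugation with [Phi^j]. *)
Fixpoint conn (j : nat) (t : R) (x : vec (ldim g)) : vec (ldim g) :=
  match j with
  | O => vzero _
  | S j => vadd (vopp (dphi t (chi t x)))
             (vscal (Derive lam t) (phi t (conn j (lam t) (chi t x))))
  end.

(** Differentiating the multiplicativity of [phi t] shows that [dphi t (chi t x)] is a derivation in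
    [x], and conjugation by an automorphism preserves derivations. *)
Lemma conn_derivation j t : is_derivation g (conn j t).
Proof.
  revert t; induction j as [|j IH]; intros t; simpl.
  - split; [split|].
    + split; intros; vring.
    + destruct (lJ g) as [J|] eqn:EJ; [|easy]; intros _; symmetry.
      now apply rlinear_zero, (J_linear g).
    + intros x y; rewrite (rlinear_zero (lbr g x)) by now apply bracket_r.
      rewrite (rlinear_zero (fun z => lbr g z y)) by (now apply bracket_l); vring.
  - destruct (IH (lam t)) as ((Lc & Jc) & Bc).
    split; [split|].
    + split; intros; [rewrite (rlinear_add _ (chi_linear t)), (rlinear_add _ Lc),
        (rlinear_add _ (phi_linear t)), (rlinear_add _ (dphi_linear t))
      | rewrite (rlinear_scal _ (chi_linear t)), (rlinear_scal _ Lc),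
        (rlinear_scal _ (phi_linear t)), (rlinear_scal _ (dphi_linear t))]; vring.
    + destruct (lJ g) as [J|] eqn:EJ; [|easy]; intros x.
      assert (LJ : rlinear J) by now apply (J_linear g).
      rewrite (rlinear_add _ LJ), (rlinear_opp _ LJ), (rlinear_scal _ LJ).
      now rewrite (chi_J J), Jc, (dphi_J J), (phi_J J).
    + intros x y.
      rewrite (rlinear_add _ (bracket_r g Hg x)), (rlinear_opp _ (bracket_r g Hg x)),
        (rlinear_scal _ (bracket_r g Hg x)).
      rewrite (rlinear_add _ (bracket_l g Hg y)), (rlinear_opp _ (bracket_l g Hg y)),
        (rlinear_scal _ (bracket_l g Hg y)).
      replace (chi t (lbr g x y)) with (lbr g (chi t x) (chi t y))
        by (symmetry; apply chi_gaut).
      rewrite Bc, dphi_bracket, (rlinear_add _ (phi_linear t)).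
      replace (phi t (lbr g (conn j (lam t) (chi t x)) (chi t y))) with
        (lbr g (phi t (conn j (lam t) (chi t x))) (phi t (chi t y)))
        by (symmetry; apply phi_gaut).
      replace (phi t (lbr g (chi t x) (conn j (lam t) (chi t y)))) with
        (lbr g (phi t (chi t x)) (phi t (conn j (lam t) (chi t y))))
        by (symmetry; apply phi_gaut).
      rewrite !(st_inv_r _ _ _ _ _ _ _ _ St); vring.
Qed.

Lemma conn_linear j t : rlinear (conn j t).
Proof. apply conn_derivation. Qed.

Lemma conn_smooth j : vcurve (conn j).
Proof.
  induction j as [|j IH]; intros x; simpl; [apply vsmooth_const|].
  assert (Sc : vsmooth (fun t => chi t x)) by apply (st_inv_smooth _ _ _ _ _ _ _ _ St).
  apply (vsmooth_add _ (fun t => vopp (dphi t (chi t x)))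
    (fun t => vscal (Derive lam t) (phi t (conn j (lam t) (chi t x))))).
  - intros i; apply (smoothR_opp (fun t => dphi t (chi t x) i)).
    apply (vsmooth_app _ _ dphi (fun t => chi t x)); auto using dphi_linear, dphi_smooth.
  - apply vsmooth_scal; [apply smoothR_Derive, lam_smooth|].
    apply (vsmooth_app _ _ phi); auto using phi_linear, phi_smooth.
    apply (vsmooth_app _ _ (fun t => conn j (lam t)) (fun t => chi t x));
      auto using conn_linear.
    intros y; apply (vsmooth_comp _ (fun t => conn j t y) lam); auto using lam_smooth.
Qed.

Lemma chi_shift t x : chi (t + 2 * PI) (sigma x) = zpow sigma (sigma_inv g sigma) m (chi t x).
Proof.
  rewrite <- (st_inv_r _ _ _ _ _ _ _ _ St t x) at 1.
  rewrite <- (st_shift _ _ _ _ _ _ _ _ St).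
  apply (st_inv_l _ _ _ _ _ _ _ _ St).
Qed.

Lemma dphi_shift t x :
  dphi (t + 2 * PI) (zpow sigma (sigma_inv g sigma) m x) = sigma (dphi t x).
Proof.
  set (y := zpow sigma (sigma_inv g sigma) m x).
  apply (is_vderive_unique _ (fun s => phi (s + 2 * PI) y) t).
  - replace (dphi (t + 2 * PI) y) with (vscal 1 (dphi (t + 2 * PI) y)) by vring.
    apply (is_vderive_comp _ (fun s => phi s y) (fun s => s + 2 * PI)); [apply dphi_is|].
    auto_derive; [easy | ring].
  - replace (fun s => phi (s + 2 * PI) y) with (fun s => sigma (phi s x)).
    + apply (is_vderive_lin _ _ sigma (fun s => phi s x)); [apply Hs | apply dphi_is].
    + apply functional_extensionality; intros s; symmetry.
      apply (st_shift _ _ _ _ _ _ _ _ St).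
Qed.

Lemma conn_shift j t x : conn j (t + 2 * PI) (sigma x) = sigma (conn j t x).
Proof.
  assert (Ls : rlinear sigma) by apply Hs.
  revert t x; induction j as [|j IH]; intros t x; simpl.
  - symmetry; now apply rlinear_zero.
  - destruct (sigma_inv_spec g sigma Hs) as (_ & E1 & E2).
    rewrite (rlinear_add _ Ls), (rlinear_opp _ Ls), (rlinear_scal _ Ls).
    rewrite chi_shift, dphi_shift.
    assert (D : Derive lam (t + 2 * PI) = Derive lam t).
    { apply is_derive_unique.
      apply (is_derive_ext (fun s => lam (s - 2 * PI) + 2 * PI * IZR m)).
      { intros s; rewrite <- (st_lam_shift _ _ _ _ _ _ _ _ St); f_equal; ring. }
      replace (Derive lam t) with (1 * Derive lam (t + 2 * PI - 2 * PI) + 0)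
        by (replace (t + 2 * PI - 2 * PI) with t by ring; ring).
      apply (is_derive_plus (fun s => lam (s - 2 * PI)) (fun _ => 2 * PI * IZR m)).
      - apply (is_derive_comp lam (fun s => s - 2 * PI)).
        + apply smoothR_is_derive, lam_smooth.
        + auto_derive; [easy | ring].
      - apply (is_derive_const (2 * PI * IZR m)). }
    rewrite D, (st_lam_shift _ _ _ _ _ _ _ _ St).
    rewrite <- (st_shift _ _ _ _ _ _ _ _ St); do 4 f_equal.
    generalize (chi t x) as y; intros y.
    destruct (st_deg _ _ _ _ _ _ _ _ St) as [-> | ->].
    + rewrite Rmult_1_r; apply (IH (lam t) y).
    (* In degree -1 the induction hypothesis is used backwards, from [lam t - 2 * PI] to [lam t]. *)
    + change (conn j (lam t + 2 * PI * - 1) (sigma_inv g sigma y) =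
        sigma_inv g sigma (conn j (lam t) y)).
      rewrite <- (E1 (conn j _ (sigma_inv g sigma y))), <- IH, E2.
      do 2 f_equal; ring.
Qed.

(** The recursion applies [lam] first, to match [Phi (Phi^j u) t = phi t (Phi^j u (lam t))]. *)
Fixpoint lam_iter (j : nat) (t : R) : R :=
  match j with O => t | S j => lam_iter j (lam t) end.

Fixpoint phi_iter (j : nat) (t : R) (x : vec (ldim g)) : vec (ldim g) :=
  match j with O => x | S j => phi t (phi_iter j (lam t) x) end.

Lemma phi_iter_gaut j t : is_gaut g (phi_iter j t).
Proof.
  revert t; induction j as [|j IH]; intros t; [apply gaut_id|].
  apply (gaut_comp g (phi t) (phi_iter j (lam t))); auto using phi_gaut.
Qed.

(** So [conn j] is minus the logarithmic derivative of [phi_iter j]; this determines it once [Phi^j]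
    is known. *)
Lemma phi_iter_derive j t x :
  is_vderive (fun s => phi_iter j s x) t (vopp (conn j t (phi_iter j t x))).
Proof.
  revert t; induction j as [|j IH]; intros t; simpl.
  - replace (vopp (vzero (ldim g))) with (vzero (ldim g)) by vring; apply is_vderive_const.
  - set (w := phi_iter j (lam t) x).
    rewrite (st_inv_l _ _ _ _ _ _ _ _ St).
    replace (vopp _) with (vadd (dphi t w)
      (phi t (vscal (Derive lam t) (vopp (conn j (lam t) w)))))
      by (rewrite (rlinear_scal _ (phi_linear t)), (rlinear_opp _ (phi_linear t)); vring).
    apply (is_vderive_app _ _ phi (dphi t) (fun s => phi_iter j (lam s) x));
      auto using phi_linear, dphi_is.
    apply (is_vderive_comp _ (fun s => phi_iter j s x) lam); [apply IH|].
    apply smoothR_is_derive, lam_smooth.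
Qed.

Lemma lam_iter_smooth j : smoothR (lam_iter j).
Proof.
  induction j as [|j IH]; [apply smoothR_id|].
  apply (smoothR_comp lam (lam_iter j)); auto using lam_smooth.
Qed.

Lemma lam_iter_shift j t : lam_iter j (t + 2 * PI) = lam_iter j t + 2 * PI * IZR m ^ j.
Proof.
  revert t; induction j as [|j IH]; intros t; simpl; [ring|].
  rewrite (st_lam_shift _ _ _ _ _ _ _ _ St).
  destruct (st_deg _ _ _ _ _ _ _ _ St) as [-> | ->].
  - rewrite Rmult_1_r, IH; ring.
  - pose proof (IH (lam t + 2 * PI * -1)) as E.
    replace (lam t + 2 * PI * -1 + 2 * PI) with (lam t) in E by ring.
    rewrite E; ring.
Qed.

Lemma lam_iter_mono j t : 0 < IZR m ^ j * Derive (lam_iter j) t.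
Proof.
  revert t; induction j as [|j IH]; intros t; simpl.
  - replace (Derive _ t) with 1 by (symmetry; apply Derive_id); lra.
  - assert (D : is_derive (lam_iter (S j)) t (Derive lam t * Derive (lam_iter j) (lam t))).
    { apply (is_derive_comp (lam_iter j) lam); apply smoothR_is_derive;
        auto using lam_smooth, lam_iter_smooth. }
    apply is_derive_unique in D; simpl in D; rewrite D.
    pose proof (IH (lam t)); pose proof (st_mono _ _ _ _ _ _ _ _ St t).
    replace (_ * _) with ((IZR m * Derive lam t) *
      (IZR m ^ j * Derive (lam_iter j) (lam t))) by ring.
    now apply Rmult_lt_0_compat.
Qed.

Lemma Phi_iter_form j u t : inL g sigma u ->
  (forall i u, inL g sigma u -> inL g sigma (Nat.iter i Phi u)) ->
  Nat.iter j Phi u t = phi_iter j t (u (lam_iter j t)).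
Proof.
  intros Hu HL; revert t; induction j as [|j IH]; intros t; simpl; [easy|].
  destruct (st_form _ _ _ _ _ _ _ _ St) as (_ & _ & _ & F).
  rewrite F by now apply HL. now rewrite IH.
Qed.

Fixpoint conn_sum (k : nat) (t : R) (x : vec (ldim g)) : vec (ldim g) :=
  match k with O => vzero _ | S k => vadd (conn_sum k t x) (conn k t x) end.

Lemma conn_sum_derivation k t : is_derivation g (conn_sum k t).
Proof.
  induction k as [|k ((L & JJ) & B)]; simpl; [apply (conn_derivation 0 t)|].
  destruct (conn_derivation k t) as ((L' & J') & B').
  split; [split|].
  - split; intros; [rewrite (rlinear_add _ L), (rlinear_add _ L')
      | rewrite (rlinear_scal _ L), (rlinear_scal _ L')]; vring.
  - destruct (lJ g) as [J|] eqn:EJ; [|easy]; intros x.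
    now rewrite (rlinear_add J) by (now apply (J_linear g)); rewrite JJ, J'.
  - intros x y; rewrite B, B', (rlinear_add _ (bracket_r g Hg x)),
      (rlinear_add _ (bracket_l g Hg y)); vring.
Qed.

Lemma conn_sum_smooth k : vcurve (conn_sum k).
Proof.
  induction k as [|k IH]; intros x; simpl; [apply vsmooth_const|].
  apply (vsmooth_add _ (fun t => conn_sum k t x) (fun t => conn k t x)); auto.
  apply conn_smooth.
Qed.

Lemma conn_sum_shift k t x : conn_sum k (t + 2 * PI) (sigma x) = sigma (conn_sum k t x).
Proof.
  assert (Ls : rlinear sigma) by apply Hs.
  induction k as [|k IH]; simpl; [symmetry; now apply rlinear_zero|].
  now rewrite IH, conn_shift, (rlinear_add _ Ls).
Qed.

(** Conjugation by [Phi] takes [conn j] to [conn (S j)], and [conn 0 = 0] may be added on the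
    left. *)
Lemma conn_sum_covariant k t x :
  vadd (conn_sum k t x) (conn k t x) =
  vadd (vscal (- INR k) (dphi t (chi t x)))
    (vscal (Derive lam t) (phi t (conn_sum k (lam t) (chi t x)))).
Proof.
  induction k as [|k IH].
  - simpl; rewrite (rlinear_zero _ (phi_linear t)); vring.
  - rewrite S_INR.
    change (conn_sum (S k) t x) with (vadd (conn_sum k t x) (conn k t x)).
    rewrite IH; simpl; rewrite (rlinear_add _ (phi_linear t)); vring.
Qed.

(** * Averages over a period of the automorphism *)

Section Period.
Context (N : Z) (k : nat) (Kk : (0 < k)%nat).
Context (Even : IZR m ^ k = 1).
Context (Lper : forall t, lam_iter k t = t + 2 * PI * IZR N).
Context (Pper : forall t x, phi_iter k t (zpow sigma (sigma_inv g sigma) N x) = x).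

(** [phi_iter k] is the inverse of a fixed power of the twist, hence constant in time, so its
    logarithmic derivative is 0. *)
Lemma conn_period t x : conn k t x = vzero _.
Proof.
  set (y := zpow sigma (sigma_inv g sigma) N x).
  pose proof (phi_iter_derive k t y) as D; unfold y in D at 2; rewrite Pper in D.
  assert (Z0 : vopp (conn k t x) = vzero _).
  { apply (is_vderive_unique _ (fun s => phi_iter k s y) t); [exact D|].
    replace (fun s => phi_iter k s y) with (fun _ : R => x)
      by (apply functional_extensionality; intros; unfold y; now rewrite Pper).
    apply is_vderive_const. }
  replace (conn k t x) with (vopp (vopp (conn k t x))) by vring; rewrite Z0; vring.
Qed.

Definition mean_conn (t : R) (x : vec (ldim g)) : vec (ldim g) := vscal (/ INR k) (conn_sum k t x).

Lemma k_pos : 0 < INR k.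
Proof. now apply lt_0_INR. Qed.

Lemma mean_conn_derivation t : is_derivation g (mean_conn t).
Proof.
  unfold mean_conn; destruct (conn_sum_derivation k t) as ((L & JJ) & B).
  split; [split|].
  - split; intros; [rewrite (rlinear_add _ L) | rewrite (rlinear_scal _ L)]; vring.
  - destruct (lJ g) as [J|] eqn:EJ; [|easy]; intros x.
    now rewrite (rlinear_scal J) by (now apply (J_linear g)); rewrite JJ.
  - intros x y; rewrite B, (rlinear_scal _ (bracket_r g Hg x)),
      (rlinear_scal _ (bracket_l g Hg y)); vring.
Qed.

Lemma mean_conn_smooth : vcurve mean_conn.
Proof.
  intros x; apply (vsmooth_scal _ (fun _ => / INR k) (fun t => conn_sum k t x));
    [apply smoothR_const | apply conn_sum_smooth].
Qed.

Lemma mean_conn_shift t x : mean_conn (t + 2 * PI) (sigma x) = sigma (mean_conn t x).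
Proof.
  unfold mean_conn; rewrite conn_sum_shift; symmetry; apply rlinear_scal, Hs.
Qed.

(** The shift from [conn j] to [conn (S j)] closes up cyclically because [conn k] vanishes; hence
    the mean is invariant under [Phi]. *)
Lemma mean_conn_covariant t y :
  mean_conn t (phi t y) =
  vadd (vopp (dphi t y)) (vscal (Derive lam t) (phi t (mean_conn (lam t) y))).
Proof.
  pose proof (conn_sum_covariant k t (phi t y)) as E.
  rewrite conn_period, (st_inv_l _ _ _ _ _ _ _ _ St) in E.
  unfold mean_conn; rewrite (rlinear_scal _ (phi_linear t)).
  replace (conn_sum k t (phi t y)) with (vadd (conn_sum k t (phi t y)) (vzero _)) by vring.
  rewrite E; pose proof k_pos; apply functional_extensionality; intros i.
  unfold vadd, vscal, vopp; field; lra.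
Qed.

(** The sign [m ^ j] makes every summand increasing, also when [lam] reverses orientation, and each
    summand advances by [2 * PI] over a period. *)
Fixpoint time_sum (j : nat) (t : R) : R :=
  match j with O => 0 | S j => time_sum j t + IZR m ^ j * lam_iter j t end.

Lemma time_sum_lam j t :
  t + IZR m * time_sum j (lam t) = time_sum j t + IZR m ^ j * lam_iter j t.
Proof.
  induction j as [|j IH]; simpl; [ring|].
  rewrite Rmult_plus_distr_l, <- Rplus_assoc, IH; ring.
Qed.

Lemma time_sum_smooth j : smoothR (time_sum j).
Proof.
  induction j as [|j IH]; simpl; [apply smoothR_const|].
  apply smoothR_plus; [exact IH|]; apply smoothR_mult;
    [apply smoothR_const | apply lam_iter_smooth].
Qed.

Lemma time_sum_shift j t : time_sum j (t + 2 * PI) = time_sum j t + INR j * (2 * PI).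
Proof.
  induction j as [|j IH]; [simpl; ring|].
  rewrite S_INR; simpl; rewrite IH, lam_iter_shift.
  assert (E : IZR m ^ j * IZR m ^ j = 1) by (rewrite <- Rpow_mult_distr, m_sq; apply pow1).
  replace (IZR m ^ j * (lam_iter j t + 2 * PI * IZR m ^ j)) with
    (IZR m ^ j * lam_iter j t + 2 * PI * (IZR m ^ j * IZR m ^ j)) by ring.
  rewrite E; ring.
Qed.

Lemma time_sum_mono j t : 0 < Derive (time_sum (S j)) t.
Proof.
  assert (E : forall i, Derive (time_sum (S i)) t =
    Derive (time_sum i) t + IZR m ^ i * Derive (lam_iter i) t).
  { intros i; apply is_derive_unique.
    apply (is_derive_plus (time_sum i) (fun s => IZR m ^ i * lam_iter i s)).
    - apply smoothR_is_derive, time_sum_smooth.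
    - apply (is_derive_scal (lam_iter i)), smoothR_is_derive, lam_iter_smooth. }
  induction j as [|j IH]; rewrite E.
  - pose proof (lam_iter_mono 0 t).
    replace (Derive (time_sum 0) t) with 0 by (symmetry; apply (Derive_const 0 t)); lra.
  - pose proof (lam_iter_mono (S j) t); lra.
Qed.

Lemma time_change : exists h eta t0, smoothR h /\ smoothR eta /\
  (forall t, h (eta t) = t) /\ (forall t, eta (h t) = t) /\
  (forall t, h (t + 2 * PI) = h t + 2 * PI) /\
  forall t, h (lam t) = IZR m * h t + t0.
Proof.
  pose proof k_pos as Pk.
  set (h := fun t => / INR k * time_sum k t).
  assert (Sh : smoothR h)
    by (apply smoothR_mult; [apply smoothR_const | apply time_sum_smooth]).
  assert (Qh : forall t, h (t + 2 * PI) = h t + 2 * PI)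
    by (intros t; unfold h; rewrite time_sum_shift; field; lra).
  destruct (smooth_inverse h Sh) as (eta & Se & E1 & E2); [|exact Qh|].
  - intros t; unfold h; rewrite Derive_scal.
    apply Rmult_lt_0_compat; [now apply Rinv_0_lt_compat|].
    destruct k as [|k']; [lia | apply time_sum_mono].
  (* Passing to [lam t] and multiplying by [m] reindexes the sum, replacing its first term [t] by
     [t + 2 * PI * N]. Dividing by [k] yields this constant. *)
  - exists h, eta, (/ INR k * (IZR m * (2 * PI * IZR N))); repeat (split; [assumption|]).
    intros t; unfold h; pose proof (time_sum_lam k t) as E; rewrite Even, Lper in E.
    replace (time_sum k (lam t)) with (IZR m * (IZR m * time_sum k (lam t)))
      by (rewrite <- Rmult_assoc, m_sq; ring).
    replace (IZR m * time_sum k (lam t)) with (time_sum k t + 2 * PI * IZR N) by lra.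
    ring.
Qed.

(** [c] trivialises the invariant connection. In the new frame the twist and [phi] commute with
    differentiation, hence are constant in time. *)
Lemma gauge : exists (c d : R -> vec (ldim g) -> vec (ldim g)) (sigma' phi0 : vec (ldim g) -> vec (ldim g)),
  (forall t, is_gaut g (c t)) /\ (forall t, is_gaut g (d t)) /\ vcurve c /\ vcurve d /\
  (forall t x, c t (d t x) = x) /\ (forall t x, d t (c t x) = x) /\
  is_gaut g sigma' /\ is_gaut g phi0 /\
  (forall t x, c (t + 2 * PI) (sigma x) = sigma' (c t x)) /\
  (forall t x, c t (phi t x) = phi0 (c (lam t) x)).
Proof.
  assert (LX : forall t, rlinear (mean_conn t)) by (intros; apply mean_conn_derivation).
  destruct (parallel_transport _ mean_conn LX mean_conn_smooth)
    as (c & d & Lc & Ld & Sc & Sd & CD & DC & d0 & Dc & Dd).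
  (* Uniqueness for the transport equation. Below it shows that [d t] commutes with [J] and the
     bracket: the defect solves the equation and vanishes at 0. *)
  assert (U : forall z, z 0 = vzero _ ->
    (forall t, is_vderive z t (vopp (mean_conn t (z t)))) -> forall t, z t = vzero _).
  { intros z z0 Dz t.
    assert (D : forall s, is_vderive (fun s => c s (z s)) s (vzero _)).
    { intros s.
      replace (vzero (ldim g)) with
        (vadd (c s (mean_conn s (z s))) (c s (vopp (mean_conn s (z s)))))
        by (rewrite (rlinear_opp _ (Lc s)); vring).
      apply (is_vderive_app _ _ c (fun y => c s (mean_conn s y)) z); auto. }
    rewrite <- (DC t (z t)), (is_vderive_0_const _ (fun s => c s (z s)) D t 0), z0.
    rewrite (rlinear_zero _ (Lc 0)); apply rlinear_zero, Ld. }
  assert (Gd : forall t, is_gaut g (d t)).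
  { intros t; split; [split; [apply Ld|] | split].
    - destruct (lJ g) as [J|] eqn:EJ; [|easy]; intros x.
      assert (LJ : rlinear J) by now apply (J_linear g).
      assert (Z : vadd (d t (J x)) (vopp (J (d t x))) = vzero _).
      { apply (U (fun s => vadd (d s (J x)) (vopp (J (d s x))))).
        - rewrite !d0; vring.
        - intros s; destruct (mean_conn_derivation s) as ((_ & JJ) & _); rewrite EJ in JJ.
          rewrite (rlinear_add _ (LX s)), (rlinear_opp _ (LX s)), JJ.
          replace (vopp _) with (vadd (vopp (mean_conn s (d s (J x))))
            (vopp (J (vopp (mean_conn s (d s x))))))
            by (rewrite (rlinear_opp _ LJ); vring).
          apply (is_vderive_add _ (fun s => d s (J x))); [apply Dd|].
          apply (is_vderive_lin _ _ (fun y => vopp (J y)) (fun s => d s x)); [|apply Dd].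
          apply (rlinear_comp _ _ _ J); [exact LJ | split; intros; vring]. }
      replace (d t (J x)) with (vadd (vadd (d t (J x)) (vopp (J (d t x)))) (J (d t x)))
        by vring.
      rewrite Z; vring.
    - intros x y.
      assert (Z : vadd (d t (lbr g x y)) (vopp (lbr g (d t x) (d t y))) = vzero _).
      { apply (U (fun s => vadd (d s (lbr g x y)) (vopp (lbr g (d s x) (d s y))))).
        - rewrite !d0; vring.
        - intros s; destruct (mean_conn_derivation s) as (_ & B).
          rewrite (rlinear_add _ (LX s)), (rlinear_opp _ (LX s)), B.
          replace (vopp _) with (vadd (vopp (mean_conn s (d s (lbr g x y))))
            (vopp (vadd (lbr g (vopp (mean_conn s (d s x))) (d s y))
                        (lbr g (d s x) (vopp (mean_conn s (d s y)))))))
            by (rewrite (rlinear_opp _ (bracket_r g Hg (d s x))),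
              (rlinear_opp _ (bracket_l g Hg (d s y))); vring).
          apply (is_vderive_add _ (fun s => d s (lbr g x y))); [apply Dd|].
          apply (is_vderive_lin _ _ vopp (fun s => lbr g (d s x) (d s y)));
            [split; intros; vring|].
          apply (is_vderive_bracket (fun s => d s x) (fun s => d s y)); apply Dd. }
      replace (d t (lbr g x y)) with
        (vadd (vadd (d t (lbr g x y)) (vopp (lbr g (d t x) (d t y)))) (lbr g (d t x) (d t y)))
        by vring.
      rewrite Z; vring.
    - now exists (c t). }
  assert (Gc : forall t, is_gaut g (c t)) by (intros t; now apply (gaut_inv g (d t))).
  assert (A : forall t x, c (t + 2 * PI) (sigma (d t x)) = c (0 + 2 * PI) (sigma (d 0 x))).
  { intros t x.
    apply (is_vderive_0_const _ (fun s => c (s + 2 * PI) (sigma (d s x)))); intros s.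
    replace (vzero (ldim g)) with
      (vadd (vscal 1 (c (s + 2 * PI) (mean_conn (s + 2 * PI) (sigma (d s x)))))
        (c (s + 2 * PI) (sigma (vopp (mean_conn s (d s x)))))).
    2: { rewrite mean_conn_shift, (rlinear_opp sigma), (rlinear_opp _ (Lc _)) by apply Hs.
         vring. }
    apply (is_vderive_app _ _ (fun s => c (s + 2 * PI))
      (fun y => vscal 1 (c (s + 2 * PI) (mean_conn (s + 2 * PI) y))) (fun s => sigma (d s x)));
      auto.
    - intros y; apply (is_vderive_comp _ (fun s => c s y) (fun s => s + 2 * PI)); [apply Dc|].
      auto_derive; [easy | ring].
    - apply (is_vderive_lin _ _ sigma (fun s => d s x)); [apply Hs | apply Dd]. }
  assert (B : forall t x, c t (phi t (d (lam t) x)) = c 0 (phi 0 (d (lam 0) x))).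
  { intros t x.
    apply (is_vderive_0_const _ (fun s => c s (phi s (d (lam s) x)))); intros s.
    set (y := d (lam s) x).
    replace (vzero (ldim g)) with (vadd (c s (mean_conn s (phi s y)))
      (c s (vadd (dphi s y) (phi s (vscal (Derive lam s) (vopp (mean_conn (lam s) y))))))).
    2: { rewrite mean_conn_covariant, <- (rlinear_add _ (Lc s)).
         rewrite (rlinear_scal _ (phi_linear s)), (rlinear_opp _ (phi_linear s)).
         rewrite <- (rlinear_zero _ (Lc s)); f_equal; vring. }
    apply (is_vderive_app _ _ c (fun z => c s (mean_conn s z))
      (fun s => phi s (d (lam s) x))); auto.
    apply (is_vderive_app _ _ phi (dphi s) (fun s => d (lam s) x));
      auto using phi_linear, dphi_is.
    apply (is_vderive_comp _ (fun s => d s x) lam); [apply Dd|].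
    apply smoothR_is_derive, lam_smooth. }
  exists c, d, (fun x => c (0 + 2 * PI) (sigma (d 0 x))), (fun x => c 0 (phi 0 (d (lam 0) x))).
  repeat (split; [assumption|]); split; [|split; [|split]].
  - apply (gaut_comp g (c (0 + 2 * PI)) (fun x => sigma (d 0 x))); auto using gaut_comp.
  - apply (gaut_comp g (c 0) (fun x => phi 0 (d (lam 0) x))); auto.
    apply (gaut_comp g (phi 0) (d (lam 0))); auto using phi_gaut.
  - intros t x; now rewrite <- (A t), DC.
  - intros t x; now rewrite <- (B t), DC.
Qed.

Lemma conjugate_to_standard :
  exists (sigma' : vec (ldim g) -> vec (ldim g)) (psi : loop g -> loop g) (phi0 : vec (ldim g) -> vec (ldim g)) (eps t0 : R),
    is_gaut g sigma' /\ is_liso g sigma sigma' psi /\ is_gaut g phi0 /\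
    (eps = 1 \/ eps = -1) /\
    forall u, inL g sigma u -> psi (Phi u) = (fun t => phi0 (psi u (eps * t + t0))).
Proof.
  destruct gauge as (c & d & sigma' & phi0 & Gc & Gd & Sc & Sd & CD & DC & Gs & Gp & A & B).
  destruct time_change as (h & eta & t0 & Sh & Se & E1 & E2 & Qh & Lh).
  (* [psi] composes the gauge [c] with the time change [eta]; the slope of the new parameter map is
     the degree [m]. *)
  exists sigma', (fun u t => c (eta t) (u (eta t))), phi0, (IZR m), t0.
  assert (Lc : forall t, rlinear (c t)) by (intros; apply Gc).
  assert (Ld : forall t, rlinear (d t)) by (intros; apply Gd).
  split; [exact Gs | split; [|split; [exact Gp | split]]].
  - assert (Qe : forall t, eta (t + 2 * PI) = eta t + 2 * PI).
    { intros t; rewrite <- (E2 (eta t + 2 * PI)), Qh, E1; reflexivity. }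
    split; [|split; [|split; [|split; [|split]]]].
    + intros u [Su Qu]; split.
      * apply (vsmooth_app _ _ (fun t => c (eta t)) (fun t => u (eta t))); auto.
        -- intros x; now apply (vsmooth_comp _ (fun t => c t x) eta).
        -- now apply (vsmooth_comp _ u eta).
      * intros t; now rewrite Qe, Qu, A.
    + intros u v _ _; apply functional_extensionality; intros t; apply (rlinear_add _ (Lc _)).
    + intros a u _; apply functional_extensionality; intros t; apply (rlinear_scal _ (Lc _)).
    + destruct (lJ g) as [J|] eqn:EJ; [|easy]; intros u _.
      apply functional_extensionality; intros t.
      destruct (Gc (eta t)) as ((_ & JJ) & _); rewrite EJ in JJ; apply JJ.
    + intros u v _ _; apply functional_extensionality; intros t; apply Gc.
    + exists (fun v t => d t (v (h t))); split; [|split].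
      * intros v [Sv Qv]; split.
        -- apply (vsmooth_app _ _ d (fun t => v (h t))); auto.
           now apply (vsmooth_comp _ v h).
        -- intros t; rewrite Qh, Qv.
           rewrite <- (CD t (v (h t))) at 1; now rewrite <- A, DC.
      * intros u _; apply functional_extensionality; intros t; now rewrite E2, DC.
      * intros v _; apply functional_extensionality; intros t; now rewrite E1, CD.
  - destruct (st_deg _ _ _ _ _ _ _ _ St) as [-> | ->]; auto.
  - intros u Hu; apply functional_extensionality; intros t.
    destruct (st_form _ _ _ _ _ _ _ _ St) as (_ & _ & _ & F).
    rewrite F, B by exact Hu.
    replace (IZR m * t + t0) with (h (lam (eta t))) by (rewrite Lh, E1; reflexivity).
    now rewrite E2.
Qed.
End Period.
End FiniteOrder.

Theorem finite_order_standard (g : liealg) (sigma : vec (ldim g) -> vec (ldim g))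
  (Phi : loop g -> loop g) :
  is_simple g -> cstruct_ok g -> is_gaut g sigma -> is_laut g sigma Phi ->
  finite_order g sigma Phi ->
  exists (sigma' : vec (ldim g) -> vec (ldim g)) (psi : loop g -> loop g)
         (phi0 : vec (ldim g) -> vec (ldim g)) (eps t0 : R),
    is_gaut g sigma' /\ is_liso g sigma sigma' psi /\ is_gaut g phi0 /\
    (eps = 1 \/ eps = -1) /\
    forall u, inL g sigma u -> psi (Phi u) = (fun t => phi0 (psi u (eps * t + t0))).
Proof.
  intros Hg Hc Hs HPhi (n & Hn & Fn).
  destruct (liso_structured g Hg Hc sigma sigma Phi Hs Hs HPhi) as (lam & phi & chi & m & St).
  assert (HL : forall i u, inL g sigma u -> inL g sigma (Nat.iter i Phi u)).
  { induction i as [|i IH]; intros u Hu; simpl; [exact Hu | apply HPhi, IH, Hu]. }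
  (* Twice the order, so that [m ^ k = 1] also when [m = -1]. *)
  set (k := (n + n)%nat).
  assert (Fk : forall u, inL g sigma u -> Nat.iter k Phi u = u).
  { intros u Hu; unfold k; now rewrite Nat.iter_add, !(Fn u). }
  destruct (sigma_inv_spec g sigma Hs) as (Gi & E1 & E2).
  assert (H : forall t u, inL g sigma u ->
    u t = phi_iter g lam phi k t (u (lam_iter lam k t))).
  { intros t u Hu.
    rewrite <- (Phi_iter_form g sigma Phi lam phi chi m St) by auto; now rewrite Fk. }
  destruct (smooth_lattice_const (fun t => lam_iter lam k t - t)) as [N HN].
  - apply smoothR_minus; [|apply smoothR_id].
    apply (lam_iter_smooth g sigma Phi lam phi chi m St).
  - intros t.
    destruct (eval_separated g Hg sigma (fun x => x) (phi_iter g lam phi k t)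
      t (lam_iter lam k t) Hs) as [N HN]; auto using gaut_id.
    + apply (phi_iter_gaut g sigma Phi lam phi chi m St).
    + exists N; lra.
  - apply (conjugate_to_standard g Hg Hc sigma Hs Phi lam phi chi m St N k).
    + unfold k; lia.
    + unfold k; rewrite pow_add, <- Rpow_mult_distr.
      rewrite (m_sq g sigma Phi lam phi chi m St); apply pow1.
    + intros t; rewrite <- (HN t); ring.
    + intros t x.
      pose proof (H t (local_section g sigma t x)) as E.
      replace (lam_iter lam k t) with (t + 2 * PI * IZR N) in E by (rewrite <- (HN t); ring).
      rewrite (zpow_equivariant _ sigma (sigma_inv g sigma)) in E;
        auto; [|apply local_section_inL, Hs].
      rewrite local_section_at in E by easy; symmetry; apply E.
      now apply local_section_inL.
Qed.

(** * An automorphism of the loop algebra of so(3) with a twisted axis *)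

Definition vec3 (a b c : R) : vec 3 := vcons a (vcons b (vcons c (vzero 0))).

Notation i1 := (Fin.F1 : Fin.t 3).
Notation i2 := (Fin.FS Fin.F1 : Fin.t 3).
Notation i3 := (Fin.FS (Fin.FS Fin.F1) : Fin.t 3).

Lemma vec3_ext (x y : vec 3) : x i1 = y i1 -> x i2 = y i2 -> x i3 = y i3 -> x = y.
Proof.
  intros H1 H2 H3; apply vec_S_ext; [exact H1|]; apply vec_S_ext; [exact H2|].
  apply vec_S_ext; [exact H3|]; apply functional_extensionality; intros i.
  apply (Fin.case0 (fun i => _ i = _ i) i).
Qed.

Definition cross (x y : vec 3) : vec 3 :=
  vec3 (x i2 * y i3 - x i3 * y i2) (x i3 * y i1 - x i1 * y i3) (x i1 * y i2 - x i2 * y i1).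

Definition so3 : liealg := mkLie 3 cross None.

Ltac ring3 := apply vec3_ext; simpl; unfold vadd, vscal, vopp, vzero; simpl; ring.

Lemma cross_lie : is_lie_bracket cross.
Proof.
  split; [intros y; split; intros; ring3|]; split; [intros x; split; intros; ring3|].
  split; intros; ring3.
Qed.

Lemma so3_simple : is_simple so3.
Proof.
  split; [exact cross_lie | split].
  - exists (vec3 1 0 0), (vec3 0 1 0); intros E.
    apply (f_equal (fun z => z i3)) in E; simpl in E; unfold vzero in E; lra.
  - simpl; intros I (_ & HA & HS & _ & HB).
    assert (F1 : I (vec3 1 0 0) -> forall x, I x).
    { intros H1 x.
      assert (H2 : I (vec3 0 1 0)).
      { replace (vec3 0 1 0) with (cross (vec3 0 0 1) (vec3 1 0 0)) by ring3; now apply HB. }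
      assert (H3 : I (vec3 0 0 1)).
      { replace (vec3 0 0 1) with (cross (vec3 1 0 0) (vec3 0 1 0)) by ring3; now apply HB. }
      replace x with (vadd (vscal (x i1) (vec3 1 0 0))
        (vadd (vscal (x i2) (vec3 0 1 0)) (vscal (x i3) (vec3 0 0 1)))) by ring3.
      auto. }
    assert (F2 : I (vec3 0 1 0) -> forall x, I x).
    { intros H; apply F1; replace (vec3 1 0 0) with
        (vscal (-1) (cross (vec3 0 0 1) (vec3 0 1 0))) by ring3; auto. }
    assert (F3 : I (vec3 0 0 1) -> forall x, I x).
    { intros H; apply F1; replace (vec3 1 0 0) with
        (cross (vec3 0 1 0) (vec3 0 0 1)) by ring3; auto. }
    destruct (classic (forall x, I x -> x = vzero 3)) as [|N]; [now left | right].
    apply not_all_ex_not in N; destruct N as [x N]; apply imply_to_and in N.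
    destruct N as [Ix Nx].
    (* For a unit vector [e], [x + e x (e x x)] is the orthogonal projection of [x] to the line of
       [e]. It lies in the ideal, so any nonzero coordinate of [x] puts a basis vector there. *)
    assert (D : forall e a f, I (vscal (/ a) (vadd x (cross e (cross e x)))) ->
      a <> 0 -> vadd x (cross e (cross e x)) = vscal a f -> I f).
    { intros e a f H Na E; rewrite E in H.
      replace f with (vscal (/ a) (vscal a f)); [exact H|].
      apply functional_extensionality; intros i; unfold vscal; field; exact Na. }
    assert (Q : forall e a, I (vscal (/ a) (vadd x (cross e (cross e x))))) by auto.
    destruct (Req_dec (x i1) 0) as [Z1|N1];
      [|apply F1, (D (vec3 1 0 0) (x i1)); auto; ring3].
    destruct (Req_dec (x i2) 0) as [Z2|N2];
      [|apply F2, (D (vec3 0 1 0) (x i2)); auto; ring3].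
    destruct (Req_dec (x i3) 0) as [Z3|N3];
      [|apply F3, (D (vec3 0 0 1) (x i3)); auto; ring3].
    exfalso; apply Nx, vec3_ext; assumption.
Qed.

(** The Killing form evaluates to -2 times the squared Euclidean norm. *)
Lemma so3_compact : Defs.compact so3.
Proof.
  intros x N; unfold killing; simpl.
  unfold ebasis; simpl.
  assert (P : 0 < x i1 * x i1 + x i2 * x i2 + x i3 * x i3); [|lra].
  apply Rnot_le_lt; intros H; apply N.
  apply vec3_ext; unfold vzero; simpl; nra.
Qed.

Lemma so3_admissible : admissible so3.
Proof. split; [exact so3_simple | split; [exact Logic.I | exact so3_compact]]. Qed.

(* The half-turn about the axis [(cos (t/2), sin (t/2), 0)]: after [2 pi] the axis is reversed but the half-turn is the same. *)
Definition half_turn (t : R) (x : vec 3) : vec 3 :=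
  vec3 (cos t * x i1 + sin t * x i2) (sin t * x i1 - cos t * x i2) (- x i3).

Definition axis (t : R) : vec 3 := vec3 (cos (t / 2)) (sin (t / 2)) 0.

Lemma cos2_sin2 t : cos t * cos t = 1 - sin t * sin t.
Proof. pose proof (sin2_cos2 t) as E; unfold Rsqr in E; lra. Qed.

Lemma half_turn_involutive t x : half_turn t (half_turn t x) = x.
Proof.
  pose proof (cos2_sin2 t) as E.
  apply vec3_ext; simpl.
  - transitivity ((cos t * cos t + sin t * sin t) * x i1); [ring | rewrite E; ring].
  - transitivity ((cos t * cos t + sin t * sin t) * x i2); [ring | rewrite E; ring].
  - ring.
Qed.

Lemma half_turn_gaut t : is_gaut so3 (half_turn t).
Proof.
  pose proof (cos2_sin2 t) as E.
  split; [split; [split; intros; ring3 | exact Logic.I]|]; split.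
  - intros x y; apply vec3_ext; simpl.
    + ring.
    + ring.
    + transitivity (- (cos t * cos t + sin t * sin t) * (x i1 * y i2 - x i2 * y i1));
        [rewrite E; ring | ring].
  - exists (half_turn t); split; apply half_turn_involutive.
Qed.

Lemma half_turn_periodic t x : half_turn (t + 2 * PI) x = half_turn t x.
Proof.
  unfold half_turn; rewrite cos_plus, sin_plus, cos_2PI, sin_2PI; f_equal; ring.
Qed.

Lemma vec3_smooth (a b c : R -> R) :
  smoothR a -> smoothR b -> smoothR c -> vsmooth (fun t => vec3 (a t) (b t) (c t)).
Proof.
  intros Ha Hb H i; apply (Fin.caseS' i); [exact Ha|]; clear i; intros i.
  apply (Fin.caseS' i); [exact Hb|]; clear i; intros i.
  apply (Fin.caseS' i); [exact H|]; clear i; intros i.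
  apply (Fin.case0 (fun _ => _) i).
Qed.

Definition twist (u : loop so3) : loop so3 := fun t => half_turn t (u t).

Lemma twist_inL u : inL so3 (fun x => x) u -> inL so3 (fun x => x) (twist u).
Proof.
  intros [Su Qu]; split.
  - apply vec3_smooth;
      repeat first [apply smoothR_plus | apply smoothR_minus | apply smoothR_mult
        | apply smoothR_opp | apply smoothR_sin_cos | apply Su].
  - intros t; unfold twist; rewrite half_turn_periodic; now rewrite Qu.
Qed.

Lemma twist_laut : is_laut so3 (fun x => x) twist.
Proof.
  assert (I : forall u, twist (twist u) = u).
  { intros u; apply functional_extensionality; intros t; apply half_turn_involutive. }
  split; [exact twist_inL|]; split; [|split; [|split; [exact Logic.I | split]]].
  - intros u v _ _; apply functional_extensionality; intros t.
    apply (rlinear_add (half_turn t)), (gaut_rlinear so3), half_turn_gaut.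
  - intros a u _; apply functional_extensionality; intros t.
    apply (rlinear_scal (half_turn t)), (gaut_rlinear so3), half_turn_gaut.
  - intros u v _ _; apply functional_extensionality; intros t; apply half_turn_gaut.
  - exists twist; split; [exact twist_inL | auto].
Qed.

Lemma half_turn_axis t : half_turn t (axis t) = axis t.
Proof.
  unfold half_turn, axis; simpl.
  replace (cos t) with (cos (2 * (t / 2))) by (f_equal; field).
  replace (sin t) with (sin (2 * (t / 2))) by (f_equal; field).
  rewrite cos_2a_sin, sin_2a.
  set (r := t / 2); pose proof (cos2_sin2 r) as E.
  f_equal; [| |ring].
  - transitivity (cos r); [ring | easy].
  - transitivity (sin r * (2 * (cos r * cos r) - 1 + 2 * sin r * sin r));
      [ring | rewrite E; ring].
Qed.

(** The half-turn is [x |-> 2 <a, x> a - x] with [a] its unit axis, so a fixed vector equals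
    [<a, x> a]. *)
Lemma half_turn_fixed t x :
  half_turn t x = x -> x = vscal (cos (t / 2) * x i1 + sin (t / 2) * x i2) (axis t).
Proof.
  intros H.
  pose proof (f_equal (fun z => z i1) H) as H1; pose proof (f_equal (fun z => z i2) H) as H2.
  pose proof (f_equal (fun z => z i3) H) as H3; simpl in H1, H2, H3.
  replace (cos t) with (cos (2 * (t / 2))) in H1, H2 by (f_equal; field).
  replace (sin t) with (sin (2 * (t / 2))) in H1, H2 by (f_equal; field).
  rewrite cos_2a_sin, sin_2a in H1, H2.
  set (r := t / 2) in *; pose proof (cos2_sin2 r) as E.
  apply vec3_ext; unfold vscal, axis; fold r; simpl.
  - transitivity (cos r * cos r * x i1 + sin r * cos r * x i2); [rewrite E; lra | ring].
  - transitivity (cos r * sin r * x i1 + (1 - cos r * cos r) * x i2);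
      [rewrite E; lra | rewrite E; ring].
  - lra.
Qed.

Lemma axis_shift m t : m = 1%Z \/ m = (-1)%Z -> axis (t + 2 * PI * IZR m) = vopp (axis t).
Proof.
  intros Hm; unfold axis.
  replace ((t + 2 * PI * IZR m) / 2) with (t / 2 + PI * IZR m) by field.
  rewrite cos_plus, sin_plus.
  assert (C : cos (PI * IZR m) = -1 /\ sin (PI * IZR m) = 0).
  { destruct Hm as [-> | ->].
    - rewrite Rmult_1_r, cos_PI, sin_PI; easy.
    - replace (PI * -1) with (- PI) by ring; rewrite cos_neg, sin_neg, cos_PI, sin_PI; lra. }
  destruct C as [-> ->]; ring3.
Qed.

Lemma axis_nonzero t : axis t <> vzero 3.
Proof.
  intros H; pose proof (f_equal (fun z => z i1) H) as H1.
  pose proof (f_equal (fun z => z i2) H) as H2; unfold axis, vzero in H1, H2; simpl in H1, H2.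
  pose proof (cos2_sin2 (t / 2)) as E; rewrite H1, H2 in E; lra.
Qed.

Lemma axis_smooth : vsmooth axis.
Proof.
  assert (S : smoothR (fun t => t / 2))
    by (apply smoothR_mult; [apply smoothR_id | apply smoothR_const]).
  apply vec3_smooth; [now apply smoothR_cos | now apply smoothR_sin | apply smoothR_const].
Qed.

(* The transported axis spans the fixed line of the constant automorphism [phi0], yet it is reversed after [2 pi], so it would have to vanish. *)
Theorem twist_not_constant :
  ~ (exists (chi : loop so3 -> loop so3) (phi0 : vec 3 -> vec 3) (lam : R -> R),
       is_laut so3 (fun x => x) chi /\ is_gaut so3 phi0 /\ is_diffeo lam /\
       forall u, inL so3 (fun x => x) u ->
         chi (twist u) = (fun t => phi0 (chi u (lam t)))).
Proof.
  intros (chi & phi0 & lam & Hchi & G0 & _ & H).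
  pose proof (gaut_id so3) as Gid.
  destruct (liso_structured so3 so3_simple Logic.I _ _ chi Gid Gid Hchi)
    as (mu & psi & psi' & m & St).
  pose proof (st_form _ _ _ _ _ _ _ _ St) as (Sm & Gpsi & Spsi & F).
  assert (Lpsi : forall t, rlinear (psi t)) by (intros; apply Gpsi).
  assert (psi_per : forall t x, psi (t + 2 * PI) x = psi t x).
  { intros t x; rewrite <- (st_shift _ _ _ _ _ _ _ _ St t x) at 1; f_equal.
    destruct (sigma_inv_spec so3 _ Gid) as (_ & E & _).
    symmetry; apply (zpow_ind _ (fun x => x) (sigma_inv so3 (fun x => x))
      (fun f => f x = x)); auto.
    intros f Ef; now rewrite Ef. }
  destruct (liso_inverse so3 so3_simple Logic.I _ _ chi Gid Gid Hchi) as (chi' & Hchi' & _ & K).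
  (* Writing a loop [w] as [chi u], the value of [chi (twist u)] at [t] depends on [w t] by the form
     of [chi], and on [w (lam t)] by hypothesis; so the two times agree modulo the period. *)
  assert (lam_per : forall t, exists k : Z, lam t = t + 2 * PI * IZR k).
  { intros t.
    apply (eval_separated so3 so3_simple (fun x => x)
      (fun x => psi t (half_turn (mu t) (psi' t x))) phi0); auto.
    - apply (gaut_comp so3 (psi t) (fun x => half_turn (mu t) (psi' t x))); auto.
      apply (gaut_comp so3 (half_turn (mu t)) (psi' t)); auto using half_turn_gaut.
      apply (st_inv_gaut _ _ _ _ _ _ _ _ St).
    - intros w Hw.
      assert (Hu : inL so3 (fun x => x) (chi' w)) by now apply Hchi'.
      pose proof (f_equal (fun v => v t) (H _ Hu)) as E; simpl in E.
      rewrite F, K in E by (auto using twist_inL).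
      rewrite <- E; unfold twist; do 2 f_equal.
      transitivity (psi' t (chi (chi' w) t)); [now rewrite K | rewrite F by exact Hu].
      apply (st_inv_l _ _ _ _ _ _ _ _ St). }
  (* Thus [psi t] conjugates the half-turn at [mu t] to the constant [phi0]. *)
  assert (Fix : forall t x, psi t (half_turn (mu t) x) = phi0 (psi t x)).
  { intros t x; set (u := local_section so3 (fun x => x) (mu t) x).
    assert (Hu : inL so3 (fun x => x) u) by now apply local_section_inL.
    assert (Eu : u (mu t) = x) by now apply local_section_at.
    pose proof (f_equal (fun v => v t) (H _ Hu)) as E; simpl in E.
    destruct (lam_per t) as [k Ek].
    rewrite F in E by now apply twist_inL.
    rewrite Ek, (periodic_Z _ (chi u)) in E by now apply Hchi.
    rewrite F in E by exact Hu; unfold twist in E; now rewrite Eu in E. }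
  set (M := fun t => psi t (axis (mu t))).
  assert (M_fix : forall t, phi0 (M t) = M t).
  { intros t; unfold M; now rewrite <- Fix, half_turn_axis. }
  assert (M_smooth : vsmooth M).
  { apply (vsmooth_app 3 3 psi (fun t => axis (mu t))); auto.
    now apply (vsmooth_comp 3 axis mu), axis_smooth. }
  assert (M_shift : M (0 + 2 * PI) = vopp (M 0)).
  { unfold M; rewrite psi_per, (st_lam_shift _ _ _ _ _ _ _ _ St), axis_shift
      by apply (st_deg _ _ _ _ _ _ _ _ St).
    apply rlinear_opp, Lpsi. }
  assert (psi_inj : forall t x, psi t x = vzero 3 -> x = vzero 3).
  { intros t x E; rewrite <- (st_inv_l _ _ _ _ _ _ _ _ St t x), E.
    apply rlinear_zero, (gaut_rlinear so3), (st_inv_gaut _ _ _ _ _ _ _ _ St). }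
  assert (M_nonzero : forall t, M t <> vzero 3).
  { intros t E; exact (axis_nonzero _ (psi_inj _ _ E)). }
  (* Pulled back by [psi 0], the fixed vector [M t] of [phi0] is fixed by one half-turn, hence a
     multiple of its axis. *)
  assert (M_line : forall t, exists a, M t = vscal a (M 0)).
  { intros t; set (w := psi' 0 (M t)).
    assert (Ew : psi 0 w = M t) by apply (st_inv_r _ _ _ _ _ _ _ _ St).
    assert (Hw : half_turn (mu 0) w = w).
    { rewrite <- (st_inv_l _ _ _ _ _ _ _ _ St 0 (half_turn (mu 0) w)), Fix, Ew.
      now rewrite M_fix. }
    apply half_turn_fixed in Hw; eexists.
    rewrite <- Ew, Hw at 1; apply (rlinear_scal _ (Lpsi 0)). }
  destruct (vec_neq _ _ _ (M_nonzero 0)) as (i & Ni); unfold vzero in Ni.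
  (* Coordinate [i] changes sign over a period. Where it vanishes, the factor [a] in [M t = a M 0]
     is 0, contradicting [M t <> 0]. *)
  destruct (IVT_gen (fun t => M t i) 0 (0 + 2 * PI) 0) as (t & _ & Et).
  - intros t; apply continuity_pt_filterlim, (smoothR_continuous (fun t => M t i)), M_smooth.
  - rewrite M_shift; unfold vopp, Rmin, Rmax; destruct (Rle_dec _ _); lra.
  - destruct (M_line t) as (a & Ea); apply (M_nonzero t); rewrite Ea in *.
    unfold vscal in Et; apply Rmult_integral in Et; destruct Et as [-> | E]; [vring | easy].
Qed.

Theorem theorem4p1 :
  (exists (g : liealg) (sigma : vec (ldim g) -> vec (ldim g))
          (Phi : loop g -> loop g),
     admissible g /\ is_gaut g sigma /\ is_laut g sigma Phi /\
     finite_order g sigma Phi /\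
     ~ (exists (chi : loop g -> loop g) (phi0 : vec (ldim g) -> vec (ldim g))
               (lam : R -> R),
          is_laut g sigma chi /\ is_gaut g phi0 /\ is_diffeo lam /\
          forall u, inL g sigma u ->
            chi (Phi u) = (fun t => phi0 (chi u (lam t)))))
  /\
  (forall (g : liealg) (sigma : vec (ldim g) -> vec (ldim g))
          (Phi : loop g -> loop g),
     admissible g -> is_gaut g sigma -> is_laut g sigma Phi ->
     finite_order g sigma Phi ->
     exists (sigma' : vec (ldim g) -> vec (ldim g)) (psi : loop g -> loop g)
            (phi0 : vec (ldim g) -> vec (ldim g)) (eps t0 : R),
       is_gaut g sigma' /\ is_liso g sigma sigma' psi /\ is_gaut g phi0 /\
       (eps = 1 \/ eps = -1) /\
       forall u, inL g sigma u ->
         psi (Phi u) = (fun t => phi0 (psi u (eps * t + t0)))).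
Proof.
  split.
  - exists so3, (fun x => x), twist.
    split; [exact so3_admissible | split; [apply gaut_id | split; [exact twist_laut|]]].
    split; [|exact twist_not_constant].
    exists 2%nat; split; [lia|]; intros u _; simpl.
    apply functional_extensionality; intros t; apply half_turn_involutive.
  - intros g sigma Phi (Hg & Hc & _); now apply finite_order_standard.
Qed.
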